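(* Let $(M^{4n+3},\phi_\alpha,\xi_\alpha,\eta_\alpha,g)$ be a $3$-cosymplectic manifold whose metric $g$ is flat. Then around each point of $M^{4n+3}$ there are local coordinates $\{x_1,\ldots,x_n,y_1,\ldots,y_n,u_1,\ldots,u_n,v_1,\ldots,v_n,z_1,z_2,z_3\}$ such that, for each $\alpha\in\{1,2,3\}$, $\eta_\alpha=dz_\alpha$, $\xi_\alpha=\frac{\partial}{\partial z_\alpha}$ and, moreover, $$\Phi_1=-2\sum_{i=1}^n(dx_i\wedge dy_i+du_i\wedge dv_i)-2\,dz_2\wedge dz_3,$$ $$\Phi_2=-2\sum_{i=1}^n(dx_i\wedge du_i-dy_i\wedge dv_i)+2\,dz_1\wedge dz_3,$$ $$\Phi_3=-2\sum_{i=1}^n(dx_i\wedge dv_i+dy_i\wedge du_i)-2\,dz_1\wedge dz_2,$$ and, with respect to the coordinate frame $\left(\frac{\partial}{\partial x_i},\frac{\partial}{\partial y_i},\frac{\partial}{\partial u_i},\frac{\partial}{\partial v_i},\frac{\partial}{\partial z_1},\frac{\partial}{\partial z_2},\frac{\partial}{\partial z_3}\right)$ (in this block order), $\phi_1,\phi_2,\phi_3$ are represented respectively by the $(4n+3)\times(4n+3)$ matrices $$\phi_1=\begin{pmatrix}0&-I_n&0&0&0&0&0\\ I_n&0&0&0&0&0&0\\ 0&0&0&-I_n&0&0&0\\ 0&0&I_n&0&0&0&0\\ 0&0&0&0&0&0&0\\ 0&0&0&0&0&0&-1\\ 0&0&0&0&0&1&0\end{pmatrix},$$ $$\phi_2=\begin{pmatrix}0&0&-I_n&0&0&0&0\\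 0&0&0&I_n&0&0&0\\ I_n&0&0&0&0&0&0\\ 0&-I_n&0&0&0&0&0\\ 0&0&0&0&0&0&1\\ 0&0&0&0&0&0&0\\ 0&0&0&0&-1&0&0\end{pmatrix},$$ $$\phi_3=\begin{pmatrix}0&0&0&-I_n&0&0&0\\ 0&0&-I_n&0&0&0&0\\ 0&I_n&0&0&0&0&0\\ I_n&0&0&0&0&0&0\\ 0&0&0&0&0&-1&0\\ 0&0&0&0&1&0&0\\ 0&0&0&0&0&0&0\end{pmatrix}.$$
   Context: An almost contact structure on an odd-dimensional manifold $M$ is a triple $(\phi,\xi,\eta)$ with $\phi$ a $(1,1)$-tensor field, $\xi$ a vector field, $\eta$ a $1$-form, such that $\phi^2=-I+\eta\otimes\xi$, $\eta(\xi)=1$. It is normal if $[\phi,\phi]+2d\eta\otimes\xi=0$, where $[\phi,\phi]$ is the Nijenhuis tensor of $\phi$. A Riemannian metric $g$ is compatible if $g(\phi E,\phi F)=g(E,F)-\eta(E)\eta(F)$; then the fundamental $2$-form is $\Phi(E,F)=g(E,\phi F)$. An almost $3$-contact metric manifold is a $(4n+3)$-dimensional smooth manifold with three almost contact structures $(\phi_\alpha,\xi_\alpha,\eta_\alpha)$, $\alpha\in\{1,2,3\}$, and a Riemannian metric $g$ compatible with each of them, such that for all $\alpha,\beta$: $\phi_\alpha\phi_\beta-\eta_\beta\otimes\xi_\alpha=\sum_\gamma\epsilon_{\alpha\beta\gamma}\phi_\gamma-\delta_{\alpha\beta}I$, $\phi_\alpha\xi_\beta=\sum_\gamma\epsilon_{\alpha\beta\gamma}\xi_\gamma$,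 $\eta_\alpha\circ\phi_\beta=\sum_\gamma\epsilon_{\alpha\beta\gamma}\eta_\gamma$, where $\epsilon_{\alpha\beta\gamma}$ is the totally antisymmetric symbol. It is $3$-cosymplectic if for each $\alpha$ one has $d\eta_\alpha=0$, $d\Phi_\alpha=0$ and the structure $(\phi_\alpha,\xi_\alpha,\eta_\alpha)$ is normal. Conventions: $(\omega\wedge\theta)(E,F)=\frac12(\omega(E)\theta(F)-\omega(F)\theta(E))$ for $1$-forms, and $2d\eta(E,F)=E(\eta(F))-F(\eta(E))-\eta([E,F])$. Flat means that the Riemann curvature tensor of $g$ vanishes identically. *)

(* Defs.v *)
From HB Require Import structures.
From mathcomp Require Import all_boot all_order all_algebra.
From mathcomp Require Import all_classical all_reals all_analysis.
Set Implicit Arguments.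
Unset Strict Implicit.
Unset Printing Implicit Defensive.
Import Order.TTheory GRing.Theory Num.Theory.
Import numFieldNormedType.Exports.
Local Open Scope classical_set_scope.
Local Open Scope ring_scope.

(* Points of R^m and tangent vectors are columns, covectors are rows, and the
   matrix of an endomorphism has the images of the frame as its columns. *)
Definition frame (R : realType) (m : nat) (j : 'I_m) : 'cV[R]_m :=
  delta_mx j 0.

Fixpoint Ck (R : realType) (m k : nat) (U : set 'cV[R]_m) (f : 'cV[R]_m -> R)
    : Prop :=
  (forall x, U x -> {for x, continuous f}) /\
  (if k is k'.+1 then
     forall j : 'I_m, (forall x, U x -> derivable f x (frame R j)) /\
                      Ck k' U ('D_(frame R j) f)
   else True).

Definition smooth_on (R : realType) (m p q : nat) (U : set 'cV[R]_m)
    (f : 'cV[R]_m -> 'M[R]_(p, q)) : Prop :=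
  forall (i : 'I_p) (j : 'I_q) (k : nat), Ck k U (fun x => f x i j).

Definition jac (R : realType) (m p : nat) (f : 'cV[R]_m -> 'cV[R]_p)
    (x : 'cV[R]_m) : 'M[R]_(p, m) :=
  \matrix_(i, j) 'D_(frame R j) (fun y => f y i 0) x.

(* [cinv] is only meaningful on the image of [cmap]. *)
Record chart (R : realType) (M : topologicalType) (m : nat) := Chart {
  cdom : set M;
  cmap : M -> 'cV[R]_m;
  cinv : 'cV[R]_m -> M;
  cdom_open : open cdom;
  cimg_open : open (cmap @` cdom);
  cmapK : forall p, cdom p -> cinv (cmap p) = p;
  cmap_cts : forall p, cdom p -> {for p, continuous cmap};
  cinv_cts : forall x, (cmap @` cdom) x -> {for x, continuous cinv} }.

Definition cimg (R : realType) (M : topologicalType) (m : nat)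
  (c : chart R M m) : set 'cV[R]_m := cmap c @` cdom c.

Definition transition (R : realType) (M : topologicalType) (m : nat)
  (c c' : chart R M m) : 'cV[R]_m -> 'cV[R]_m := cmap c' \o cinv c.

Definition compatible_charts (R : realType) (M : topologicalType) (m : nat)
    (c c' : chart R M m) : Prop :=
  smooth_on (cmap c @` (cdom c `&` cdom c')) (transition c c') /\
  smooth_on (cmap c' @` (cdom c `&` cdom c')) (transition c' c).

(* The atlas is maximal: its members are all the local coordinate systems. *)
Record manifold (R : realType) (M : topologicalType) (m : nat) := Manifold {
  atlas : set (chart R M m);
  atlas_cover : forall p : M, exists2 c, atlas c & cdom c p;
  atlas_compat : forall c c', atlas c -> atlas c' -> compatible_charts c c';
  atlas_max : forall c, (forall c', atlas c' -> compatible_charts c c') ->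
    atlas c;
  manifold_hausdorff : hausdorff_space M;
  manifold_second_countable : @second_countable M }.

(* A tensor field assigns to every chart of the atlas smooth components, as
   functions of the coordinates, which obey the tensor transformation law under
   changes of chart. *)
Section TensorFields.
Context (R : realType) (M : topologicalType) (m : nat) (S : manifold R M m).

Definition transforms (p q : nat) (T : chart R M m -> 'cV[R]_m -> 'M[R]_(p, q))
    (law : 'M[R]_m -> 'M[R]_(p, q) -> 'M[R]_(p, q) -> Prop) : Prop :=
  forall c c', atlas S c -> atlas S c' ->
  forall a, cdom c a -> cdom c' a ->
  law (jac (transition c c') (cmap c a)) (T c (cmap c a)) (T c' (cmap c' a)).

Record vector_field := VectorField {
  vf_comp :> chart R M m -> 'cV[R]_m -> 'cV[R]_m;
  vf_smooth : forall c, atlas S c -> smooth_on (cimg c) (vf_comp c);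
  vf_law : transforms vf_comp (fun J v v' => v' = J *m v) }.

Record one_form := OneForm {
  of_comp :> chart R M m -> 'cV[R]_m -> 'rV[R]_m;
  of_smooth : forall c, atlas S c -> smooth_on (cimg c) (of_comp c);
  of_law : transforms of_comp (fun J w w' => w = w' *m J) }.

Record endo_field := EndoField {
  ef_comp :> chart R M m -> 'cV[R]_m -> 'M[R]_m;
  ef_smooth : forall c, atlas S c -> smooth_on (cimg c) (ef_comp c);
  ef_law : transforms ef_comp (fun J A A' => A' *m J = J *m A) }.

Record riemannian_metric := RiemannianMetric {
  rm_comp :> chart R M m -> 'cV[R]_m -> 'M[R]_m;
  rm_smooth : forall c, atlas S c -> smooth_on (cimg c) (rm_comp c);
  rm_law : transforms rm_comp (fun J g g' => g = J^T *m g' *m J);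
  rm_sym : forall c x, atlas S c -> cimg c x -> (rm_comp c x)^T = rm_comp c x;
  rm_pos : forall c x (v : 'cV[R]_m), atlas S c -> cimg c x -> v != 0 ->
    0 < (v^T *m rm_comp c x *m v) 0 0 }.

End TensorFields.

Section Calculus.
Context (R : realType) (m : nat).
Notation V := 'cV[R]_m.

Definition pairing (w : 'rV[R]_m) (v : V) : R := (w *m v) 0 0.
Definition bilin (g : 'M[R]_m) (u v : V) : R := (u^T *m g *m v) 0 0.
Definition apply_endo (phi : V -> 'M[R]_m) (E : V -> V) : V -> V :=
  fun x => phi x *m E x.

(* As an endomorphism, (eta (x) xi) E = eta(E) xi. *)
Definition tensor (eta : 'rV[R]_m) (xi : V) : 'M[R]_m := xi *m eta.

Definition lie_deriv (E : V -> V) (f : V -> R) : V -> R :=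
  fun x => 'D_(E x) f x.

Definition bracket (E F : V -> V) : V -> V :=
  fun x => 'D_(E x) F x - 'D_(F x) E x.

(* Exterior derivatives and wedge products carry the Kobayashi-Nomizu factors
   1/(p+1) and 1/2. *)
Definition d_one_form (eta : V -> 'rV[R]_m) (E F : V -> V) : V -> R := fun x =>
  2^-1 * (lie_deriv E (fun y => pairing (eta y) (F y)) x
          - lie_deriv F (fun y => pairing (eta y) (E y)) x
          - pairing (eta x) (bracket E F x)).

Definition d_two_form (Phi : V -> V -> V -> R) (E F G : V -> V) : V -> R :=
  fun x =>
  3^-1 * (lie_deriv E (fun y => Phi y (F y) (G y)) x
          + lie_deriv F (fun y => Phi y (G y) (E y)) x
          + lie_deriv G (fun y => Phi y (E y) (F y)) x
          - Phi x (bracket E F x) (G x)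
          - Phi x (bracket F G x) (E x)
          - Phi x (bracket G E x) (F x)).

Definition nijenhuis (phi : V -> 'M[R]_m) (E F : V -> V) : V -> V := fun x =>
  phi x *m (phi x *m bracket E F x)
  + bracket (apply_endo phi E) (apply_endo phi F) x
  - phi x *m bracket (apply_endo phi E) F x
  - phi x *m bracket E (apply_endo phi F) x.

Definition fundamental_form (g phi : V -> 'M[R]_m) : V -> V -> V -> R :=
  fun x u v => bilin (g x) u (phi x *m v).

(* Christoffel symbols of the Levi-Civita connection; [invmx (g x) k l] is the
   contravariant metric g^{kl}. *)
Definition christoffel (g : V -> 'M[R]_m) (k i j : 'I_m) (x : V) : R :=
  2^-1 * \sum_(l < m) invmx (g x) k l *
    ('D_(frame R i) (fun y => g y j l) x
     + 'D_(frame R j) (fun y => g y i l) x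
     - 'D_(frame R l) (fun y => g y i j) x).

Definition cov_deriv (g : V -> 'M[R]_m) (E F : V -> V) : V -> V := fun x =>
  'D_(E x) F x
  + \col_k \sum_(i < m) \sum_(j < m) christoffel g k i j x * E x i 0 * F x j 0.

Definition riemann (g : V -> 'M[R]_m) (E F G : V -> V) : V -> V := fun x =>
  cov_deriv g E (cov_deriv g F G) x
  - cov_deriv g F (cov_deriv g E G) x
  - cov_deriv g (bracket E F) G x.

Definition differential (f : V -> R) (x : V) : 'rV[R]_m :=
  \row_j 'D_(frame R j) f x.

Definition dcoord (i : 'I_m) : V -> 'rV[R]_m :=
  differential (fun x => x i 0).

Definition wedge (w t : 'rV[R]_m) (u v : V) : R :=
  2^-1 * (pairing w u * pairing t v - pairing w v * pairing t u).

End Calculus.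

Section Contact.
Context (R : realType) (M : topologicalType) (m : nat) (S : manifold R M m).

Definition almost_contact (phi : endo_field S) (xi : vector_field S)
    (eta : one_form S) : Prop :=
  forall c x, atlas S c -> cimg c x ->
  phi c x *m phi c x = - 1%:M + tensor (eta c x) (xi c x) /\
  pairing (eta c x) (xi c x) = 1.

Definition compatible_metric (phi : endo_field S) (eta : one_form S)
    (g : riemannian_metric S) : Prop :=
  forall c x (u v : 'cV[R]_m), atlas S c -> cimg c x ->
  bilin (g c x) (phi c x *m u) (phi c x *m v) =
  bilin (g c x) u v - pairing (eta c x) u * pairing (eta c x) v.

(* In this and the next predicates E, F, G range over all smooth vector fields on
   the domain of the chart, in components. *)
Definition closed_one_form (eta : one_form S) : Prop :=
  forall c (E F : 'cV[R]_m -> 'cV[R]_m), atlas S c ->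
  smooth_on (cimg c) E -> smooth_on (cimg c) F ->
  forall x, cimg c x -> d_one_form (eta c) E F x = 0.

Definition closed_fundamental_form (g : riemannian_metric S)
    (phi : endo_field S) : Prop :=
  forall c (E F G : 'cV[R]_m -> 'cV[R]_m), atlas S c ->
  smooth_on (cimg c) E -> smooth_on (cimg c) F -> smooth_on (cimg c) G ->
  forall x, cimg c x ->
  d_two_form (fundamental_form (g c) (phi c)) E F G x = 0.

Definition normal_structure (phi : endo_field S) (xi : vector_field S)
    (eta : one_form S) : Prop :=
  forall c (E F : 'cV[R]_m -> 'cV[R]_m), atlas S c ->
  smooth_on (cimg c) E -> smooth_on (cimg c) F ->
  forall x, cimg c x ->
  nijenhuis (phi c) E F x + (2 * d_one_form (eta c) E F x) *: xi c x = 0.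

Definition flat_metric (g : riemannian_metric S) : Prop :=
  forall c (E F G : 'cV[R]_m -> 'cV[R]_m), atlas S c ->
  smooth_on (cimg c) E -> smooth_on (cimg c) F -> smooth_on (cimg c) G ->
  forall x, cimg c x -> riemann (g c) E F G x = 0.

(* The indices 1, 2, 3 are the elements 0, 1, 2 of 'I_3. *)
Definition eps (a b c : 'I_3) : R :=
  let t := (val a, val b, val c) in
  if t \in [:: (0, 1, 2); (1, 2, 0); (2, 0, 1)]%N then 1
  else if t \in [:: (0, 2, 1); (2, 1, 0); (1, 0, 2)]%N then -1
  else 0.

Definition three_contact_identities (phi : 'I_3 -> endo_field S)
    (xi : 'I_3 -> vector_field S) (eta : 'I_3 -> one_form S) : Prop :=
  forall (a b : 'I_3) c x, atlas S c -> cimg c x ->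
  [/\ phi a c x *m phi b c x - tensor (eta b c x) (xi a c x) =
        \sum_(d < 3) eps a b d *: phi d c x - ((a == b)%:R)%:M,
      phi a c x *m xi b c x = \sum_(d < 3) eps a b d *: xi d c x
    & eta a c x *m phi b c x = \sum_(d < 3) eps a b d *: eta d c x].

End Contact.

(* dimension 4n + 3, split into the coordinate blocks x, y, u, v, z *)
Definition dim3c (n : nat) : nat := (n + (n + (n + (n + 3))))%N.

Lemma dim3cE (n : nat) : dim3c n = (4 * n + 3)%N.
Proof. by rewrite /dim3c !mulSn mul0n addn0 !addnA. Qed.

Definition almost_3contact_metric (R : realType) (M : topologicalType)
    (n : nat) (S : manifold R M (dim3c n)) (phi : 'I_3 -> endo_field S)
    (xi : 'I_3 -> vector_field S) (eta : 'I_3 -> one_form S)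
    (g : riemannian_metric S) : Prop :=
  [/\ forall a, almost_contact (phi a) (xi a) (eta a),
      forall a, compatible_metric (phi a) (eta a) g
    & three_contact_identities phi xi eta].

Definition three_cosymplectic (R : realType) (M : topologicalType)
    (n : nat) (S : manifold R M (dim3c n)) (phi : 'I_3 -> endo_field S)
    (xi : 'I_3 -> vector_field S) (eta : 'I_3 -> one_form S)
    (g : riemannian_metric S) : Prop :=
  almost_3contact_metric phi xi eta g /\
  forall a, [/\ closed_one_form (eta a),
                closed_fundamental_form g (phi a)
              & normal_structure (phi a) (xi a) (eta a)].

Definition i1 : 'I_3 := @Ordinal 3 0 isT.
Definition i2 : 'I_3 := @Ordinal 3 1 isT.
Definition i3 : 'I_3 := @Ordinal 3 2 isT.

Section Model.
Context (R : realType) (n : nat).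

Definition ix (i : 'I_n) : 'I_(dim3c n) := lshift (n + (n + (n + 3))) i.
Definition iy (i : 'I_n) : 'I_(dim3c n) := rshift n (lshift (n + (n + 3)) i).
Definition iu (i : 'I_n) : 'I_(dim3c n) :=
  rshift n (rshift n (lshift (n + 3) i)).
Definition iv (i : 'I_n) : 'I_(dim3c n) :=
  rshift n (rshift n (rshift n (lshift 3 i))).
Definition iz (a : 'I_3) : 'I_(dim3c n) :=
  rshift n (rshift n (rshift n (rshift n a))).

Definition brow (k : nat) (a b c d : 'M[R]_(k, n)) (e f h : 'M[R]_(k, 1))
    : 'M[R]_(k, dim3c n) :=
  row_mx a (row_mx b (row_mx c (row_mx d (row_mx e (row_mx f h))))).

Definition bcol (k : nat) (a b c d : 'M[R]_(n, k)) (e f h : 'M[R]_(1, k))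
    : 'M[R]_(dim3c n, k) :=
  col_mx a (col_mx b (col_mx c (col_mx d (col_mx e (col_mx f h))))).

Local Notation I := (1%:M : 'M[R]_(_, _)).

Definition phi1_mx : 'M[R]_(dim3c n) := bcol
  (brow 0 (-I) 0 0    0 0 0)
  (brow I 0    0 0    0 0 0)
  (brow 0 0    0 (-I) 0 0 0)
  (brow 0 0    I 0    0 0 0)
  (brow 0 0    0 0    0 0 0)
  (brow 0 0    0 0    0 0 (-I))
  (brow 0 0    0 0    0 I 0).

Definition phi2_mx : 'M[R]_(dim3c n) := bcol
  (brow 0 0    (-I) 0 0    0 0)
  (brow 0 0    0    I 0    0 0)
  (brow I 0    0    0 0    0 0)
  (brow 0 (-I) 0    0 0    0 0)
  (brow 0 0    0    0 0    0 I)
  (brow 0 0    0    0 0    0 0)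
  (brow 0 0    0    0 (-I) 0 0).

Definition phi3_mx : 'M[R]_(dim3c n) := bcol
  (brow 0 0 0    (-I) 0 0    0)
  (brow 0 0 (-I) 0    0 0    0)
  (brow 0 I 0    0    0 0    0)
  (brow I 0 0    0    0 0    0)
  (brow 0 0 0    0    0 (-I) 0)
  (brow 0 0 0    0    I 0    0)
  (brow 0 0 0    0    0 0    0).

End Model.

(* Main.v *)
Require Import Defs.
From HB Require Import structures.
From mathcomp Require Import all_boot all_order all_algebra.
From mathcomp Require Import all_classical all_reals all_analysis.
From mathcomp Require Import ring lra zify.
Set Implicit Arguments.
Unset Strict Implicit.
Unset Printing Implicit Defensive.
Import Order.TTheory GRing.Theory Num.Theory.
Import numFieldNormedType.Exports.
Local Open Scope classical_set_scope.
Local Open Scope ring_scope.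

(** Differentiable dependence of solutions of differential equations on parameters is never invoked.
    The derivative of the ray solution is guessed from the equation, and the error of the guess is
    shown to be quadratic in the step. This needs bounds on the coefficients and their derivatives
    up to order two, and a ball so small that the coefficient along each ray has norm at most 1/4;
    that one constant makes Picard iteration contract by 1/2 and closes the growth estimate without
    exponentials.

    [Ck] speaks only of partial derivatives, so continuity, total differentiability and the chain
    rule are recovered from a Lipschitz estimate along coordinate steps.

    The coframe is normalised to the identity at the base point, where it is the Jacobian of the new
    coordinates; the inverse function theorem then yields a chart whose image is a ball. On a ball a
    tensor with vanishing derivatives is constant, so a basis chosen at one point serves the whole
    chart.

    Each of the three structures is shown to be parallel separately; the relations between different
    structures enter only in the choice of the basis. *)

(* A flat metric has charts in which its components are constant: a parallel
   coframe solves a linear total differential system whose integrability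
   condition is the vanishing of the curvature, and it is closed because the
   connection is torsion-free.  The system is solved along rays; a Gronwall
   estimate comparing the solutions along neighbouring rays shows that the
   result satisfies the equation in every direction, and its smoothness is then
   bootstrapped from the equation.

   In such a chart the Levi-Civita connection is the coordinate derivative D.
   Closedness of eta and Phi and normality, tested on constant vector fields,
   force D xi = 0 and D phi = 0 by linear algebra, so all structure tensors are
   constant.  A linear change of coordinates to a basis of the form
   (e_i, phi_1 e_i, phi_2 e_i, phi_3 e_i, xi_1, xi_2, xi_3), orthonormal for the
   metric, brings them to the model. *)

Local Ltac ilra := repeat match goal with
  H : is_true (_ && _) |- _ => move/andP: H => [? ?] end;
  try (apply/andP; split); lra.

Local Ltac mxring := apply/matrixP => ? ?; rewrite !mxE; ring.

(** * Differential calculus on coordinate space *)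

Lemma mx_entry_le (R : realType) (m n : nat) (A : 'M[R]_(m, n)) i j :
  `|A i j| <= `|A|.
Proof.
by rewrite [leRHS]/Num.Def.normr/= mx_normrE; exact: (le_bigmax _ _ (i, j)).
Qed.

Lemma mx_norm_le (R : realType) (m n : nat) (A : 'M[R]_(m, n)) e :
  0 <= e -> (forall i j, `|A i j| <= e) -> `|A| <= e.
Proof.
move=> e0 Ae; rewrite [leLHS]/Num.Def.normr/= mx_normrE.
by apply: bigmax_le => // -[i j] _; exact: Ae.
Qed.

Lemma ball_mxE (R : realType) (m n : nat) (x y : 'M[R]_(m, n)) e :
  ball x e y <-> `|y - x| < e.
Proof. by rewrite -ball_normE /ball_ /= distrC. Qed.

Lemma open_norm_ball (R : realType) m (x0 : 'cV[R]_m) r : open [set x | `|x - x0| < r].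
Proof.
rewrite (_ : mkset _ = ball x0 r); first exact: ball_open.
by apply/seteqP; split => x /ball_mxE.
Qed.

Lemma open_ballP (R : realType) (m n : nat) (U : set 'M[R]_(m, n)) x :
  open U -> U x -> exists2 d, 0 < d & forall y, `|y - x| < d -> U y.
Proof.
move=> oU Ux; have /nbhs_ballP[d d0 dU] := open_nbhs_nbhs (conj oU Ux).
by exists d => // y yx; apply: dU; apply/ball_mxE.
Qed.

(** Clearing the denominator of the difference quotient makes [h = 0] harmless and leaves
    inequalities that can be added and composed. *)
Lemma is_deriveP (R : realType) (V W : normedModType R) (f : V -> W) x v l :
  is_derive x v f l <-> forall e, 0 < e -> exists2 d, 0 < d &
    forall h, `|h| < d -> `|f (h *: v + x) - f x - h *: l| <= e * `|h|.
Proof.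
split.
- move=> [df <-] e e0.
  have /cvgrPdist_le/(_ e e0)[d d0 H] := df.
  exists d => // h hd.
  have [->|h0] := eqVneq h 0.
    by rewrite !scale0r add0r subrr subr0 !normr0 mulr0.
  have := H h; rewrite /= /ball_ /= sub0r normrN => /(_ hd h0) Hh.
  have -> : f (h *: v + x) - f x - h *: 'D_v f x =
     - (h *: ('D_v f x - h^-1 *: (f (h *: v + x) - f x))).
    by rewrite [in RHS]scalerBr scalerA divff// scale1r opprB.
  by rewrite normrN normrZ mulrC ler_wpM2r.
- move=> H.
  have cl : (fun h => h^-1 *: ((f \o shift x) (h *: v) - f x)) @ 0^' --> l.
    apply/cvgrPdist_le => e e0; have [d d0 Hd] := H e e0.
    exists d => //= h; rewrite /ball_ /= sub0r normrN => hd h0.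
    have -> : l - h^-1 *: (f (h *: v + x) - f x) =
       - (h^-1 *: (f (h *: v + x) - f x - h *: l)).
      by rewrite [in RHS]scalerBr scalerA mulVf// scale1r opprB.
    rewrite normrN normrZ normfV ler_pdivrMl ?normr_gt0// mulrC; exact: Hd.
  split; first by apply/cvg_ex; exists l.
  exact/cvg_lim.
Qed.

Lemma continuous_atP (R : realType) (V W : normedModType R) (f : V -> W) x :
  {for x, continuous f} <-> forall e, 0 < e -> exists2 d, 0 < d &
    forall y, `|y - x| < d -> `|f y - f x| <= e.
Proof.
split.
- move=> /cvgrPdist_le H e e0; have /nbhs_ballP[d /= d0 Hd] := H e e0.
  exists d => // y yx; rewrite distrC; apply: Hd.
  by rewrite -ball_normE /ball_ /= distrC.
- move=> H; apply/cvgrPdist_le => e e0; have [d d0 Hd] := H e e0.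
  apply/nbhs_ballP; exists d => //= y; rewrite -ball_normE /ball_ /= distrC => yx.
  by rewrite distrC; exact: Hd.
Qed.

Lemma is_derive_continuous (R : realType) (W : normedModType R) (f : R -> W) (x : R) l :
  is_derive x 1 f l -> {for x, continuous f}.
Proof.
by move=> [df _]; apply: differentiable_continuous; exact/derivable1_diffP.
Qed.

Lemma is_derive_mxP (R : realType) (V : normedModType R) m n
    (A : V -> 'M[R]_(m, n)) x v l :
  is_derive x v A l <-> forall i j, is_derive x v (fun y => A y i j) (l i j).
Proof.
split.
- move=> [dA Al] i j.
  have /derivable_mxP dAij := dA.
  split; first exact: dAij.
  by move: Al; rewrite derive_mx// => <-; rewrite mxE.
- move=> H; have dA : derivable A x v.
    by apply/derivable_mxP => i j; have [] := H i j.
  split => //; rewrite derive_mx//; apply/matrixP => i j; rewrite mxE.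
  by have [] := H i j.
Qed.

Lemma is_derive_line (R : realType) (V W : normedModType R) (f : V -> W)
    (x v : V) (t : R) l :
  is_derive (t *: v + x) v f l -> is_derive t 1 (fun s : R => f (s *: v + x)) l.
Proof.
move=> /is_deriveP H; apply/is_deriveP => e /H[d d0 Hd]; exists d => // h /Hd.
by rewrite [h *: 1 : R^o]mulr1 scalerDl addrA.
Qed.

(** The [min]/[max] bounds allow steps of either sign, as occur with increments [h] of a directional
    derivative. *)
Lemma mean_value_le (R : realType) (f df : R -> R) (a b K : R) :
  (forall t, Num.min a b <= t <= Num.max a b -> is_derive t 1 f (df t)) ->
  (forall t, Num.min a b <= t <= Num.max a b -> `|df t| <= K) ->
  `|f b - f a| <= K * `|b - a|.
Proof.
wlog ab : a b / a <= b.
  move=> H; have /orP[ab|ba] := le_total a b; first exact: H.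
  rewrite minC maxC => h1 h2; rewrite distrC (distrC b a).
  exact: H b a ba h1 h2.
rewrite (min_idPl ab) (max_idPr ab) => fdf dfK.
have [||c cab ->] := @MVT_segment R f df a b ab.
- by move=> t; rewrite in_itv /= => /andP[at_ tb]; apply: fdf; rewrite !ltW.
- apply: continuous_in_subspaceT => t; rewrite inE/= in_itv/= => /fdf.
  exact: is_derive_continuous.
by rewrite normrM ler_wpM2r// dfK//; move: cab; rewrite in_itv.
Qed.

Lemma mx_norm_lt (R : realType) (m n : nat) (A : 'M[R]_(m, n)) e :
  0 < e -> (forall i j, `|A i j| < e) -> `|A| < e.
Proof.
move=> e0 Ae; rewrite [ltLHS]/Num.Def.normr/= mx_normrE.
by apply: bigmax_lt => // -[i j] _; exact: Ae.
Qed.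

(** Each of the [m] coordinate steps costs at most [K] times the norm of [y - z]. This is the source
    of the continuity, total differentiability and constancy results below. *)
Lemma partial_lipschitz (R : realType) m (g : 'cV[R]_m -> R) x0 r K :
  (forall x, `|x - x0| < r -> forall j, derivable g x (frame R j) /\
     `|'D_(frame R j) g x| <= K) ->
  forall y z, `|y - x0| < r -> `|z - x0| < r ->
  `|g y - g z| <= m%:R * K * `|y - z|.
Proof.
move=> gK y z yr zr.
have r0 : 0 < r by exact: le_lt_trans yr.
(* Move from z to y one coordinate at a time; sup-norm balls are boxes. *)
pose hyb k : 'cV[R]_m := \col_i (if (i < k)%N then y i 0 else z i 0).
have h0 : hyb 0%N = z by apply/colP => i; rewrite mxE.
have hm : hyb m = y by apply/colP => i; rewrite mxE ltn_ord.
have step (k : 'I_m) : `|g (hyb k.+1) - g (hyb k)| <= K * `|y - z|.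
  have -> : hyb k.+1 = (y k 0 - z k 0) *: frame R k + hyb k.
    apply/colP => i; rewrite !mxE eqxx andbT ltnS.
    have [->|ik] := eqVneq i k; first by rewrite leqnn ltnn mulr1 subrK.
    by rewrite mulr0 add0r leq_eqVlt -val_eqE /= in ik *; rewrite (negbTE ik).
  have inb t : Num.min 0 (y k 0 - z k 0) <= t <= Num.max 0 (y k 0 - z k 0) ->
      `|t *: frame R k + hyb k - x0| < r.
    move=> tb; apply: mx_norm_lt => // i j; rewrite (ord1 j) {j} !mxE andbT.
    have yi : `|y i 0 - x0 i 0| < r.
      by apply: le_lt_trans yr; have := mx_entry_le (y - x0) i 0; rewrite !mxE.
    have zi : `|z i 0 - x0 i 0| < r.
      by apply: le_lt_trans zr; have := mx_entry_le (z - x0) i 0; rewrite !mxE.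
    have [ik|ik] := eqVneq i k; last by rewrite mulr0 add0r; case: ifP.
    subst i; rewrite ltnn mulr1; move: tb yi zi.
    rewrite !ltr_norml => /andP[+ +] /andP[+ +] /andP[].
    by case: (leP 0 (y k 0 - z k 0)) => ? *; apply/andP; split; lra.
  have -> : g (hyb k) = g (0 *: frame R k + hyb k) by rewrite scale0r add0r.
  apply: le_trans (_ : _ <= K * `|y k 0 - z k 0 - 0|) _.
    apply: (@mean_value_le _ (fun s => g (s *: frame R k + hyb k))
       (fun s => 'D_(frame R k) g (s *: frame R k + hyb k))).
    - move=> t tb; apply: is_derive_line; split=> //.
      by have [] := gK _ (inb _ tb) k.
    - by move=> t tb; have [] := gK _ (inb _ tb) k.
  rewrite subr0; apply: ler_wpM2l; last first.
    by have := mx_entry_le (y - z) k 0; rewrite !mxE.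
  by have [_] := gK _ yr k; apply: le_trans.
have tel : forall k, (k <= m)%N ->
    `|g (hyb k) - g (hyb 0%N)| <= k%:R * (K * `|y - z|).
  elim=> [|k IH] km; first by rewrite subrr normr0 mul0r.
  have -> : g (hyb k.+1) - g (hyb 0%N) =
     (g (hyb k.+1) - g (hyb k)) + (g (hyb k) - g (hyb 0%N)).
    by rewrite addrA subrK.
  rewrite (le_trans (ler_normD _ _))// mulrSr mulrDl mul1r addrC lerD//.
    exact/IH/ltnW.
  exact: step (Ordinal km).
by have := tel m (leqnn m); rewrite h0 hm mulrA.
Qed.

Lemma near_finite (R : realType) (V : normedModType R) (J : finType)
    (P : J -> V -> Prop) x0 :
  (forall j, exists2 d, 0 < d & forall y, `|y - x0| < d -> P j y) ->
  exists2 d, 0 < d & forall y, `|y - x0| < d -> forall j, P j y.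
Proof.
move=> Hj; pose dd j := s2val (cid2 (Hj j)).
exists (\big[Num.min/1]_j dd j).
  apply: lt_bigmin => // j _; exact: (s2valP (cid2 (Hj j))).
move=> y yx j; apply: (s2valP' (cid2 (Hj j))).
by apply: lt_le_trans yx _; exact: bigmin_le_cond.
Qed.

(** Total differentiability, with the gradient read off from the partial derivatives. The chain rule
    needs this form, since partial derivatives alone do not survive composition. *)
Definition frechet (R : realType) m (f : 'cV[R]_m -> R) x :=
  forall e, 0 < e -> exists2 d, 0 < d & forall y, `|y - x| < d ->
  `|f y - f x - \sum_j 'D_(frame R j) f x * (y - x) j 0| <= e * `|y - x|.

Lemma is_derive_coord (R : realType) m (x v : 'cV[R]_m) i :
  is_derive x v (fun y : 'cV[R]_m => y i 0) (v i 0).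
Proof.
have /is_derive_mxP/(_ i 0) : is_derive x v (@id 'cV[R]_m) v by exact: is_derive_id.
exact.
Qed.

(** Subtracting the candidate linear part leaves a function whose partial derivatives are small near
    [x], by their continuity; [partial_lipschitz] turns this into a small increment. *)
Lemma C1_frechet (R : realType) m (U : set 'cV[R]_m) (f : 'cV[R]_m -> R) x :
  open U -> U x -> Ck 1 U f -> frechet f x.
Proof.
move=> oU Ux [_ C1f] e e0.
(* The factor [m] of [partial_lipschitz] has to be absorbed; [m.+1] stays nonzero when [m = 0]. *)
pose e' := e / (m.+1)%:R.
have e'0 : 0 < e' by rewrite divr_gt0.
pose a j := 'D_(frame R j) f x.
have [d d0 Hd] : exists2 d, 0 < d & forall y, `|y - x| < d -> U y /\ forall j,
    `|'D_(frame R j) f y - a j| <= e'.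
  have [d1 d10 Hd1] := open_ballP oU Ux.
  have [d2 d20 Hd2] : exists2 d, 0 < d & forall y, `|y - x| < d -> forall j,
      `|'D_(frame R j) f y - a j| <= e'.
    apply: near_finite => j; have [_ [cf _]] := C1f j.
    by move/continuous_atP : (cf x Ux); apply.
  exists (Num.min d1 d2); first by rewrite lt_min d10.
  by move=> y; rewrite lt_min => /andP[/Hd1 Uy /Hd2].
exists d => // y yd.
pose g := fun z : 'cV[R]_m => f z - \sum_j a j * z j 0.
have gK z : `|z - x| < d -> forall j, derivable g z (frame R j) /\
     `|'D_(frame R j) g z| <= e'.
  move=> zd j; have [Uz ze] := Hd _ zd.
  have dl : is_derive z (frame R j) g ('D_(frame R j) f z - a j).
    apply: is_deriveB.
      by split => //; have [] := C1f j => + _; exact.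
    have -> : (fun z0 : 'cV[R]_m => \sum_j a j * z0 j 0) =
         \sum_j (fun z0 : 'cV[R]_m => a j * z0 j 0).
      by apply/funext => w; rewrite fct_sumE.
    apply: is_derive_eq.
      apply: is_derive_sum => i; apply: is_deriveZ; exact: is_derive_coord.
    rewrite (bigD1 j)//= !mxE !eqxx [_ *: _]mulr1 big1 ?addr0// => i ij.
    by rewrite mxE (negbTE ij) [_ *: _]mulr0.
  by have [? ->] := dl; split.
have := partial_lipschitz gK yd; move=> /(_ x).
rewrite subrr normr0 => /(_ d0).
have -> : g y - g x = f y - f x - \sum_j 'D_(frame R j) f x * (y - x) j 0.
  rewrite /g /a; under [in RHS]eq_bigr do rewrite !mxE mulrBr.
  by rewrite sumrB; ring.
move=> /le_trans; apply; rewrite ler_wpM2r// /e' mulrCA ger_pMr//.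
by rewrite ler_pdivrMr// mul1r ler_nat.
Qed.

(** The error splits into the remainder of [f] at the moved point and the gradient of [f] applied to
    the remainder of [Y]; each part receives [e / 2]. *)
Lemma frechet_comp (R : realType) (T : normedModType R) m (f : 'cV[R]_m -> R)
    (Y : T -> 'cV[R]_m) x v l :
  frechet f (Y x) -> is_derive x v Y l ->
  is_derive x v (f \o Y) (\sum_i 'D_(frame R i) f (Y x) * l i 0).
Proof.
move=> fY /is_deriveP dY; apply/is_deriveP => e e0.
pose a i := 'D_(frame R i) f (Y x).
pose A := \sum_i `|a i|.
have A0 : 0 <= A by apply: sumr_ge0.
pose e1 := e / (2 * (`|l| + 1)).
have L0 : 0 < `|l| + 1 by rewrite ltr_wpDl.
have e10 : 0 < e1 by rewrite divr_gt0// mulr_gt0.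
have [d1 d10 Hd1] := fY e1 e10.
(* The cap 1 bounds the increment of [Y] by [(|l| + 1) |h|], which is what [e1] was scaled for; the
   other term controls the gradient part, [A] being its l1 norm. *)
pose e2 := Num.min 1 (e / (2 * (A + 1))).
have e20 : 0 < e2 by rewrite lt_min ltr01/= divr_gt0// mulr_gt0// ltr_wpDl.
have [d2 d20 Hd2] := dY e2 e20.
exists (Num.min d2 (d1 / (`|l| + 1))).
  by rewrite lt_min d20/= divr_gt0.
move=> h; rewrite lt_min => /andP[/Hd2 h2 h1] /=.
set y := Y (h *: v + x) in h2 *.
have yl : `|y - Y x| <= (`|l| + 1) * `|h|.
  have -> : y - Y x = (y - Y x - h *: l) + h *: l by rewrite subrK.
  rewrite (le_trans (ler_normD _ _))// normrZ mulrDl addrC (mulrC `|h|) lerD2l.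
  apply: le_trans h2 _; rewrite ler_wpM2r// /e2 ge_min lexx//.
have /Hd1 H1 : `|y - Y x| < d1.
  by apply: le_lt_trans yl _; rewrite mulrC -ltr_pdivlMr.
have -> : f y - f (Y x) - h *: (\sum_i 'D_(frame R i) f (Y x) * l i 0) =
  (f y - f (Y x) - \sum_j 'D_(frame R j) f (Y x) * (y - Y x) j 0) +
  \sum_j a j * (y - Y x - h *: l) j 0.
  have -> : \sum_j a j * (y - Y x - h *: l) j 0 =
     \sum_j a j * (y - Y x) j 0 - h *: (\sum_i a i * l i 0).
    rewrite scaler_sumr -sumrB; apply: eq_bigr => i _.
    by rewrite !mxE [_ *: _]mulrCA -mulrBr.
  by rewrite addrA subrK.
rewrite (le_trans (ler_normD _ _))//.
have -> : e * `|h| = e / 2 * `|h| + e / 2 * `|h| by field.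
apply: lerD.
  apply: le_trans H1 _; rewrite /e1.
  apply: le_trans (_ : _ <= e / (2 * (`|l| + 1)) * ((`|l| + 1) * `|h|)) _.
    by rewrite ler_wpM2l// ltW.
  rewrite le_eqVlt; apply/orP; left; apply/eqP; field.
  by rewrite gt_eqF.
apply: le_trans (ler_norm_sum _ _ _) _.
apply: le_trans (_ : _ <= \sum_i `|a i| * (e2 * `|h|)) _.
  apply: ler_sum => i _; rewrite normrM ler_wpM2l//.
  by apply: le_trans h2; exact: mx_entry_le.
rewrite -mulr_suml mulrA ler_wpM2r// -/A.
apply: le_trans (_ : _ <= A * (e / (2 * (A + 1)))) _.
  by rewrite ler_wpM2l// /e2 ge_min lexx orbT.
have A1 : 0 < A + 1 by rewrite ltr_wpDl.
rewrite mulrA ler_pdivrMr ?mulr_gt0//.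
have -> : e / 2 * (2 * (A + 1)) = e * A + e by field.
by rewrite mulrC lerDl ltW.
Qed.

Lemma frechet_derive (R : realType) m (f : 'cV[R]_m -> R) x v :
  frechet f x -> is_derive x v f (\sum_j v j 0 * 'D_(frame R j) f x).
Proof.
move=> ff; have := @frechet_comp _ _ _ f id x v v ff (is_derive_id _ _).
by under eq_bigr do rewrite mulrC.
Qed.

Lemma open_eq_near (T : topologicalType) (W : Type) (U : set T) (f g : T -> W) x :
  open U -> U x -> (forall y, U y -> f y = g y) -> \near x, f x = g x.
Proof.
move=> oU Ux fg; have := open_nbhs_nbhs (conj oU Ux).
by apply: filterS => y /fg.
Qed.

Lemma is_derive_ext (R : realType) (V W : normedModType R) (U : set V)
    (f g : V -> W) x v l : open U -> U x -> (forall y, U y -> f y = g y) ->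
  is_derive x v f l -> is_derive x v g l.
Proof. by move=> oU Ux fg; apply: near_eq_is_derive; exact: open_eq_near fg. Qed.

Lemma continuous_ext (T T' : topologicalType) (U : set T)
    (f g : T -> T') x : open U -> U x -> (forall y, U y -> f y = g y) ->
  {for x, continuous f} -> {for x, continuous g}.
Proof.
move=> oU Ux fg cf; suff : g @ x --> f x by rewrite (fg x Ux).
apply: cvg_trans cf; apply: near_eq_cvg.
exact: open_eq_near fg.
Qed.

Section Ck_theory.
Context (R : realType).

Lemma Ck_cont m k (U : set 'cV[R]_m) f : Ck k U f ->
  forall x, U x -> {for x, continuous f}.
Proof. by case: k => [|k] []. Qed.

Lemma CkW m k (U : set 'cV[R]_m) f : Ck k.+1 U f -> Ck k U f.
Proof.
elim: k f => [|k IH] f [cf df]; first by split.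
by split => // j; have [dfj Cdfj] := df j; split => //; exact: IH.
Qed.

Lemma CkS_derive m k (U : set 'cV[R]_m) f x j : Ck k.+1 U f -> U x ->
  is_derive x (frame R j) f ('D_(frame R j) f x).
Proof. by move=> [_ /(_ j)[df _]] Ux; split => //; exact: df. Qed.

Lemma Ck_subset m k (U U' : set 'cV[R]_m) f : U' `<=` U -> Ck k U f -> Ck k U' f.
Proof.
move=> UU; elim: k f => [|k IH] f [cf df].
  by split => // x /UU; exact: cf.
split; first by move=> x /UU; exact: cf.
by move=> j; have [dfj /IH] := df j; split => // x /UU; exact: dfj.
Qed.

Lemma Ck_ext m k (U : set 'cV[R]_m) f g : open U -> (forall x, U x -> f x = g x) ->
  Ck k U f -> Ck k U g.
Proof.
move=> oU; elim: k f g => [|k IH] f g fg [cf df].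
  by split => // x Ux; exact: (continuous_ext oU Ux fg (cf x Ux)).
split; first by move=> x Ux; exact: (continuous_ext oU Ux fg (cf x Ux)).
move=> j; have [dfj Cdf] := df j; split.
  by move=> x Ux; apply: near_eq_derivable (dfj x Ux); exact: open_eq_near fg.
apply: IH Cdf => x Ux; apply: near_eq_derive; exact: open_eq_near fg.
Qed.

(** [Ck] asks for regularity of the function ['D_(frame R j) f], whose values are known only on [U];
    openness of [U] allows replacing it by any formula valid there. *)
Lemma CkS_intro m k (U : set 'cV[R]_m) f (df : 'I_m -> 'cV[R]_m -> R) :
  open U -> (forall x, U x -> {for x, continuous f}) ->
  (forall x j, U x -> is_derive x (frame R j) f (df j x)) ->
  (forall j, Ck k U (df j)) -> Ck k.+1 U f.
Proof.
move=> oU cf fdf Cdf; split => // j; split.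
  by move=> x Ux; have [] := fdf x j Ux.
by apply: Ck_ext (Cdf j) => // x Ux; have [_ ->] := fdf x j Ux.
Qed.

Lemma Ck_cst m k (U : set 'cV[R]_m) (c : R) : Ck k U (fun=> c).
Proof.
elim: k c => [|k IH] c; split => //; try by move=> x _; exact: cst_continuous.
move=> j; split; first by move=> x _; exact: derivable_cst.
rewrite (_ : 'D_(frame R j) _ = fun=> 0); first exact: IH.
by apply/funext => x; rewrite derive_cst.
Qed.

Lemma CkD m k (U : set 'cV[R]_m) f g : open U -> Ck k U f -> Ck k U g ->
  Ck k U (fun x => f x + g x).
Proof.
move=> oU; elim: k f g => [|k IH] f g Cf Cg.
  by split => // x Ux; apply: continuousD; [apply: Ck_cont Cf _ Ux|apply: Ck_cont Cg _ Ux].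
apply: (@CkS_intro _ _ _ _ (fun j x => 'D_(frame R j) f x + 'D_(frame R j) g x)) => //.
- by move=> x Ux; apply: continuousD; [apply: Ck_cont Cf _ Ux|apply: Ck_cont Cg _ Ux].
- move=> x j Ux; apply: (is_deriveD (CkS_derive j Cf Ux) (CkS_derive j Cg Ux)).
- by move=> j; apply: IH; [have [_ /(_ j)[]] := Cf|have [_ /(_ j)[]] := Cg].
Qed.

Lemma CkM m k (U : set 'cV[R]_m) f g : open U -> Ck k U f -> Ck k U g ->
  Ck k U (fun x => f x * g x).
Proof.
move=> oU; elim: k f g => [|k IH] f g Cf Cg.
  by split => // x Ux; apply: continuousM; [apply: Ck_cont Cf _ Ux|apply: Ck_cont Cg _ Ux].
apply: (@CkS_intro _ _ _ _
  (fun j x => f x * 'D_(frame R j) g x + g x * 'D_(frame R j) f x)) => //.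
- by move=> x Ux; apply: continuousM; [apply: Ck_cont Cf _ Ux|apply: Ck_cont Cg _ Ux].
- move=> x j Ux; apply: (is_deriveM (CkS_derive j Cf Ux) (CkS_derive j Cg Ux)).
- move=> j; apply: CkD => //; apply: IH; do ?exact: CkW.
  + by have [_ /(_ j)[]] := Cg.
  + by have [_ /(_ j)[]] := Cf.
Qed.

Lemma Ck_sum m k (U : set 'cV[R]_m) (I : Type) (r : seq I)
    (P : pred I) (f : I -> 'cV[R]_m -> R) :
  open U -> (forall i, P i -> Ck k U (f i)) -> Ck k U (fun x => \sum_(i <- r | P i) f i x).
Proof.
move=> oU Cf; elim: r => [|i r IH].
  by under [X in Ck _ _ X]eq_fun do rewrite big_nil; exact: Ck_cst.
under [X in Ck _ _ X]eq_fun do rewrite big_cons.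
by have [Pi|//] := boolP (P i); apply: CkD => //; exact: Cf.
Qed.

Lemma Ck_prod m k (U : set 'cV[R]_m) (I : Type) (r : seq I)
    (P : pred I) (f : I -> 'cV[R]_m -> R) :
  open U -> (forall i, P i -> Ck k U (f i)) -> Ck k U (fun x => \prod_(i <- r | P i) f i x).
Proof.
move=> oU Cf; elim: r => [|i r IH].
  by under [X in Ck _ _ X]eq_fun do rewrite big_nil; exact: Ck_cst.
under [X in Ck _ _ X]eq_fun do rewrite big_cons.
by have [Pi|//] := boolP (P i); apply: CkM => //; exact: Cf.
Qed.

Lemma CkV m k (U : set 'cV[R]_m) f : open U -> (forall x, U x -> f x != 0) ->
  Ck k U f -> Ck k U (fun x => (f x)^-1).
Proof.
move=> oU f0; elim: k => [|k IH] Cf.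
  by split => // x Ux; apply: continuousV; [exact: f0|apply: Ck_cont Cf _ Ux].
apply: (@CkS_intro _ _ _ _ (fun j x => -1 * ((f x)^-1 * (f x)^-1 * 'D_(frame R j) f x))) => //.
- by move=> x Ux; apply: continuousV; [exact: f0|apply: Ck_cont Cf _ Ux].
- move=> x j Ux; have [df _] := CkS_derive j Cf Ux; split.
    exact: derivableV (f0 _ Ux) df.
  rewrite deriveV//; last exact: f0.
  by rewrite mulN1r scaleNr -exprVn expr2.
- move=> j; apply: CkM => //; first exact: Ck_cst.
  have CV : Ck k U (fun x => (f x)^-1) by exact/IH/CkW.
  apply: CkM => //; first exact: CkM.
  by have [_ /(_ j)[]] := Cf.
Qed.

Lemma Ck_coord m k (U : set 'cV[R]_m) i : open U -> Ck k U (fun x : 'cV[R]_m => x i 0).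
Proof.
move=> oU; case: k => [|k]; first by split => // x _; exact: coord_continuous.
apply: (@CkS_intro _ _ _ _ (fun j x => (frame R j) i 0)) => //.
- by move=> x _; exact: coord_continuous.
- by move=> x j _; exact: is_derive_coord.
- by move=> j; exact: Ck_cst.
Qed.

Lemma mx_continuousP (T : topologicalType) p q (A : T -> 'M[R]_(p, q)) x :
  (forall i j, {for x, continuous (fun y => A y i j)}) -> {for x, continuous A}.
Proof.
move=> H; apply/cvgrPdist_le => e e0; near=> y.
apply: mx_norm_le; first exact: ltW.
near: y; apply: filter_forall => i; apply: filter_forall => j.
have /cvgrPdist_le/(_ e e0) := H i j.
by apply: filterS => y; rewrite !mxE.
Unshelve. all: by end_near. Qed.

Lemma Ck_comp m p k (U : set 'cV[R]_m) (U' : set 'cV[R]_p) f (Y : 'cV[R]_m -> 'cV[R]_p) :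
  open U -> open U' -> (forall x, U x -> U' (Y x)) ->
  (forall i, Ck k U (fun x => Y x i 0)) -> Ck k U' f -> Ck k U (f \o Y).
Proof.
move=> oU oU' UU'; elim: k f => [|k IH] f CY Cf.
  split => // x Ux; apply: continuous_comp; last by apply: Ck_cont Cf _ (UU' _ Ux).
  by apply: mx_continuousP => i j; rewrite (ord1 j); apply: Ck_cont (CY i) _ Ux.
apply: (@CkS_intro _ _ _ _ (fun j x => \sum_i ('D_(frame R i) f \o Y) x
  * 'D_(frame R j) (fun x => Y x i 0) x)) => //.
- move=> x Ux; apply: continuous_comp; last by apply: Ck_cont Cf _ (UU' _ Ux).
  by apply: mx_continuousP => i j; rewrite (ord1 j); apply: Ck_cont (CY i) _ Ux.
- move=> x j Ux.
  have dY : is_derive x (frame R j) Y (\col_i 'D_(frame R j) (fun x => Y x i 0) x).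
    by apply/is_derive_mxP => i l; rewrite (ord1 l) mxE; exact: CkS_derive (CY i) Ux.
  have Cf1 : Ck 1 U' f.
    by elim: k {IH CY} Cf => // k IH /CkW.
  have := frechet_comp (C1_frechet oU' (UU' _ Ux) Cf1) dY.
  by under eq_bigr do rewrite mxE.
- move=> j; apply: Ck_sum => // i _; apply: CkM => //.
    by apply: IH; [move=> l; exact/CkW/CY|have [_ /(_ i)[]] := Cf].
  by have [_ /(_ j)[]] := CY i.
Qed.

End Ck_theory.

Section smooth_theory.
Context (R : realType) (m : nat).
Implicit Type U : set 'cV[R]_m.

(** The order is kept finite and explicit so that regularity can be bootstrapped by induction on
    [k]. *)
Definition Ckmx (p q k : nat) U (A : 'cV[R]_m -> 'M[R]_(p, q)) :=
  forall i j, Ck k U (fun x => A x i j).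

Lemma smooth_onP p q U (A : 'cV[R]_m -> 'M[R]_(p, q)) :
  smooth_on U A <-> forall k, Ckmx k U A.
Proof. by split=> [H k i j|H i j k]; exact: H. Qed.

Lemma Ckmx_mul p q r k U (A : 'cV[R]_m -> 'M[R]_(p, q)) (B : 'cV[R]_m -> 'M[R]_(q, r)) :
  open U -> Ckmx k U A -> Ckmx k U B -> Ckmx k U (fun x => A x *m B x).
Proof.
move=> oU CA CB i j; under [X in Ck _ _ X]eq_fun do rewrite mxE.
by apply: Ck_sum => // l _; exact: CkM.
Qed.

Lemma Ck_det q k U (A : 'cV[R]_m -> 'M[R]_q) :
  open U -> Ckmx k U A -> Ck k U (fun x => \det (A x)).
Proof.
move=> oU CA; apply: Ck_sum => // s _; apply: CkM => //; first exact: Ck_cst.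
exact: Ck_prod.
Qed.

(** By Cramer's formula the entries of the inverse are cofactors divided by the determinant, hence
    polynomials in the entries over a nonvanishing function. *)
Lemma Ckmx_inv q k U (A : 'cV[R]_m -> 'M[R]_q) :
  open U -> (forall x, U x -> A x \in unitmx) ->
  Ckmx k U A -> Ckmx k U (fun x => invmx (A x)).
Proof.
move=> oU uA CA i j.
apply: (@Ck_ext _ _ _ _ (fun x => (\det (A x))^-1 * \adj (A x) i j)) => //.
  by move=> x Ux; rewrite /invmx uA// !mxE.
apply: CkM => //.
  apply: CkV => //; last exact: Ck_det.
  by move=> x Ux; have := uA x Ux; rewrite unitmxE unitfE.
under [X in Ck _ _ X]eq_fun do rewrite mxE /cofactor.
apply: CkM => //; first exact: Ck_cst.
apply: Ck_det => // a b.
by under [X in Ck _ _ X]eq_fun do rewrite !mxE; exact: CA.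
Qed.

Lemma Ckmx_jac p k U (Y : 'cV[R]_m -> 'cV[R]_p) : Ckmx k.+1 U Y -> Ckmx k U (jac Y).
Proof.
move=> CY i j; under [X in Ck _ _ X]eq_fun do rewrite mxE.
by have [_ /(_ j)[]] := CY i 0.
Qed.

End smooth_theory.

Section derive_matrix.
Context (R : realType) (V : normedModType R).

Lemma is_derive_mulmx p q r (A : V -> 'M[R]_(p, q)) (B : V -> 'M[R]_(q, r)) x v A' B' :
  is_derive x v A A' -> is_derive x v B B' ->
  is_derive x v (fun y => A y *m B y) (A' *m B x + A x *m B').
Proof.
move=> /is_derive_mxP dA /is_derive_mxP dB; apply/is_derive_mxP => i j.
rewrite (_ : (fun y => _) = \sum_l (fun y => A y i l * B y l j)); last first.
  by apply/funext => y; rewrite mxE fct_sumE.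
apply: (is_derive_eq (is_derive_sum (fun l => is_deriveM (dA i l) (dB l j)))).
rewrite !mxE -big_split/=; apply: eq_bigr => l _.
by rewrite addrC; congr (_ + _); rewrite [_ *: _]mulrC.
Qed.

Lemma is_derive_trmx p q (A : V -> 'M[R]_(p, q)) x v A' :
  is_derive x v A A' -> is_derive x v (fun y => (A y)^T) A'^T.
Proof.
move=> /is_derive_mxP dA; apply/is_derive_mxP => i j; rewrite mxE.
by under [X in is_derive _ _ X]eq_fun do rewrite mxE.
Qed.

End derive_matrix.

(** * Linear total differential systems *)

(** The integration operator of Picard iteration. Its outputs are continuous on the whole line so
    that they can be integrated again, while the derivative matters only on the unit interval. *)
Lemma antiderivative (R : realType) : exists I : (R -> R) -> R -> R,
  (forall f, continuous f -> [/\ I f 0 = 0, continuous (I f) &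
     forall t : R, 0 <= t <= 1 -> is_derive t 1 (I f) (f t)]) /\
  (forall f g K, continuous f -> continuous g -> (forall t, `|f t - g t| <= K) ->
     forall t, `|I f t - I g t| <= 2 * K) /\
  (forall t, I (fun=> 0) t = 0).
Proof.
(* Integrating from -1 inside the interval from -1 to 2 makes 0 and 1 interior points, so that the
   derivatives there are two-sided. *)
pose F (f : R -> R) (x : R) : R := (\int[lebesgue_measure]_(t in `[(-1)%R, x]) f t)%R.
pose cl (t : R) : R := Num.max (- (1/2)) (Num.min t (3/2)).
have clP t : - (1/2) <= cl t <= 3/2.
  by rewrite /cl le_max lexx ge_max ge_min lexx orbT andbT /=; lra.
have clid t : - (1/2) <= t <= 3/2 -> cl t = t.
  by move=> /andP[? ?]; rewrite /cl min_l// max_r.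
have cl0 : cl 0 = 0 by apply: clid; ilra.
have FD f : continuous f -> forall t : R, - (1/2) <= t <= 3/2 -> is_derive t 1 (F f) (f t).
  move=> cf t tb.
  have t2 : t < 2 by ilra.
  have t1 : -1 < t by ilra.
  have fi : lebesgue_measure.-integrable `[-1, 2] (EFin \o f).
    apply: continuous_compact_integrable; first exact: segment_compact.
    exact: continuous_subspaceT.
  have [dF F'] := continuous_FTC1_closed t2 fi t1 (cf t).
  by split; [exact: dF|rewrite -derive1E].
have F0 x : F (fun=> 0) x = 0 by rewrite /F /Rintegral integral0.
(* Clamping the endpoint makes the primitive continuous on the whole line. *)
exists (fun f t => F f (cl t) - F f 0); split; last split; last first.
- by move=> t; rewrite !F0 subrr.
- move=> f g K cf cg fgK t.
  have K0 : 0 <= K by exact: le_trans (fgK 0).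
  have [/andP[c1 c2]] := clP t.
  have -> : F f (cl t) - F f 0 - (F g (cl t) - F g 0) =
    (F f (cl t) - F g (cl t)) - (F f 0 - F g 0) by ring.
  apply: le_trans (_ : _ <= K * `|cl t - 0|) _.
    have H s : Num.min 0 (cl t) <= s <= Num.max 0 (cl t) -> - (1/2) <= s <= 3/2.
      by case: (leP 0 (cl t)) => ? /andP[? ?]; ilra.
    apply: (@mean_value_le _ (fun s => F f s - F g s) (fun s => f s - g s)) => //.
    by move=> s /H sb; apply: is_deriveB; exact: FD.
  (* The clamped endpoint has absolute value at most 3/2, which the constant 2 covers. *)
  rewrite subr0 mulrC ler_wpM2r// ler_norml; ilra.
- move=> f cf; split; first by rewrite cl0 subrr.
  + move=> t; apply: cvgB; last exact: cvg_cst.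
    apply: (@continuous_comp _ _ _ cl (F f)); last exact: is_derive_continuous (FD f cf _ (clP t)).
    apply: continuous_max; first exact: cst_continuous.
    by apply: continuous_min; [exact: cvg_id|exact: cst_continuous].
  + move=> t tb.
    apply: (@is_derive_ext _ R^o R^o [set s : R | - (1/2) < s < 3/2] (fun s => F f s - F f 0)).
    * rewrite (_ : mkset _ = `](- (1/2)), (3/2)[%classic); first exact: interval_open.
      by rewrite set_itvoo.
    * by rewrite /=; ilra.
    * by move=> s /= sb; rewrite clid//; ilra.
    * rewrite -[f t]subr0; apply: is_deriveB; apply: FD => //; ilra.
Qed.

(** The intervals of radius [2 * C * 2^-1 ^+ k] around [u k] are nested, so the supremum of their
    left ends lies in all of them. The explicit error replaces limits in the fixed-point
    arguments. *)
Lemma geometric_limit (R : realType) (u : nat -> R) (C : R) :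
  (forall k, `|u k.+1 - u k| <= C * 2^-1 ^+ k) ->
  exists l, forall k, `|l - u k| <= 2 * C * 2^-1 ^+ k.
Proof.
move=> uC.
have C0 : 0 <= C by have := uC 0%N; rewrite expr0 mulr1; exact: le_trans.
have e0 k : 0 <= 2^-1 ^+ k :> R by rewrite exprn_ge0.
(* Rearranged, the two inequalities say that the interval for [k + i] lies inside the one for
   [k]. *)
have down k i : u (k + i)%N - 2 * C * 2^-1 ^+ (k + i) <=
     u k + 2 * C * 2^-1 ^+ k - 4 * C * 2^-1 ^+ (k + i) /\
   u k - 2 * C * 2^-1 ^+ k <=
     u (k + i)%N + 2 * C * 2^-1 ^+ (k + i) - 4 * C * 2^-1 ^+ (k + i).
  elim: i => [|i IH]; first by rewrite addn0; split; lra.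
  rewrite addnS exprS; have := uC (k + i)%N; rewrite ler_norml => /andP[? ?].
  have ? := mulr_ge0 C0 (e0 (k + i)%N).
  by move: IH => [? ?]; split; lra.
have cross j k : u j - 2 * C * 2^-1 ^+ j <= u k + 2 * C * 2^-1 ^+ k.
  have [jk|/ltnW jk] := leqP k j.
    have [+ _] := down k (j - k)%N; rewrite subnKC// => ?.
    have ? := mulr_ge0 C0 (e0 j); lra.
  have [_ +] := down j (k - j)%N; rewrite subnKC// => ?.
  have ? := mulr_ge0 C0 (e0 k); lra.
pose A := [set u k - 2 * C * 2^-1 ^+ k | k in setT].
have supA : has_sup A.
  split; first by exists (u 0%N - 2 * C * 2^-1 ^+ 0); exists 0%N.
  by exists (u 0%N + 2 * C * 2^-1 ^+ 0) => _ [j _ <-].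
exists (sup A) => k; rewrite ler_norml; apply/andP; split.
  have : u k - 2 * C * 2^-1 ^+ k <= sup A.
    by apply: ub_le_sup; [case: supA|exists k].
  lra.
have : sup A <= u k + 2 * C * 2^-1 ^+ k.
  by apply: ge_sup; [case: supA|move=> _ [j _ <-]].
lra.
Qed.

(** Archimedean argument: otherwise some [k] exceeds [C / |a|], and [2 ^ k] is larger still.
    Fixed-point equations are proved by bounding the difference of their sides for every [k]. *)
Lemma geometric_eq0 (R : realType) (a C : R) :
  (forall k : nat, `|a| <= C * 2^-1 ^+ k) -> a = 0.
Proof.
move=> aC; apply/eqP; rewrite -normr_eq0; apply/eqP/le_anti; rewrite normr_ge0 andbT.
rewrite leNgt; apply/negP => a0.
have Ck := truncnS_gt (C / `|a|); set k := (Num.truncn _).+1 in Ck.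
have := aC k; rewrite exprVn ler_pdivlMr ?exprn_gt0//.
move: Ck; rewrite ltr_pdivrMr// => Ck /le_lt_trans/(_ Ck).
rewrite mulrC ltr_pM2r//; apply/negP; rewrite -leNgt -natrX ler_nat.
exact/ltnW/ltn_expl.
Qed.

Lemma continuous_sum_fun (R : realType) (T : topologicalType) (J : Type)
    (r : seq J) (f : J -> T -> R) :
  (forall j, continuous (f j)) -> continuous (fun t => \sum_(j <- r) f j t).
Proof.
move=> cf; elim: r => [|j r IH].
  by under [X in continuous X]eq_fun do rewrite big_nil; exact: cst_continuous.
under [X in continuous X]eq_fun do rewrite big_cons.
by move=> t; apply: cvgD; [exact: cf|exact: IH].
Qed.

Lemma continuous_mulmx_entry (R : realType) (T : topologicalType) (p q r : nat)
    (A : T -> 'M[R]_(p, q)) (B : T -> 'M[R]_(q, r)) :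
  (forall i j, continuous (fun t => A t i j)) ->
  (forall i j, continuous (fun t => B t i j)) ->
  forall i j, continuous (fun t => (A t *m B t) i j).
Proof.
move=> cA cB i j; under [X in continuous X]eq_fun do rewrite mxE.
by apply: continuous_sum_fun => l t; apply: cvgM; [exact: cA|exact: cB].
Qed.

Arguments continuous_mulmx_entry {R T p q r A B} _ _ i j x _ _.

(** The unknown is a row because it will hold components of a covector. Smallness and continuity of
    [b] are global in [t], which callers arrange by clamping the parameter. *)
Lemma linear_ode (R : realType) N (b : R -> 'M[R]_N) (w0 : 'rV[R]_N) :
  (forall i j, continuous (fun t => b t i j)) ->
  (forall t (v : 'rV[R]_N), `|v *m b t| <= 4^-1 * `|v|) ->
  exists w : R -> 'rV[R]_N, [/\ w 0 = w0,
    forall t : R, 0 <= t <= 1 -> is_derive t 1 w (w t *m b t) &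
    forall t, `|w t| <= 3 * `|w0|].
Proof.
move=> cb bq; have [I [Iprop [Ilip I0]]] := antiderivative R.
pose step (F : R -> 'rV[R]_N) (t : R) : 'rV[R]_N :=
  w0 + \row_j I (fun s => (F s *m b s) 0 j) t.
pose cts (F : R -> 'rV[R]_N) := forall i j, continuous (fun t => F t i j).
have cstep F : cts F -> cts (step F).
  move=> cF i j; rewrite (ord1 i).
  under [X in continuous X]eq_fun do rewrite !mxE.
  move=> t; apply: cvgD; first exact: cvg_cst.
  by have [_ + _] := Iprop _ (continuous_mulmx_entry cF cb 0 j); exact.
have lstep F G K : cts F -> cts G -> (forall t, `|F t - G t| <= K) ->
    forall t, `|step F t - step G t| <= 2^-1 * K.
  move=> cF cG FGK t; apply: mx_norm_le.
    by rewrite mulr_ge0//; exact: le_trans (FGK 0).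
  move=> i j; rewrite (ord1 i) !mxE.
  set p := I _ t; set q := I _ t.
  have -> : w0 0 j + p - (w0 0 j + q) = p - q by ring.
  (* The 2 is the Lipschitz constant of [I], the 1/4 the bound on [b]. *)
  have -> : 2^-1 * K = 2 * (4^-1 * K) by lra.
  apply: Ilip => [||s].
  - exact: continuous_mulmx_entry.
  - exact: continuous_mulmx_entry.
  - have -> : (F s *m b s) 0 j - (G s *m b s) 0 j = ((F s - G s) *m b s) 0 j.
      by rewrite mulmxBl !mxE.
    apply: le_trans (mx_entry_le _ _ _) _; apply: le_trans (bq _ _) _.
    by rewrite ler_wpM2l.
(* Picard iteration; the bound 1/4 makes [step] a contraction of ratio 1/2. *)
pose F k := iter k step (fun=> w0).
have cF k : cts (F k).
  elim: k => [|k IH]; last exact: cstep.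
  by move=> i j; exact: cst_continuous.
have c0 : cts (fun=> 0).
  by move=> i j; under [X in continuous X]eq_fun do rewrite mxE; exact: cst_continuous.
have FS k t : `|F k.+1 t - F k t| <= `|w0| * 2^-1 ^+ k.
  elim: k t => [|k IH] t; last first.
    rewrite exprS mulrCA; exact: lstep (cF _) (cF _) IH t.
  rewrite expr0 mulr1 /=.
  (* The step of the zero function is the constant [w0], so the first increment is also a difference
     of two steps and [lstep] applies. *)
  have -> : step (fun=> w0) t - w0 = step (fun=> w0) t - step (fun=> 0) t.
    congr (_ - _); apply/rowP => j; rewrite !mxE.
    under [X in I X _]eq_fun do rewrite mul0mx mxE.
    by rewrite I0 addr0.
  apply: le_trans (lstep _ _ `|w0| (cF 0%N) c0 _ t) _; last by have := normr_ge0 w0; lra.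
  by move=> s; rewrite subr0.
have [w wF] : exists w : R -> 'rV[R]_N, forall t k,
    `|w t - F k t| <= 2 * `|w0| * 2^-1 ^+ k.
  have H t j : exists l, forall k, `|l - F k t 0 j| <= 2 * `|w0| * 2^-1 ^+ k.
    apply: geometric_limit => k; apply: le_trans (FS k t).
    by have := mx_entry_le (F k.+1 t - F k t) 0 j; rewrite !mxE.
  exists (fun t => \row_j sval (cid (H t j))) => t k; apply: mx_norm_le.
    by rewrite !mulr_ge0// exprn_ge0.
  move=> i j; rewrite (ord1 i) !mxE; exact: (svalP (cid (H t j))).
have cw : cts w.
  move=> i j t; rewrite (ord1 i) {i}; apply/continuous_atP => e e0.
  (* If no [k] worked, [e / 3] would lie below every term of a geometric sequence and so vanish.
     With such a [k], the uniform limit inherits continuity by the usual three-term estimate. *)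
  have [k ke] : exists k, 2 * `|w0| * 2^-1 ^+ k <= e / 3.
    apply: contrapT => nk.
    have : e / 3 = 0; last lra.
    apply: (@geometric_eq0 _ _ (2 * `|w0|)) => k.
    rewrite ger0_norm; last lra.
    by rewrite leNgt; apply/negP => /ltW ?; apply: nk; exists k.
  have /continuous_atP Fc := cF k 0 j t.
  have e3 : 0 < e / 3 by lra.
  have [d d0 Hd] := Fc _ e3; exists d => // y /Hd.
  have /le_trans/(_ (wF y k))/le_trans/(_ ke) := mx_entry_le (w y - F k y) 0 j.
  have /le_trans/(_ (wF t k))/le_trans/(_ ke) := mx_entry_le (w t - F k t) 0 j.
  rewrite !mxE !ler_norml => ? ? ?; ilra.
(* [F k.+1] is close to [w] by convergence and to [step w] by contraction, both with errors
   geometric in [k]. *)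
have wS t : w t = step w t.
  apply/eqP; rewrite -subr_eq0; apply/eqP/rowP => j; rewrite [RHS]mxE.
  apply: (@geometric_eq0 _ _ (4 * `|w0|)) => k.
  apply: le_trans (mx_entry_le _ _ _) _.
  have -> : w t - step w t = (w t - F k.+1 t) + (step (F k) t - step w t).
    by rewrite addrA subrK.
  apply: le_trans (ler_normD _ _) _.
  have := wF t k.+1; rewrite exprS => h1.
  have := lstep w (F k) _ cw (cF k) (fun t => wF t k) t; rewrite distrC => h2.
  have ? : 0 <= `|w0| * 2^-1 ^+ k by rewrite mulr_ge0// exprn_ge0.
  by apply: le_trans (lerD h1 h2) _; lra.
exists w; split.
- rewrite wS; apply/rowP => j; rewrite !mxE.
  by have [-> _ _] := Iprop _ (continuous_mulmx_entry cw cb 0 j); rewrite addr0.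
- move=> t t01; have -> : w = step w by apply/funext.
  apply/is_derive_mxP => i j; rewrite (ord1 i).
  under [X in is_derive _ _ X]eq_fun do rewrite !mxE.
  rewrite -wS -[(_ *m _) _ _]add0r; apply: is_deriveD.
  by have [_ _] := Iprop _ (continuous_mulmx_entry cw cb 0 j); apply.
(* For [k = 0] the approximant is the constant [w0], so [w] deviates from it by at most twice its
   norm. *)
- move=> t; have := wF t 0%N; rewrite expr0 mulr1 /= => h.
  have -> : w t = (w t - w0) + w0 by rewrite subrK.
  apply: le_trans (ler_normD _ _) _; lra.
Qed.

Lemma local_bound (R : realType) (V : normedModType R) (J : finType)
    (f : J -> V -> R) x0 : (forall j, {for x0, continuous (f j)}) ->
  exists d C, [/\ 0 < d, 0 <= C & forall y, `|y - x0| < d -> forall j, `|f j y| <= C].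
Proof.
move=> cf.
have [d d0 Hd] : exists2 d, 0 < d & forall y, `|y - x0| < d -> forall j,
    `|f j y - f j x0| <= 1.
  by apply: near_finite => j; move/continuous_atP : (cf j); apply.
exists d, (\sum_j (`|f j x0| + 1)); split => //.
  by apply: sumr_ge0 => j _; rewrite addr_ge0.
move=> y /Hd H j; apply: le_trans (_ : _ <= `|f j x0| + 1) _.
  have -> : f j y = f j x0 + (f j y - f j x0) by rewrite addrC subrK.
  by apply: le_trans (ler_normD _ _) _; rewrite lerD2l.
by rewrite (bigD1 j)//= lerDl; apply: sumr_ge0 => i _; rewrite addr_ge0.
Qed.

Lemma mulmx_norm_le (R : realType) p q r (A : 'M[R]_(p, q)) (B : 'M[R]_(q, r)) :
  `|A *m B| <= q%:R * `|A| * `|B|.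
Proof.
apply: mx_norm_le; first by rewrite !mulr_ge0.
move=> i j; rewrite mxE; apply: le_trans (ler_norm_sum _ _ _) _.
apply: le_trans (_ : _ <= \sum_(l < q) `|A| * `|B|) _; last first.
  by rewrite sumr_const card_ord -[leLHS]mulr_natl mulrA.
by apply: ler_sum => l _; rewrite normrM ler_pM// mx_entry_le.
Qed.

(* The growth rate 1/4 of D on the unit interval makes its maximum absorb itself. *)
Lemma linear_growth_le (R : realType) p q (D D' : R -> 'M[R]_(p, q)) (e : R) :
  D 0 = 0 -> (forall t : R, 0 <= t <= 1 -> is_derive t 1 D (D' t)) ->
  (forall t : R, 0 <= t <= 1 -> `|D' t| <= 4^-1 * `|D t| + e) -> `|D 1| <= 2 * e.
Proof.
move=> D0 dD D'e.
have [c c01 cmax] : exists2 c, 0 <= c <= 1 & forall t : R, 0 <= t <= 1 -> `|D t| <= `|D c|.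
  have [|c + H] := @EVT_max R (fun t => `|D t|) 0 1 ler01.
  - apply: continuous_in_subspaceT => t; rewrite inE/= in_itv/= => t01.
    have /derivable1_diffP/differentiable_continuous cD := @ex_derive _ _ _ _ _ _ _ (dD t t01).
    exact: cvg_norm.
  - rewrite in_itv/= => c01; exists c => // t t01; apply: H; by rewrite in_itv.
have e0 (t : R) : 0 <= t <= 1 -> 0 <= 4^-1 * `|D c| + e.
  by move=> t01; have := normr_ge0 (D' t); have := D'e t t01; have := cmax t t01; lra.
have bnd (t : R) : 0 <= t <= 1 -> `|D t| <= 4^-1 * `|D c| + e.
  move=> t01; apply: mx_norm_le; first exact: e0 t01.
  move=> i j.
  have sub (s : R) : Num.min 0 t <= s <= Num.max 0 t -> 0 <= s <= 1.
    case: (leP 0 t) => ? ?; ilra.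
  have := @mean_value_le _ (fun s => D s i j) (fun s => D' s i j) 0 t (4^-1 * `|D c| + e).
  rewrite D0 mxE !subr0 => H.
  apply: le_trans (H _ _) _.
  - by move=> s /sub s01; have /is_derive_mxP := dD s s01; apply.
  - move=> s /sub s01; apply: le_trans (mx_entry_le _ _ _) _.
    by apply: le_trans (D'e s s01) _; have := cmax s s01; lra.
  - by have ? := e0 t t01; rewrite ler_piMr// ler_norml; ilra.
(* At the maximum point the bound absorbs itself and gives [|D c| <= 4/3 e]; inserted at time 1 it
   gives [4/3 e] again. *)
have := bnd c c01; have := bnd 1; rewrite lexx ler01 => /(_ isT).
have := normr_ge0 (D c); lra.
Qed.

Section quantitative_taylor.
Context (R : realType) (m : nat) (x0 : 'cV[R]_m) (r C : R).
Variable (f : 'cV[R]_m -> R).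

Lemma frame_segment_ball (x : 'cV[R]_m) j k t : `|x - x0| < r ->
  `|k *: frame R j + x - x0| < r -> Num.min 0 k <= t <= Num.max 0 k ->
  `|t *: frame R j + x - x0| < r.
Proof.
move=> xr kr tk; have r0 : 0 < r by exact: le_lt_trans xr.
apply: mx_norm_lt => // i l; rewrite (ord1 l).
have := le_lt_trans (mx_entry_le (x - x0) i 0) xr.
have := le_lt_trans (mx_entry_le (k *: frame R j + x - x0) i 0) kr.
rewrite !mxE; case: (i == j) => /=; rewrite ?mulr1 ?mulr0 ?add0r//.
rewrite !ltr_norml; move: tk.
by case: (leP 0 k) => ? ? ? ?; ilra.
Qed.

Hypothesis df : forall x, `|x - x0| < r -> forall j, derivable f x (frame R j) /\
   `|'D_(frame R j) f x| <= C.

Lemma frame_increment_le x j k : `|x - x0| < r ->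
  `|k *: frame R j + x - x0| < r -> `|f (k *: frame R j + x) - f x| <= C * `|k|.
Proof.
move=> xr kr.
have := @mean_value_le _ (fun s => f (s *: frame R j + x))
  (fun s => 'D_(frame R j) f (s *: frame R j + x)) 0 k C.
rewrite scale0r add0r subr0; apply.
- move=> t tk; apply: is_derive_line; split => //.
  by have [] := df (frame_segment_ball xr kr tk) j.
- by move=> t tk; have [] := df (frame_segment_ball xr kr tk) j.
Qed.
End quantitative_taylor.

(** The mean value estimate is applied to [f (s *: frame R j + x) - s * D_j f x], whose derivative
    is an increment of [D_j f] and hence at most [C |k|]. *)
Lemma taylor2_le (R : realType) (m : nat) (x0 : 'cV[R]_m) (r C : R) f x j k :
  0 <= C ->
  (forall x, `|x - x0| < r -> derivable f x (frame R j)) ->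
  (forall x, `|x - x0| < r -> forall l, derivable ('D_(frame R j) f) x (frame R l) /\
     `|'D_(frame R l) ('D_(frame R j) f) x| <= C) ->
  `|x - x0| < r -> `|k *: frame R j + x - x0| < r ->
  `|f (k *: frame R j + x) - f x - k * 'D_(frame R j) f x| <= C * k ^+ 2.
Proof.
move=> C0 df ddf xr kr.
have := @mean_value_le _ (fun s => f (s *: frame R j + x) - s * 'D_(frame R j) f x)
  (fun s => 'D_(frame R j) f (s *: frame R j + x) - 'D_(frame R j) f x) 0 k (C * `|k|).
have -> : C * k ^+ 2 = C * `|k| * `|k|.
  by rewrite -mulrA -expr2 -normrX ger0_norm ?sqr_ge0.
rewrite scale0r add0r mul0r !subr0 addrAC; apply.
- move=> t tk; apply: is_deriveB.
    apply: is_derive_line; split => //.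
    by exact: df (frame_segment_ball xr kr tk).
  have -> : (fun s : R => s * 'D_(frame R j) f x) = ('D_(frame R j) f x *: (@id R)).
    by apply/funext => s; rewrite mulrC.
  by apply: is_derive_eq; rewrite [_ *: _]mulr1.
- move=> t tk; have tr := frame_segment_ball xr kr tk.
  apply: le_trans (frame_increment_le ddf xr tr) _.
  rewrite ler_wpM2l//.
  by move: tk; case: (leP 0 k) => ? tk; rewrite ler_norml;
    [rewrite ger0_norm//|rewrite ltr0_norm//]; ilra.
Qed.

Lemma derive_mx_entry (R : realType) (V : normedModType R) p q
    (A : V -> 'M[R]_(p, q)) x v i j :
  (forall i j, derivable (fun y => A y i j) x v) ->
  ('D_v A x) i j = 'D_v (fun y => A y i j) x.
Proof. by move=> /derivable_mxP dA; rewrite derive_mx// mxE. Qed.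

Lemma Ckmx_derive (R : realType) m p q k (U : set 'cV[R]_m)
    (A : 'cV[R]_m -> 'M[R]_(p, q)) x j : Ckmx k.+1 U A -> U x ->
  is_derive x (frame R j) A ('D_(frame R j) A x).
Proof.
move=> CA Ux; apply/is_derive_mxP => a b; rewrite derive_mx_entry.
  exact: CkS_derive (CA a b) Ux.
by move=> i' j'; have [] := CkS_derive j (CA i' j') Ux.
Qed.

(* The defect w' - w - h t w B_j, where w and w' are the transports along the
   rays to x and x + h e_j, satisfies a linear equation with a small
   inhomogeneous term, because of the flatness identity. *)
Lemma transport_defect (R : realType) N (w w' : 'rV[R]_N) (b b' Bj M M' : 'M[R]_N) (h t : R) :
  b *m Bj + M = M' + Bj *m b ->
  w' *m b' - w *m b - (h *: (w *m Bj) + (h * t) *: (w *m b *m Bj + w *m M)) =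
  (w' - w - (h * t) *: (w *m Bj)) *m b' +
  (w *m (b' - b - h *: Bj - (h * t) *: M') + (h * t) *: (w *m Bj *m (b' - b))).
Proof.
move=> flat; have -> : w *m b *m Bj + w *m M = w *m M' + w *m Bj *m b.
  by rewrite -!mulmxA -!mulmxDr flat.
rewrite !(mulmxBl, mulmxBr, =^~scalemxAl, =^~scalemxAr).
apply/rowP => i.
move: (w' *m b') (w *m b') (w *m b) (w *m Bj) (w *m M') (w *m Bj *m b') (w *m Bj *m b).
move=> a1 a2 a3 a4 a5 a6 a7; rewrite !mxE; ring.
Qed.

Section linear_frobenius.
Context (R : realType) (m N : nat) (x0 : 'cV[R]_m) (r C : R).
Variable B : 'I_m -> 'cV[R]_m -> 'M[R]_N.
Local Notation inball x := (`|x - x0| < r).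
Local Notation D j f := ('D_(frame R j) f).
Hypothesis C0 : 0 <= C.
Hypothesis r0 : 0 < r.
Hypothesis r1 : r <= 1.
Hypothesis rsmall : m%:R * r * (N%:R * C) <= 4^-1.
Hypothesis CB : forall i, Ckmx 2 [set x | inball x] (B i).
Hypothesis B0 : forall i a b x, inball x -> `|B i x a b| <= C.
Hypothesis B1 : forall i a b j x, inball x -> `|D j (fun y => B i y a b) x| <= C.
Hypothesis B2 : forall i a b j l x, inball x ->
  `|D l (D j (fun y => B i y a b)) x| <= C.
Hypothesis flat : forall i j x, inball x ->
  D i (B j) x + B i x *m B j x = D j (B i) x + B j x *m B i x.

Let ray (x : 'cV[R]_m) (t : R) : 'cV[R]_m := t *: (x - x0) + x0.
Let clamp (t : R) : R := Num.max 0 (Num.min t 1).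
(** The coefficient of the total differential system pulled back to the ray from [x0] to [x].
    Clamping meets the requirement of [linear_ode] that it be continuous and small for all real
    [t]. *)
Let beta x (t : R) := \sum_i (x - x0) i 0 *: B i (ray x (clamp t)).

Let clamp_itv t : 0 <= clamp t <= 1.
Proof. by rewrite /clamp le_max lexx ge_max ge_min lexx orbT ler01. Qed.

Let clampK (t : R) : 0 <= t <= 1 -> clamp t = t.
Proof. by move=> /andP[? ?]; rewrite /clamp min_l// max_r. Qed.

Let ray_ball x (t : R) : inball x -> 0 <= t <= 1 -> inball (ray x t).
Proof.
move=> xr /andP[t0 t1]; rewrite addrK normrZ ger0_norm//.
by apply: le_lt_trans xr; rewrite ler_piMl.
Qed.

Let rv_mul_le (v : 'rV[R]_N) (A : 'M[R]_N) K : 0 <= K ->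
  (forall a b, `|A a b| <= K) -> `|v *m A| <= N%:R * `|v| * K.
Proof.
move=> K0 AK; apply: le_trans (mulmx_norm_le _ _) _.
by rewrite ler_wpM2l ?mulr_ge0//; exact: mx_norm_le.
Qed.

(** The condition [rsmall] on the radius is exactly what brings the ray coefficient below the
    threshold 1/4. *)
Let beta_small x t (v : 'rV[R]_N) : inball x -> `|v *m beta x t| <= 4^-1 * `|v|.
Proof.
move=> xr; apply: le_trans (_ : _ <= N%:R * `|v| * (m%:R * r * C)) _; last first.
  have -> : N%:R * `|v| * (m%:R * r * C) = m%:R * r * (N%:R * C) * `|v| by ring.
  by rewrite ler_wpM2r.
apply: rv_mul_le; first by rewrite !mulr_ge0// ltW.
move=> a b; rewrite summxE; apply: le_trans (ler_norm_sum _ _ _) _.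
apply: le_trans (_ : _ <= \sum_(i < m) r * C) _; last first.
  by rewrite sumr_const card_ord -[leLHS]mulr_natl mulrA.
apply: ler_sum => i _; rewrite mxE normrM ler_pM//.
  by apply: le_trans (mx_entry_le _ _ _) _; exact: ltW.
by apply: B0; apply: ray_ball => //; exact: clamp_itv.
Qed.

Let oball : open [set x | inball x].
Proof. exact: open_norm_ball. Qed.

Let clamp_cts : continuous clamp.
Proof.
move=> t; change {for t, continuous clamp}; rewrite /clamp.
apply: continuous_max; first exact: cst_continuous.
by apply: continuous_min; [exact: cvg_id|exact: cst_continuous].
Qed.

Let beta_cts x : inball x -> forall a b, continuous (fun t => beta x t a b).
Proof.
move=> xr a b; under [X in continuous X]eq_fun do rewrite summxE.
apply: continuous_sum_fun => i t.
under [X in continuous_at _ X]eq_fun do rewrite mxE.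
apply: cvgM; first exact: cvg_cst.
apply: (@continuous_comp _ _ _ (fun t => ray x (clamp t)) (fun y => B i y a b)).
  apply: cvgD; last exact: cvg_cst.
  by apply: cvgZ; [exact: clamp_cts|exact: cvg_cst].
apply: Ck_cont (CB i a b) _ _; apply: ray_ball => //; exact: clamp_itv.
Qed.

Let CB1 i a b : forall x, inball x -> forall j,
  derivable (fun y => B i y a b) x (frame R j) /\ `|D j (fun y => B i y a b) x| <= C.
Proof. by move=> x xr j; split; [case: (CkS_derive j (CB i a b) xr)|exact: B1]. Qed.

Let CB2 i a b j : forall x, inball x -> forall l,
  derivable (D j (fun y => B i y a b)) x (frame R l) /\
  `|D l (D j (fun y => B i y a b)) x| <= C.
Proof.
move=> x xr l; split; last exact: B2.
have [_ /(_ j)[_ CBj]] := CB i a b.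
by case: (CkS_derive (k:=0) l CBj xr).
Qed.

Let dB_ray (x : 'cV[R]_m) (t : R) (j : 'I_m) : inball x -> 0 <= t <= 1 ->
  is_derive t 1 (fun s => B j (ray x s)) (\sum_i (x - x0) i 0 *: D i (B j) (ray x t)).
Proof.
move=> xr t01; have rr := ray_ball xr t01.
apply/is_derive_mxP => a b; rewrite summxE.
have fB : frechet (fun y => B j y a b) (ray x t).
  by apply: C1_frechet oball rr _; apply: CkW; exact: CB.
have dr : is_derive t 1 (ray x) (x - x0).
  have := @is_derive_line R _ _ (@id 'cV[R]_m) x0 (x - x0) t (x - x0).
  by apply; exact: is_derive_id.
have := frechet_comp fB dr; congr (is_derive _ _ _ _).
apply: eq_bigr => i _; rewrite [in RHS]mxE mulrC derive_mx_entry//.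
by move=> a' b'; have [] := CB1 j a' b' rr i.
Qed.

(** [W x] is the value at time 1 of the transport along the ray to [x]. For the derivative along
    [e_j], the defect between the rays to [x] and [x + h e_j] starts at zero and ends at the
    remainder of the claimed derivative; flatness makes its forcing term quadratic in [h]. *)
Lemma linear_frobenius_ball (w0 : 'rV[R]_N) : exists W : 'cV[R]_m -> 'rV[R]_N,
  W x0 = w0 /\ forall x j, inball x -> is_derive x (frame R j) W (W x *m B j x) /\
    `|W x| <= 3 * `|w0|.
Proof.
have Hw x : exists w : R -> 'rV[R]_N, inball x ->
  [/\ w 0 = w0, forall t : R, 0 <= t <= 1 -> is_derive t 1 w (w t *m beta x t) &
    forall t, `|w t| <= 3 * `|w0|].
  have [xr|nxr] := pselect (inball x); last by exists (fun=> 0).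
  have [w Hw] := linear_ode w0 (beta_cts xr) (fun t v => beta_small t v xr).
  by exists w.
have [w {}Hw] := choice Hw.
have xx0 : inball x0 by rewrite subrr normr0.
exists (fun x => w x 1); split.
  have [w00 dw _] := Hw _ xx0.
  (* The ray to the centre is constant, so the equation there reads [w' = 0] and the growth estimate
     with [e = 0] yields [W x0 = w0]. *)
  have bx0 t : beta x0 t = 0.
    by rewrite /beta big1// => i _; rewrite subrr mxE scale0r.
  apply/eqP; rewrite -subr_eq0; apply/eqP; apply: normr0_eq0.
  have := @linear_growth_le R _ _ (fun t => w x0 t - w0) (fun=> 0) 0.
  rewrite w00 subrr mulr0 => /(_ erefl) H.
  apply/le_anti; rewrite normr_ge0 andbT; apply: H => t t01.
    rewrite -[X in is_derive _ _ _ X]subr0; apply: is_deriveB.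
    by have := dw t t01; rewrite bx0 mulmx0.
  by rewrite normr0 addr0 mulr_ge0.
move=> x j xr; have [w00 dw wb] := Hw _ xr; split; last exact: wb.
pose X := x - x0.
(* The two summands bound the two forcing terms of [transport_defect]: [w] times the second-order
   remainder of [beta], and [w *m B j] times its first-order increment. *)
pose K : R := N%:R * (3 * `|w0|) * ((m.+1)%:R * C) +
   N%:R * (N%:R * (3 * `|w0|) * C) * ((m.+1)%:R * C).
have K0 : 0 <= K by rewrite addr_ge0// !mulr_ge0.
have key h : inball (h *: frame R j + x) ->
    `|w (h *: frame R j + x) 1 - w x 1 - h *: (w x 1 *m B j x)| <= 2 * (K * h ^+ 2).
  set x' := h *: frame R j + x => xr'.
  have [w00' dw' wb'] := Hw _ xr'.
  pose M t := \sum_i X i 0 *: D i (B j) (ray x t).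
  pose M' t := \sum_i X i 0 *: D j (B i) (ray x t).
  (* At time [t] the two rays differ by [(h * t) e_j], so the guessed difference of the solutions is
     this multiple of the right-hand side. *)
  pose Def t := w x' t - w x t - (h * t) *: (w x t *m B j (ray x t)).
  pose Def' t := w x' t *m beta x' t - w x t *m beta x t -
    (h *: (w x t *m B j (ray x t)) +
     (h * t) *: (w x t *m beta x t *m B j (ray x t) + w x t *m M t)).
  have := @linear_growth_le R _ _ Def Def' (K * h ^+ 2).
  have -> : Def 1 = w x' 1 - w x 1 - h *: (w x 1 *m B j x).
    by rewrite /Def mulr1 /ray scale1r subrK.
  apply.
  - by rewrite /Def w00 w00' subrr mulr0 scale0r subrr.
  - move=> t t01; apply: is_deriveB.
      by apply: is_deriveB; [exact: dw'|exact: dw].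
    have dM : is_derive t 1 (fun s => w x s *m B j (ray x s))
        (w x t *m beta x t *m B j (ray x t) + w x t *m M t).
      exact: is_derive_mulmx (dw t t01) (dB_ray j xr t01).
    apply/is_derive_mxP => a b.
    have /is_derive_mxP/(_ a b) dMab := dM.
    have dht : is_derive t 1 (fun s : R => h * s) h.
      by apply: is_derive_eq; rewrite [_ *: _]mulr1.
    rewrite (_ : (fun y => _) =
      (fun s : R => h * s) * (fun s => (w x s *m B j (ray x s)) a b)); last first.
      by apply/funext => s; rewrite mxE.
    apply: (is_derive_eq (is_deriveM dht dMab)).
    move: (w x t *m beta x t *m B j (ray x t)) (w x t *m M t) (w x t *m B j (ray x t)) => a1 a2 a3.
    by rewrite !mxE /GRing.scale/=; ring.
  - move=> t t01; have rr := ray_ball xr t01; have rr' := ray_ball xr' t01.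
    have betaE y : beta y t = \sum_i (y - x0) i 0 *: B i (ray y t).
      by rewrite /beta clampK.
    (* The flatness identity contracted with [x - x0], in the shape of the hypothesis of
       [transport_defect]. *)
    have flatM : beta x t *m B j (ray x t) + M t = M' t + B j (ray x t) *m beta x t.
      rewrite betaE /M /M' mulmx_suml mulmx_sumr -!big_split/=; apply: eq_bigr => i _.
      rewrite -scalemxAl -scalemxAr -!scalerDr; congr (_ *: _).
      by rewrite addrC flat.
    rewrite /Def' (transport_defect _ _ _ _ _ flatM) -/(Def t).
    apply: le_trans (ler_normD _ _) _; apply: lerD; first exact: beta_small.
    have ray' : ray x' t = (t * h) *: frame R j + ray x t.
      by rewrite /ray /x' -[_ + x - x0]addrA scalerDr scalerA addrA.
    have th : `|t * h| <= `|h|.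
      by rewrite normrM ler_piMl// ler_norml; ilra.
    have inc i a b : `|B i (ray x' t) a b - B i (ray x t) a b| <= C * `|h|.
      rewrite ray'; apply: le_trans (frame_increment_le (CB1 i a b) rr _) _.
        by rewrite -ray'.
      by rewrite ler_wpM2l.
    have tay i a b : `|B i (ray x' t) a b - B i (ray x t) a b -
        (t * h) * D j (fun y => B i y a b) (ray x t)| <= C * h ^+ 2.
      rewrite ray'; apply: le_trans (taylor2_le C0 _ (CB2 i a b j) rr _) _.
      - by move=> y yr; have [] := CB1 i a b yr j.
      - by rewrite -ray'.
      - by rewrite ler_wpM2l// -[leLHS]ger0_norm ?sqr_ge0//
          -[leRHS]ger0_norm ?sqr_ge0// !normrX lerXn2r ?nnegrE.
    have X'E i : (x' - x0) i 0 = X i 0 + h * (i == j)%:R.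
      by rewrite /x' /X !mxE andbT; ring.
    have delta_sum (F : 'I_m -> R) : \sum_i (h * (i == j)%:R) * F i = h * F j.
      rewrite (bigD1 j)//= eqxx mulr1 big1 ?addr0// => i /negbTE ->.
      by rewrite mulr0 mul0r.
    have Xr i : `|X i 0| <= 1.
      apply: le_trans r1; apply: le_trans (ltW xr); exact: mx_entry_le.
    have sum_le (F : 'I_m -> R) c : (forall i, `|F i| <= c) ->
        `|\sum_i X i 0 * F i| <= m%:R * c.
      move=> Fc; apply: le_trans (ler_norm_sum _ _ _) _.
      apply: le_trans (_ : _ <= \sum_(i < m) c) _; last first.
        by rewrite sumr_const card_ord -[leLHS]mulr_natl.
      apply: ler_sum => i _; rewrite normrM -[leRHS]mul1r ler_pM//.
    (* The coefficient changes for two reasons: the point where [B] is evaluated moves, giving [m]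
       terms, and the direction [x - x0] gains the component [h] along [e_j], giving one more. This
       is the origin of [m.+1]. *)
    have dbeta a b : (beta x' t - beta x t) a b =
       \sum_i X i 0 * (B i (ray x' t) a b - B i (ray x t) a b) +
       h * B j (ray x' t) a b.
      rewrite !betaE !mxE !summxE -(delta_sum (fun i => B i (ray x' t) a b)).
      rewrite -sumrB -big_split/=; apply: eq_bigr => i _.
      have sE (k : R) (A : 'M[R]_N) : (k *: A) a b = k * A a b by rewrite mxE.
      by rewrite !sE X'E /X; ring.
    have b1 a b : `|(beta x' t - beta x t) a b| <= m.+1%:R * C * `|h|.
      rewrite dbeta; apply: le_trans (ler_normD _ _) _.
      rewrite mulrSr !mulrDl mul1r; apply: lerD.
        by rewrite -mulrA; apply: sum_le.
      by rewrite normrM mulrC ler_wpM2r// B0.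
    (* The [m] terms use the second-order Taylor bound; the extra one already carries a factor [h],
       so a first-order increment suffices. *)
    have b2 a b : `|(beta x' t - beta x t - h *: B j (ray x t) - (h * t) *: M' t) a b| <=
       m.+1%:R * C * h ^+ 2.
      have -> : (beta x' t - beta x t - h *: B j (ray x t) - (h * t) *: M' t) a b =
         \sum_i X i 0 * (B i (ray x' t) a b - B i (ray x t) a b - (t * h) * D j (fun y => B i y a b) (ray x t))
         + h * (B j (ray x' t) a b - B j (ray x t) a b).
        have M'E : (M' t) a b = \sum_i X i 0 * D j (fun y => B i y a b) (ray x t).
          rewrite /M' summxE; apply: eq_bigr => i _; rewrite mxE derive_mx_entry//.
          by move=> a' b'; have [] := CB1 i a' b' rr j.
        have -> : (beta x' t - beta x t - h *: B j (ray x t) - (h * t) *: M' t) a b =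
          (beta x' t - beta x t) a b - h * B j (ray x t) a b - (h * t) * (M' t) a b.
          by move: (beta x' t - beta x t) (B j _) (M' t) => a1 a2 a3; rewrite !mxE.
        rewrite dbeta M'E.
        under [in RHS]eq_bigr do rewrite mulrBr (mulrCA _ (t * h)).
        by rewrite [in RHS]sumrB -mulr_sumr; ring.
      apply: le_trans (ler_normD _ _) _.
      rewrite mulrSr !mulrDl mul1r; apply: lerD.
        by rewrite -mulrA; apply: sum_le.
      have -> : C * h ^+ 2 = `|h| * (C * `|h|).
        by rewrite [RHS]mulrCA -expr2 -normrX ger0_norm ?sqr_ge0.
      by rewrite normrM ler_wpM2l.
    have -> : K * h ^+ 2 = N%:R * (3 * `|w0|) * (m.+1%:R * C * h ^+ 2) +
       `|h| * (N%:R * (N%:R * (3 * `|w0|) * C) * (m.+1%:R * C * `|h|)).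
      have -> : h ^+ 2 = `|h| * `|h| by rewrite -expr2 -normrX ger0_norm ?sqr_ge0.
      by rewrite /K; ring.
    apply: le_trans (ler_normD _ _) _; apply: lerD.
      have Ch : 0 <= m.+1%:R * C * h ^+ 2 by rewrite mulr_ge0 ?sqr_ge0// mulr_ge0.
      apply: le_trans (rv_mul_le _ Ch b2) _.
      by rewrite ler_wpM2r// ler_wpM2l.
    rewrite normrZ ler_pM//.
      by rewrite normrM -[leRHS]mulr1 ler_wpM2l// ler_norml; ilra.
    apply: le_trans (rv_mul_le _ _ b1) _; first by rewrite !mulr_ge0.
    rewrite ler_wpM2r ?mulr_ge0// ler_wpM2l//.
    apply: le_trans (rv_mul_le _ C0 _) _; first by move=> a b; exact: B0.
    by rewrite ler_wpM2r// ler_wpM2l.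
apply/is_deriveP => e e0.
have [d1 d10 Hd1] := open_ballP oball xr.
(* This keeps [x + h e_j] in the ball and turns [2 * K * h ^+ 2] into at most [e |h|]; the [+ 1]
   avoids division by zero. *)
exists (Num.min d1 (e / (2 * K + 1))).
  by rewrite lt_min d10 divr_gt0// ltr_wpDl// mulr_ge0.
move=> h; rewrite lt_min => /andP[hd1 hK].
apply: le_trans (key h _) _.
  apply: Hd1; rewrite addrK; apply: le_lt_trans hd1.
  rewrite normrZ ler_piMr//; apply: mx_norm_le => // a b; rewrite mxE.
  by case: (_ && _); rewrite ?normr1// normr0.
have -> : h ^+ 2 = `|h| * `|h| by rewrite -expr2 -normrX ger0_norm ?sqr_ge0.
rewrite !mulrA ler_wpM2r//.
move: hK; rewrite ltr_pdivlMr ?ltr_wpDl// ?mulr_ge0// => /ltW; apply: le_trans.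
by have := normr_ge0 h; lra.
Qed.

End linear_frobenius.

(** Starts the regularity bootstrap: at first the solution is only known to have bounded partial
    derivatives. *)
Lemma bounded_partials_continuous (R : realType) m (f : 'cV[R]_m -> R) x0 r K :
  (forall x, `|x - x0| < r -> forall j, derivable f x (frame R j) /\
     `|'D_(frame R j) f x| <= K) ->
  forall x, `|x - x0| < r -> {for x, continuous f}.
Proof.
move=> fK x xr; apply/continuous_atP => e e0.
have [d d0 Hd] := open_ballP (@open_norm_ball _ _ x0 r) xr.
pose L := m%:R * `|K| + 1.
have L0 : 0 < L by rewrite ltr_wpDl// mulr_ge0.
exists (Num.min d (e / L)); first by rewrite lt_min d0 divr_gt0.
move=> y; rewrite lt_min => /andP[/Hd yr]; rewrite ltr_pdivlMr// => /ltW yL.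
apply: le_trans (partial_lipschitz fK yr xr) _; apply: le_trans yL.
rewrite mulrC ler_wpM2l// /L.
have : m%:R * K <= m%:R * `|K| by rewrite ler_wpM2l// ler_norm.
lra.
Qed.

(* Regularity is bootstrapped from the equation satisfied by the derivatives. *)
Lemma Ckmx_linear_system (R : realType) m N (x0 : 'cV[R]_m) r K (U : set 'cV[R]_m)
    (B : 'I_m -> 'cV[R]_m -> 'M[R]_N) (W : 'cV[R]_m -> 'rV[R]_N) :
  (forall x, `|x - x0| < r -> U x) ->
  (forall k i, Ckmx k U (B i)) ->
  (forall x j, `|x - x0| < r -> is_derive x (frame R j) W (W x *m B j x)) ->
  (forall x j, `|x - x0| < r -> `|W x *m B j x| <= K) ->
  forall k, Ckmx k [set x | `|x - x0| < r] W.
Proof.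
move=> sU CB dW WK; have oU := @open_norm_ball _ _ x0 r.
have cW i j x : `|x - x0| < r -> {for x, continuous (fun y => W y i j)}.
  apply: (@bounded_partials_continuous _ _ _ x0 r K) => {}x xr l.
  have /is_derive_mxP/(_ i j)[? ->] := dW x l xr; split => //.
  by apply: le_trans (WK x l xr); exact: mx_entry_le.
elim=> [|k IH] i j; first by split => // x xr; exact: cW.
apply: (@CkS_intro _ _ _ _ _ (fun l x => (W x *m B l x) i j)) => //.
- by move=> x xr; exact: cW.
- by move=> x l xr; have /is_derive_mxP := dW x l xr; apply.
- move=> l; apply: (Ckmx_mul oU IH) => a b.
  by apply: Ck_subset (CB k l a b) => x /sU.
Qed.

(** The radius depends on the coefficients alone and not on [w0], so that several solutions with
    different initial values share one ball. *)
Lemma linear_frobenius (R : realType) m N (U : set 'cV[R]_m) x0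
    (B : 'I_m -> 'cV[R]_m -> 'M[R]_N) : open U -> U x0 ->
  (forall k i, Ckmx k U (B i)) ->
  (forall i j x, U x -> 'D_(frame R i) (B j) x + B i x *m B j x =
                        'D_(frame R j) (B i) x + B j x *m B i x) ->
  exists r, [/\ 0 < r, forall x, `|x - x0| < r -> U x &
   forall w0, exists W : 'cV[R]_m -> 'rV[R]_N, [/\ W x0 = w0,
     forall x j, `|x - x0| < r -> is_derive x (frame R j) W (W x *m B j x) &
     forall k, Ckmx k [set x | `|x - x0| < r] W]].
Proof.
move=> oU Ux0 CB flat.
have [d0 d00 Hd0] := open_ballP oU Ux0.
have [d1 [C1 [d10 C10 Hd1]]] := @local_bound R _ ('I_m * ('I_N * 'I_N))%type
  (fun p x => B p.1 x p.2.1 p.2.2) x0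
  (fun p => Ck_cont (CB 0%N p.1 p.2.1 p.2.2) Ux0).
have CB1 p : Ck 1 U ('D_(frame R p.2) (fun x => B p.1.1 x p.1.2.1 p.1.2.2)).
  by have [_ /(_ p.2)[]] := CB 2 p.1.1 p.1.2.1 p.1.2.2.
have CB2 p : Ck 0 U ('D_(frame R p.2)
    ('D_(frame R p.1.2) (fun x => B p.1.1.1 x p.1.1.2.1 p.1.1.2.2))).
  by have [_ /(_ p.2)[]] := CB1 p.1.
have [d2 [C2 [d20 C20 Hd2]]] := @local_bound R _ ('I_m * ('I_N * 'I_N) * 'I_m)%type
  _ x0 (fun p => Ck_cont (CB1 p) Ux0).
have [d3 [C3 [d30 C30 Hd3]]] := @local_bound R _ ('I_m * ('I_N * 'I_N) * 'I_m * 'I_m)%type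
  _ x0 (fun p => Ck_cont (CB2 p) Ux0).
pose C := C1 + C2 + C3.
have C0 : 0 <= C by rewrite !addr_ge0.
pose L := m%:R * (N%:R * C) + 1.
have L0 : 0 < L by rewrite ltr_wpDl// !mulr_ge0.
(* The radii [d1], [d2], [d3] come from local bounds on [B] and its first two derivatives;
   [4^-1 / L] enforces the smallness of the ray coefficient, and 1 bounds the components of
   [x - x0]. *)
pose r := Num.min (Num.min d0 d1) (Num.min (Num.min d2 d3) (Num.min 1 (4^-1 / L))).
have [r0 rd0 rd1 rd2 [rd3 r1 rL]] :
    [/\ 0 < r, r <= d0, r <= d1, r <= d2 & [/\ r <= d3, r <= 1 & r <= 4^-1 / L]].
  have q0 : 0 < 4^-1 / L by rewrite divr_gt0.
  by split; last split; rewrite /r ?lt_min ?d00 ?d10 ?d20 ?d30 ?ltr01 ?q0// !ge_min lexx ?orbT.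
have rU x : `|x - x0| < r -> U x by move=> xr; apply: Hd0; exact: lt_le_trans xr rd0.
have h1 : m%:R * r * (N%:R * C) <= 4^-1.
  move: rL; rewrite ler_pdivlMr//; apply: le_trans.
  rewrite -mulrA mulrCA ler_wpM2l ?(ltW r0)// /L; lra.
have h2 i : Ckmx 2 [set x | `|x - x0| < r] (B i).
  by move=> a b; apply: Ck_subset (CB 2 i a b) => x /rU.
have h3 i a b x : `|x - x0| < r -> `|B i x a b| <= C.
  move=> xr; apply: le_trans (Hd1 x (lt_le_trans xr rd1) (i, (a, b))) _.
  by rewrite /C; lra.
have h4 i a b j x : `|x - x0| < r -> `|'D_(frame R j) (fun y => B i y a b) x| <= C.
  move=> xr; apply: le_trans (Hd2 x (lt_le_trans xr rd2) (i, (a, b), j)) _.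
  by rewrite /C; lra.
have h5 i a b j l x : `|x - x0| < r ->
   `|'D_(frame R l) ('D_(frame R j) (fun y => B i y a b)) x| <= C.
  move=> xr; apply: le_trans (Hd3 x (lt_le_trans xr rd3) (i, (a, b), j, l)) _.
  by rewrite /C; lra.
exists r; split => // w0.
have [W [W0 HW]] := linear_frobenius_ball C0 r0 r1 h1 h2 h3 h4 h5
   (fun i j x xr => flat i j x (rU x xr)) w0.
exists W; split => //; first by move=> x j /(HW x j)[].
apply: (@Ckmx_linear_system _ _ _ _ _ (N%:R * (3 * `|w0|) * C) U B) => //.
- by move=> x j /(HW x j)[].
- move=> x j xr; have [_ Wx] := HW x j xr.
  apply: le_trans (mulmx_norm_le _ _) _; rewrite ler_pM ?mulr_ge0//.
    by rewrite ler_wpM2l.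
  by apply: mx_norm_le => // a b; exact: h3.
Qed.

(** * The inverse function theorem *)

Lemma half_contraction_fixed (R : realType) m (x0 : 'cV[R]_m) d (f : 'cV[R]_m -> 'cV[R]_m) :
  0 <= d -> (forall x, `|x - x0| <= d -> `|f x - x0| <= d) ->
  (forall x y, `|x - x0| <= d -> `|y - x0| <= d -> `|f x - f y| <= 2^-1 * `|x - y|) ->
  exists2 x, `|x - x0| <= d & f x = x.
Proof.
move=> d0 fd fc; pose u k := iter k f x0.
have uin k : `|u k - x0| <= d.
  by elim: k => [|k IH]; [rewrite subrr normr0|exact: fd].
have uS k : `|u k.+1 - u k| <= d * 2^-1 ^+ k.
  elim: k => [|k IH]; first by rewrite expr0 mulr1; exact: uin 1%N.
  apply: le_trans (fc _ _ (uin k.+1) (uin k)) _.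
  by rewrite exprS mulrCA ler_wpM2l.
have [l lu] : exists l : 'cV[R]_m, forall k, `|l - u k| <= 2 * d * 2^-1 ^+ k.
  have H i : exists l, forall k, `|l - u k i 0| <= 2 * d * 2^-1 ^+ k.
    apply: geometric_limit => k; apply: le_trans (uS k).
    by have := mx_entry_le (u k.+1 - u k) i 0; rewrite !mxE.
  exists (\col_i sval (cid (H i))) => k; apply: mx_norm_le.
    by rewrite !mulr_ge0// exprn_ge0.
  move=> i j; rewrite (ord1 j) !mxE; exact: (svalP (cid (H i))).
have lin : `|l - x0| <= d.
  rewrite leNgt; apply/negP => dl.
  suff : `|l - x0| - d = 0 by move=> ?; lra.
  apply: (@geometric_eq0 _ _ (2 * d)) => k; rewrite ger0_norm; last lra.
  rewrite lerBlDr; apply: le_trans (lerD (lu k) (uin k)).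
  by rewrite -[X in `|X|](subrKA (u k)) ler_normD.
exists l => //; apply/eqP; rewrite -subr_eq0; apply/eqP/normr0_eq0.
apply: (@geometric_eq0 _ _ (2 * d)) => k; rewrite normr_id.
have h1 := fc _ _ lin (uin k); have h2 := lu k; have := lu k.+1; rewrite distrC exprS => h3.
rewrite -[X in `|X|](subrKA (u k.+1)); apply: le_trans (ler_normD _ _) _.
by apply: le_trans (lerD h1 h3) _; lra.
Qed.

(** With Jacobian 1 at [x0], the map [Y - id] is a contraction of ratio 1/2 near [x0], which gives
    injectivity and, by a fixed point, surjectivity onto a ball. *)
Lemma inverse_function (R : realType) m x0 r (Y : 'cV[R]_m -> 'cV[R]_m) :
  0 < r -> (forall k, Ckmx k [set x | `|x - x0| < r] Y) -> jac Y x0 = 1%:M ->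
  exists d U Z, [/\ 0 < d, open U, U x0 &
   [/\ forall x, U x -> `|x - x0| < r,
       forall x, U x -> [/\ `|Y x - Y x0| < d, Z (Y x) = x & jac Y x \in unitmx],
       forall y, `|y - Y x0| < d -> U (Z y) /\ Y (Z y) = y &
       forall k, Ckmx k [set y | `|y - Y x0| < d] Z]].
Proof.
move=> r0 CY jY.
(* Chosen so that [m * e <= 1/2], the contraction ratio. *)
pose e : R := (2 * m.+1%:R)^-1.
have e0 : 0 < e by rewrite invr_gt0 mulr_gt0.
have x0r : `|x0 - x0| < r by rewrite subrr normr0.
have [d1 d10 Hd1] : exists2 d, 0 < d & forall y, `|y - x0| < d -> forall p : 'I_m * 'I_m,
    `|jac Y y p.1 p.2 - (p.1 == p.2)%:R| <= e.
  apply: near_finite => p.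
  have /continuous_atP/(_ e e0) := Ck_cont (Ckmx_jac (CY 1%N) p.1 p.2) x0r.
  by rewrite jY mxE.
pose r1 := Num.min r d1.
have r10 : 0 < r1 by rewrite lt_min r0.
have r1r x : `|x - x0| < r1 -> `|x - x0| < r by rewrite lt_min => /andP[].
have Yc y z : `|y - x0| < r1 -> `|z - x0| < r1 -> `|(Y y - y) - (Y z - z)| <= 2^-1 * `|y - z|.
  move=> yr zr; apply: mx_norm_le; first by rewrite mulr_ge0.
  move=> i l; rewrite (ord1 l) {l}.
  have := @partial_lipschitz R m (fun x => Y x i 0 - x i 0) x0 r1 e.
  move=> /(_ _ y z yr zr) H.
  have -> : (Y y - y - (Y z - z)) i 0 = Y y i 0 - y i 0 - (Y z i 0 - z i 0) by rewrite !mxE.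
  apply: le_trans (H _) _.
    move=> x xr j.
    have dg : is_derive x (frame R j) (fun x => Y x i 0 - x i 0)
        (jac Y x i j - (i == j)%:R).
      have dY := CkS_derive j (CY 1%N i 0) (r1r _ xr).
      have := is_deriveB dY (is_derive_coord x (frame R j) i).
      by rewrite /jac !mxE andbT.
    have [? ->] := dg; split => //; apply: (Hd1 _ _ (i, j)).
    by move: xr; rewrite lt_min => /andP[].
  rewrite ler_wpM2r// /e invfM mulrA -ler_pdivlMr ?invr_gt0// invrK mulrC.
  by rewrite ler_wpM2l// ler_nat.
have Yinj y z : `|y - x0| < r1 -> `|z - x0| < r1 -> `|y - z| <= 2 * `|Y y - Y z|.
  move=> yr zr; have := Yc y z yr zr.
  have -> : Y y - y - (Y z - z) = - ((y - z) - (Y y - Y z)).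
    by mxring.
  rewrite normrN; have := lerB_dist (y - z) (Y y - Y z); lra.
(* On the closed ball of radius [r1 / 2] the fixed-point map moves the centre by less than [r1 / 4]
   and contracts by 1/2, so it preserves that ball. *)
pose d := r1 / 4.
have d0 : 0 < d by rewrite divr_gt0.
have sol y : exists z, `|y - Y x0| < d -> `|z - x0| < r1 /\ Y z = y.
  have [yd|] := pselect (`|y - Y x0| < d); last by move=> ?; exists 0.
  have lt12 x : `|x - x0| <= r1 / 2 -> `|x - x0| < r1.
    by move=> h; apply: le_lt_trans h _; lra.
  (* A fixed point of [x |-> y - (Y x - x)] is a solution of [Y x = y]. *)
  have [|||x xr fx] := @half_contraction_fixed R m x0 (r1 / 2) (fun x => y - (Y x - x)).
  - by lra.
  - move=> x xr.
    have -> : y - (Y x - x) - x0 = (y - Y x0) - ((Y x - x) - (Y x0 - x0)).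
      by mxring.
    apply: le_trans (ler_normB _ _) _.
    have := Yc x x0 (lt12 _ xr); rewrite subrr normr0 => /(_ r10).
    by rewrite /d in yd; lra.
  - move=> x x' xr xr'.
    have -> : y - (Y x - x) - (y - (Y x' - x')) = - ((Y x - x) - (Y x' - x')).
      by mxring.
    by rewrite normrN; apply: Yc; exact: lt12.
  - exists x => _; split; first exact: lt12.
    have -> : Y x = y + (x - (y - (Y x - x))) by mxring.
    by rewrite fx subrr addr0.
have [Z HZ] := choice sol.
(* The second condition cuts the domain down so that its image is exactly the ball of radius [d]. *)
pose U := [set x | `|x - x0| < r1 /\ `|Y x - Y x0| < d].
have ZY y : `|y - Y x0| < d -> U (Z y) /\ Y (Z y) = y.
  by move=> yd; have [Zr YZ] := HZ y yd; rewrite /U /= YZ.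
have YZ x : U x -> Z (Y x) = x.
  move=> [xr Yd]; have [[Zr _] YZ] := ZY _ Yd.
  apply/eqP; rewrite -subr_eq0 -normr_le0.
  by have := Yinj _ _ Zr xr; rewrite YZ subrr normr0 mulr0.
have oU : open U.
  rewrite openE => x [xr Yd]; apply/nbhs_ballP.
  have [d2 d20 Hd2] := open_ballP (@open_norm_ball _ _ x0 r1) xr.
  have [d3 d30 Hd3] := open_ballP (@open_norm_ball _ _ (Y x0) d) Yd.
  have cY : {for x, continuous Y}.
    apply: mx_continuousP => i j; apply: Ck_cont (CY 0%N i j) _ _; exact: r1r.
  have d32 : 0 < d3 / 2 by lra.
  move/continuous_atP : cY => /(_ _ d32)[d4 d40 Hd4].
  exists (Num.min d2 d4); first by rewrite /= lt_min d20.
  move=> y /ball_mxE; rewrite lt_min => /andP[y2 y4]; split; first exact: Hd2.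
  by apply: Hd3; apply: le_lt_trans (Hd4 _ y4) _; lra.
(* A row [v] with [v *m jac Y x = 0] equals [- v *m (jac Y x - 1)], whose norm is at most half that
   of [v]. *)
have jU x : `|x - x0| < r1 -> jac Y x \in unitmx.
  move=> xr; rewrite -row_free_unit -kermx_eq0; apply/eqP/row_matrixP => a.
  rewrite row0; set v := row a _.
  have vJ : v *m jac Y x = 0 by rewrite /v -row_mul mulmx_ker row0.
  apply/eqP; rewrite -normr_le0.
  have E : v = - (v *m (jac Y x - 1%:M)) by rewrite mulmxBr vJ mulmx1 sub0r opprK.
  have : `|v| <= 2^-1 * `|v|; last by have := normr_ge0 v; lra.
  rewrite {1}E normrN; apply: le_trans (mulmx_norm_le _ _) _.
  have je : `|jac Y x - 1%:M| <= e.
    apply: mx_norm_le => [|i j]; first exact: ltW.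
    have sE (A : 'M[R]_m) : (A - 1%:M) i j = A i j - (i == j)%:R by rewrite !mxE.
    rewrite sE; apply: (Hd1 x _ (i, j)).
    by move: xr; rewrite lt_min => /andP[].
  rewrite mulrAC ler_wpM2r//.
  apply: le_trans (_ : _ <= m%:R * e) _; first by rewrite ler_wpM2l.
  rewrite /e invfM mulrA -ler_pdivlMr ?invr_gt0// invrK mulrC.
  by rewrite ler_wpM2l// ler_nat.
exists d, U, Z; split => //; first by split; rewrite /= subrr normr0.
split => //.
- by move=> x [/r1r].
- by move=> x Ux; have [xr Yd] := Ux; split; [exact: Yd|exact: YZ|exact: jU].
have oD := @open_norm_ball _ _ (Y x0) d.
have Zlip y z : `|y - Y x0| < d -> `|z - Y x0| < d -> `|Z y - Z z| <= 2 * `|y - z|.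
  move=> yd zd; have [[yr _] Yy] := ZY _ yd; have [[zr _] Yz] := ZY _ zd.
  by have := Yinj _ _ yr zr; rewrite Yy Yz.
have cZ y : `|y - Y x0| < d -> {for y, continuous Z}.
  move=> yd; apply/continuous_atP => e1 e10.
  have [d2 d20 Hd2] := open_ballP oD yd.
  exists (Num.min d2 (e1 / 2)); first by rewrite lt_min d20/=; lra.
  move=> z; rewrite lt_min => /andP[z2 z1].
  by apply: le_trans (Zlip _ _ (Hd2 _ z2) yd) _; lra.
pose W (y : 'cV[R]_m) := invmx (jac Y (Z y)).
have dZ y j : `|y - Y x0| < d -> is_derive y (frame R j) Z (col j (W y)).
  move=> yd; have [[Zr _] YZy] := ZY _ yd; have Zr' := r1r _ Zr.
  apply/is_deriveP => e1 e10.
  pose L := m%:R * `|W y| + 1.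
  have L0 : 0 < L by rewrite ltr_wpDl// mulr_ge0.
  pose e2 := e1 / (2 * L).
  have e20 : 0 < e2 by rewrite divr_gt0// mulr_gt0.
  have [d2 d20 Hd2] : exists2 d2, 0 < d2 & forall x, `|x - Z y| < d2 -> forall i,
      `|Y x i 0 - Y (Z y) i 0 -
        \sum_l 'D_(frame R l) (fun x => Y x i 0) (Z y) * (x - Z y) l 0| <= e2 * `|x - Z y|.
    apply: near_finite => i; apply: C1_frechet e20 => //.
    - exact: (@open_norm_ball _ _ x0 r).
    - exact: Zr'.
    - exact: CY.
  have [d3 d30 Hd3] := open_ballP oD yd.
  exists (Num.min d3 (d2 / 2)); first by rewrite lt_min d30/=; lra.
  move=> h; rewrite lt_min => /andP[h3 h2].
  have hn : `|h *: frame R j| <= `|h|.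
    rewrite normrZ ler_piMr//; apply: mx_norm_le => // a b; rewrite mxE.
    by case: (_ && _); rewrite ?normr1// normr0.
  set y' := h *: frame R j + y.
  have y'y : y' - y = h *: frame R j by rewrite addrK.
  have y'd : `|y' - Y x0| < d by apply: Hd3; rewrite y'y; exact: le_lt_trans h3.
  have [_ YZy'] := ZY _ y'd.
  have Zy : `|Z y' - Z y| <= 2 * `|h|.
    by apply: le_trans (Zlip _ _ y'd yd) _; rewrite y'y ler_wpM2l.
  have H : `|h *: frame R j - jac Y (Z y) *m (Z y' - Z y)| <= e2 * (2 * `|h|).
    apply: mx_norm_le; first by apply: mulr_ge0; [exact: ltW|exact: mulr_ge0].
    move=> i l; rewrite (ord1 l) {l} -y'y.
    have := Hd2 (Z y') _ i; rewrite YZy YZy'.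
    have -> : (y' - y - jac Y (Z y) *m (Z y' - Z y)) i 0 = y' i 0 - y i 0 -
       \sum_l 'D_(frame R l) (fun x => Y x i 0) (Z y) * (Z y' - Z y) l 0.
      have -> : \sum_l 'D_(frame R l) (fun x => Y x i 0) (Z y) * (Z y' - Z y) l 0 =
          (jac Y (Z y) *m (Z y' - Z y)) i 0.
        by rewrite mxE; apply: eq_bigr => l _; rewrite [jac _ _ _ _]mxE.
      by move: (jac Y (Z y) *m _) => A; rewrite !mxE.
    move=> H; apply: le_trans (H _) _; last by rewrite ler_wpM2l// ltW.
    by apply: le_lt_trans Zy _; lra.
  (* The remainder of [Z] is the inverse Jacobian applied to the total-differentiability remainder
     of [Y] between [Z y] and [Z y']; the Lipschitz bound on [Z] makes the latter small relative to
     [h]. *)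
  have -> : Z y' - Z y - h *: col j (W y) =
     - (W y *m (h *: frame R j - jac Y (Z y) *m (Z y' - Z y))).
    rewrite mulmxBr mulmxA mulVmx ?jU// mul1mx opprB -scalemxAr.
    by rewrite /frame colE.
  rewrite normrN; apply: le_trans (mulmx_norm_le _ _) _.
  apply: le_trans (_ : _ <= L * (e2 * (2 * `|h|))) _.
    rewrite ler_pM// ?mulr_ge0// /L; lra.
  rewrite /e2 le_eqVlt; apply/orP; left; apply/eqP; field.
  by rewrite gt_eqF.
(* The derivative of [Z] is the inverse Jacobian of [Y] composed with [Z], so order [k] of [Z]
   yields order [k.+1]. *)
elim=> [|k IH] i j.
  split => // y yd; rewrite (ord1 j).
  apply: (@continuous_comp _ _ _ Z (fun x : 'cV[R]_m => x i 0)).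
    exact: cZ.
  exact: coord_continuous.
apply: (@CkS_intro _ _ _ _ _ (fun l y => W y i l)) => //.
- move=> y yd; rewrite (ord1 j).
  apply: (@continuous_comp _ _ _ Z (fun x : 'cV[R]_m => x i 0)).
    exact: cZ.
  exact: coord_continuous.
- move=> y l yd; have /is_derive_mxP/(_ i j) := dZ y l yd.
  by rewrite mxE.
- move=> l; apply: (@Ck_comp _ _ _ _ _ [set x | `|x - x0| < r1]
    (fun x => invmx (jac Y x) i l) Z) => //.
  + exact: open_norm_ball.
  + by move=> y yd; have [[]] := ZY _ yd.
  + apply: Ckmx_inv; first exact: open_norm_ball.
      by move=> x xr; exact: jU.
    apply: Ckmx_jac => a b; apply: Ck_subset (CY k.+1 a b) => x xr; exact: r1r.
Qed.

(** * Flat charts *)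

(** A chart comes with an open total image; for smaller open sets the continuity of [cinv] is
    used. *)
Lemma cmap_image_open (R : realType) (M : topologicalType) m (c : chart R M m)
    (W : set M) : open W -> open (cmap c @` (cdom c `&` W)).
Proof.
move=> oW; rewrite openE => _ [p [cp Wp] <-].
have cxp : (cmap c @` cdom c) (cmap c p) by exists p.
have h1 := open_nbhs_nbhs (conj (@cimg_open _ _ _ c) cxp).
have cic := cinv_cts cxp.
have nW : nbhs (cinv c (cmap c p)) W by rewrite cmapK//; exact: open_nbhs_nbhs.
have h2 := cic _ nW.
apply: filterS (filterI h1 h2) => _ [[q cq <-] /=]; rewrite cmapK// => Wq.
by exists q.
Qed.

Lemma Ckmx_continuous (R : realType) m p q k (U : set 'cV[R]_m)
    (A : 'cV[R]_m -> 'M[R]_(p, q)) x :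
  Ckmx k U A -> U x -> {for x, continuous A}.
Proof. by move=> CA Ux; apply: mx_continuousP => i j; exact: Ck_cont (CA i j) _ Ux. Qed.

Section chart_change.
Context (R : realType) (M : topologicalType) (m : nat) (S : manifold R M m).
Variables (c0 : chart R M m) (U : set 'cV[R]_m) (Y Z : 'cV[R]_m -> 'cV[R]_m).
Hypothesis c0S : atlas S c0.
Hypothesis oU : open U.
Hypothesis sU : U `<=` cimg c0.
Hypothesis CY : forall k, Ckmx k U Y.
Hypothesis oYU : open (Y @` U).
Hypothesis CZ : forall k, Ckmx k (Y @` U) Z.
Hypothesis ZY : forall x, U x -> Z (Y x) = x.

Let dom := [set p | cdom c0 p /\ U (cmap c0 p)].

Let img : (Y \o cmap c0) @` dom = Y @` U.
Proof.
apply/seteqP; split.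
  by move=> _ [p [_ Up] <-]; exists (cmap c0 p).
by move=> _ [x Ux <-]; have [p cp px] := sU Ux; exists p; rewrite /= ?px//; split => //; rewrite px.
Qed.

Let dom_open : open dom.
Proof.
rewrite openE => p [cp Up].
have h1 := open_nbhs_nbhs (conj (@cdom_open _ _ _ c0) cp).
have h2 := cmap_cts cp (open_nbhs_nbhs (conj oU Up)).
exact: filterS (filterI h1 h2).
Qed.

Let img_open : open ((Y \o cmap c0) @` dom). Proof. by rewrite img. Qed.

Let mapK p : dom p -> (cinv c0 \o Z) ((Y \o cmap c0) p) = p.
Proof. by move=> [cp Up] /=; rewrite ZY// cmapK. Qed.

Let map_cts p : dom p -> {for p, continuous (Y \o cmap c0)}.
Proof.
move=> [cp Up]; apply: continuous_comp; first exact: cmap_cts.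
exact: Ckmx_continuous (CY 0%N) Up.
Qed.

Let inv_cts x : ((Y \o cmap c0) @` dom) x -> {for x, continuous (cinv c0 \o Z)}.
Proof.
rewrite img => YUx; apply: continuous_comp; first exact: Ckmx_continuous (CZ 0%N) YUx.
by case: YUx => x' Ux' <-; rewrite ZY//; apply: cinv_cts; exact: sU.
Qed.

Let newc := Chart dom_open img_open mapK map_cts inv_cts.

(** Maximality leaves compatibility with each member [c'] to check. The transitions are those
    between [c0] and [c'], preceded by [Z] in one direction and followed by [Y] in the other. *)
Let newc_atlas : atlas S newc.
Proof.
apply: atlas_max => c' c'S; have [C0 C0'] := atlas_compat c0S c'S.
split; apply/smooth_onP => k i j.
- apply: (@Ck_comp _ _ _ _ _ (cmap c0 @` (cdom c0 `&` cdom c'))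
    (fun x => transition c0 c' x i j) Z).
  + exact/cmap_image_open/cdom_open.
  + exact/cmap_image_open/cdom_open.
  + by move=> _ [p [[cp Up] c'p] <-] /=; rewrite ZY//; exists p.
  + move=> l; apply: Ck_subset (CZ k l 0) => _ [p [[cp Up] c'p] <-] /=.
    by exists (cmap c0 p).
  + exact: C0.
- rewrite setIC.
  have o1 : open (cmap c' @` (cdom c' `&` cdom newc)) by exact/cmap_image_open/cdom_open.
  apply: (@Ck_comp _ _ _ _ _ U (fun x => Y x i j) (transition c' c0)) => //.
  + by move=> _ [p [c'p [cp Up]] <-] /=; rewrite /transition /= cmapK.
  + move=> l; apply: Ck_subset (C0' l 0 k) => _ [p [c'p [cp Up]] <-] /=.
    by exists p.
  + exact: CY.
Qed.

(** The last clause packages, for each coordinate point, a point of [M] and the Jacobian with which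
    the tensor transformation laws are applied later. *)
Lemma chart_change : exists c, [/\ atlas S c,
  forall p, cdom c0 p -> U (cmap c0 p) -> cdom c p,
  cimg c = Y @` U &
  forall x, U x -> exists a, [/\ cdom c0 a, cdom c a, cmap c0 a = x,
    cmap c a = Y x & jac (transition c0 c) x = jac Y x]].
Proof.
exists newc; split => //.
move=> x Ux; have [a ca ax] := sU Ux; exists a; split => //.
- by split => //; rewrite ax.
- by rewrite /= ax.
- apply/matrixP => i j; rewrite !mxE; apply: near_eq_derive.
  have fg y : (cmap c0 @` cdom c0) y -> transition c0 newc y i 0 = Y y i 0.
    by move=> [b cb <-]; rewrite /transition /= cmapK.
  exact: open_eq_near (@cimg_open _ _ _ c0) (sU Ux) fg.
Qed.

End chart_change.

Lemma frame_sum (R : realType) m (j : 'I_m) (F : 'I_m -> R) :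
  \sum_i F i * frame R j i 0 = F j.
Proof.
rewrite (bigD1 j)//= mxE !eqxx mulr1 big1 ?addr0// => i ij.
by rewrite mxE (negbTE ij) mulr0.
Qed.

Lemma mulmx_frameE (R : realType) m p (A : 'M[R]_(p, m)) j a : (A *m frame R j) a 0 = A a j.
Proof. by rewrite mxE frame_sum. Qed.

Lemma eq_mulmx_frame (R : realType) m p (A B : 'M[R]_(p, m)) :
  (forall j, A *m frame R j = B *m frame R j) -> A = B.
Proof. by move=> AB; apply/matrixP => a j; rewrite -[LHS]mulmx_frameE AB mulmx_frameE. Qed.

Lemma posdef_unitmx (R : realType) m (G : 'M[R]_m) :
  (forall v : 'cV[R]_m, v != 0 -> 0 < (v^T *m G *m v) 0 0) -> G \in unitmx.
Proof.
move=> Gpos; rewrite -row_free_unit -kermx_eq0; apply/eqP/row_matrixP => a.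
rewrite row0; set u := row a _.
have uG : u *m G = 0 by rewrite /u -row_mul mulmx_ker row0.
apply/eqP; apply: contraT => u0.
have ut0 : u^T != 0 by rewrite -trmx0 (inj_eq trmx_inj).
by have := Gpos _ ut0; rewrite trmxK uG mul0mx mxE ltxx.
Qed.

Section christoffel.
Context (R : realType) (m : nat) (U : set 'cV[R]_m) (G : 'cV[R]_m -> 'M[R]_m).
Hypothesis oU : open U.
Hypothesis CG : forall k, Ckmx k U G.
Hypothesis Gsym : forall x, U x -> (G x)^T = G x.
Hypothesis Gpos : forall x (v : 'cV[R]_m), U x -> v != 0 -> 0 < (v^T *m G x *m v) 0 0.

(** The connection matrix in direction [i]: column [j] is the covariant derivative of the [j]-th
    frame field. A parallel covector field [w] satisfies [D_i w = w *m christoffel_mx i]. *)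
Definition christoffel_mx (i : 'I_m) (x : 'cV[R]_m) : 'M[R]_m :=
  \matrix_(k, j) christoffel G k i j x.

Let Gunit x : U x -> G x \in unitmx.
Proof. by move=> Ux; apply: posdef_unitmx => v; exact: Gpos. Qed.

Lemma christoffel_mx_smooth k i : Ckmx k U (christoffel_mx i).
Proof.
move=> a b; under [X in Ck _ _ X]eq_fun do rewrite mxE.
apply: CkM => //; first exact: Ck_cst.
apply: Ck_sum => // l _; apply: CkM => //.
  by apply: Ckmx_inv => //; exact: Gunit.
have dG p q r : Ck k U ('D_(frame R r) (fun y => G y p q)).
  by have [_ /(_ r)[]] := CG k.+1 p q.
apply: CkD => //; first exact: CkD.
under [X in Ck _ _ X]eq_fun do rewrite -mulN1r.
by apply: CkM => //; exact: Ck_cst.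
Qed.

Let dGsym i j l x : U x ->
  'D_(frame R l) (fun y => G y i j) x = 'D_(frame R l) (fun y => G y j i) x.
Proof.
move=> Ux; apply: near_eq_derive.
have fg y : U y -> G y i j = G y j i by move=> Uy; rewrite -{1}(Gsym Uy) mxE.
exact: open_eq_near oU Ux fg.
Qed.

Lemma christoffel_mx_sym i j x : U x ->
  christoffel_mx i x *m frame R j = christoffel_mx j x *m frame R i.
Proof.
move=> Ux; apply/colP => k; rewrite !mulmx_frameE !mxE /christoffel.
congr (_ * _); apply: eq_bigr => l _; congr (_ * _).
by rewrite (dGsym i j l Ux); congr (_ - _); rewrite addrC.
Qed.

(** Lowering the index ([low]) gives the Christoffel symbols of the first kind; adding the transpose
    cancels all but the derivative in direction [i]. *)
Lemma metric_compatible i x : U x ->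
  'D_(frame R i) G x = (christoffel_mx i x)^T *m G x + G x *m christoffel_mx i x.
Proof.
move=> Ux.
have low l j : (G x *m christoffel_mx i x) l j =
    2^-1 * ('D_(frame R i) (fun y => G y j l) x + 'D_(frame R j) (fun y => G y i l) x
     - 'D_(frame R l) (fun y => G y i j) x).
  pose T : 'cV[R]_m := \col_l ('D_(frame R i) (fun y => G y j l) x +
    'D_(frame R j) (fun y => G y i l) x - 'D_(frame R l) (fun y => G y i j) x).
  have : (G x *m (invmx (G x) *m T)) l 0 = T l 0 by rewrite mulmxA mulmxV ?Gunit// mul1mx.
  rewrite [in RHS]mxE => <-; rewrite mxE [in RHS]mxE mulr_sumr; apply: eq_bigr => k _.
  rewrite mxE /christoffel mulrCA; congr (_ * (_ * _)).
  by rewrite mxE; apply: eq_bigr => l' _; rewrite mxE.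
apply/matrixP => a b; rewrite derive_mx_entry; last first.
  by move=> i' j'; have [] := CkS_derive i (CG 1 i' j') Ux.
have -> : ((christoffel_mx i x)^T *m G x + G x *m christoffel_mx i x) a b =
    (G x *m christoffel_mx i x) b a + (G x *m christoffel_mx i x) a b.
  rewrite mxE; congr (_ + _).
  by rewrite -{1}(Gsym Ux) -trmx_mul mxE.
rewrite !low (dGsym b a i Ux) (dGsym i b a Ux) (dGsym i a b Ux).
by rewrite (dGsym b i a Ux) (dGsym a i b Ux); field.
Qed.

Lemma cov_deriv_frame i (F : 'cV[R]_m -> 'cV[R]_m) x :
  cov_deriv G (fun=> frame R i) F x =
  'D_(frame R i) F x + christoffel_mx i x *m F x.
Proof.
congr (_ + _); apply/colP => k; rewrite !mxE exchange_big/=; apply: eq_bigr => j _.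
under eq_bigr do rewrite mulrAC; by rewrite frame_sum mxE.
Qed.

(** Frame fields have constant components, so their brackets vanish and the curvature is the
    commutator of the operators [D_i + christoffel_mx i], which is a matrix applied to
    [frame R k]. *)
Lemma flat_christoffel i j x : U x ->
  (forall k, riemann G (fun=> frame R i) (fun=> frame R j) (fun=> frame R k) x = 0) ->
  'D_(frame R i) (christoffel_mx j) x + christoffel_mx i x *m christoffel_mx j x =
  'D_(frame R j) (christoffel_mx i) x + christoffel_mx j x *m christoffel_mx i x.
Proof.
move=> Ux flat; apply: eq_mulmx_frame => k.
have cov2 a b :
   cov_deriv G (fun=> frame R a) (cov_deriv G (fun=> frame R b) (fun=> frame R k)) x =
   ('D_(frame R a) (christoffel_mx b) x + christoffel_mx a x *m christoffel_mx b x) *m frame R k.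
  have -> : cov_deriv G (fun=> frame R b) (fun=> frame R k) =
      fun y => christoffel_mx b y *m frame R k.
    by apply/funext => y; rewrite cov_deriv_frame derive_cst add0r.
  rewrite cov_deriv_frame mulmxDl mulmxA; congr (_ + _).
  have dc := Ckmx_derive a (@christoffel_mx_smooth 1 b) Ux.
  have [_ ->] := is_derive_mulmx dc (is_derive_cst (frame R k) x (frame R a)).
  by rewrite mulmx0 addr0.
have := flat k; rewrite /riemann !cov2.
have -> : cov_deriv G (bracket (fun=> frame R i) (fun=> frame R j)) (fun=> frame R k) x = 0.
  rewrite /cov_deriv /bracket /= !derive_cst subrr add0r; apply/colP => l.
  by rewrite !mxE big1// => a _; rewrite big1// => b _; rewrite mxE mulr0 mul0r.
by rewrite subr0 => /eqP; rewrite subr_eq0 => /eqP.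
Qed.

End christoffel.

Lemma is_derive_block (R : realType) (V : normedModType R) p1 p2 q1 q2
    (A : V -> 'M[R]_(p1, q1)) (B : V -> 'M[R]_(p1, q2))
    (C : V -> 'M[R]_(p2, q1)) (D : V -> 'M[R]_(p2, q2)) x v A' B' C' D' :
  is_derive x v A A' -> is_derive x v B B' -> is_derive x v C C' -> is_derive x v D D' ->
  is_derive x v (fun y => block_mx (A y) (B y) (C y) (D y)) (block_mx A' B' C' D').
Proof.
move=> /is_derive_mxP dA /is_derive_mxP dB /is_derive_mxP dC /is_derive_mxP dD.
apply/is_derive_mxP => i j.
case: (split_ordP i) => {}i ->; case: (split_ordP j) => {}j ->.
- by rewrite block_mxEul; under [X in is_derive _ _ X]eq_fun do rewrite block_mxEul.
- by rewrite block_mxEur; under [X in is_derive _ _ X]eq_fun do rewrite block_mxEur.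
- by rewrite block_mxEdl; under [X in is_derive _ _ X]eq_fun do rewrite block_mxEdl.
- by rewrite block_mxEdr; under [X in is_derive _ _ X]eq_fun do rewrite block_mxEdr.
Qed.

(* The linear system has a function and its differential as unknowns: the
   differential has to be parallel. *)
Lemma flat_coordinates (R : realType) m (U : set 'cV[R]_m) x0
    (Gam : 'I_m -> 'cV[R]_m -> 'M[R]_m) : open U -> U x0 ->
  (forall k i, Ckmx k U (Gam i)) ->
  (forall i j x, U x -> Gam i x *m frame R j = Gam j x *m frame R i) ->
  (forall i j x, U x -> 'D_(frame R i) (Gam j) x + Gam i x *m Gam j x =
                        'D_(frame R j) (Gam i) x + Gam j x *m Gam i x) ->
  exists r Y, [/\ 0 < r, forall x, `|x - x0| < r -> U x,
    forall k, Ckmx k [set x | `|x - x0| < r] Y, jac Y x0 = 1%:M &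
    forall x j, `|x - x0| < r -> is_derive x (frame R j) (jac Y) (jac Y x *m Gam j x)].
Proof.
move=> oU Ux0 CGam sym flat.
(* A row [(y, w)] times [B j] is [(w_j, w *m Gam j)]: the system says at once that [w] is the
   differential of [y] and that [w] is parallel. *)
pose B j x := block_mx (0 : 'M[R]_1) 0 (frame R j) (Gam j x).
have dB i j x : U x ->
    is_derive x (frame R i) (B j) (block_mx 0 0 0 ('D_(frame R i) (Gam j) x)).
  move=> Ux; apply: is_derive_block; try exact: is_derive_cst.
  exact: Ckmx_derive (CGam 1 j) Ux.
have CB k j : Ckmx k U (B j).
  move=> a b; rewrite /B.
  case: (split_ordP a) => {}a ->; case: (split_ordP b) => {}b ->.
  - under [X in Ck _ _ X]eq_fun do rewrite block_mxEul.
    by under [X in Ck _ _ X]eq_fun do rewrite mxE; exact: Ck_cst.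
  - under [X in Ck _ _ X]eq_fun do rewrite block_mxEur.
    by under [X in Ck _ _ X]eq_fun do rewrite mxE; exact: Ck_cst.
  - under [X in Ck _ _ X]eq_fun do rewrite block_mxEdl; exact: Ck_cst.
  - under [X in Ck _ _ X]eq_fun do rewrite block_mxEdr; exact: CGam.
(* The lower left block of integrability is the absence of torsion ([sym]), the lower right one the
   absence of curvature. *)
have flatB i j x : U x -> 'D_(frame R i) (B j) x + B i x *m B j x =
                        'D_(frame R j) (B i) x + B j x *m B i x.
  move=> Ux; have [_ ->] := dB i j x Ux; have [_ ->] := dB j i x Ux.
  rewrite /B !mulmx_block !mul0mx !mulmx0 !addr0 !add0r !add_block_mx !add0r.
  by rewrite sym// flat.
have [r [r0 rU HW]] := linear_frobenius oU Ux0 CB flatB.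
(* The [a]-th coordinate starts with value 0 and differential [dx_a], which makes the Jacobian the
   identity at [x0]. *)
have [W W0] := choice (fun a : 'I_m => HW (row_mx 0 (frame R a)^T)).
pose A x : 'M[R]_m := \matrix_(a, j) (W a x) 0 (rshift 1 j).
pose Y x : 'cV[R]_m := \col_a (W a x) 0 (lshift m 0).
have rowA a x : row a (A x) = rsubmx (W a x) by apply/rowP => j; rewrite !mxE.
have WB a j x : W a x *m B j x = row_mx (row a (A x) *m frame R j) (row a (A x) *m Gam j x).
  rewrite -{1}[W a x]hsubmxK /B mul_row_block !mulmx0 !add0r -rowA.
  by [].
have CW a k : Ckmx k [set x | `|x - x0| < r] (W a) by have [_ _] := W0 a; exact.
have dY x a j : `|x - x0| < r -> is_derive x (frame R j) (fun y => Y y a 0) (A x a j).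
  move=> xr; have [_ dW _] := W0 a; have /is_derive_mxP/(_ 0 (lshift m 0)) := dW x j xr.
  rewrite WB row_mxEl mulmx_frameE mxE.
  by under [X in _ -> is_derive _ _ X _]eq_fun do rewrite mxE.
have jacY x : `|x - x0| < r -> jac Y x = A x.
  by move=> xr; apply/matrixP => a j; rewrite [LHS]mxE; have [_ ->] := dY x a j xr.
exists r, Y; split => //.
- move=> k a b; under [X in Ck _ _ X]eq_fun do rewrite mxE; exact: CW.
- rewrite jacY ?subrr ?normr0//; apply/matrixP => a j; rewrite mxE.
  have [-> _ _] := W0 a; rewrite row_mxEr !mxE andbT eq_sym//.
- move=> x j xr; have oB := @open_norm_ball _ _ x0 r.
  apply: (is_derive_ext (U := [set x | `|x - x0| < r]) (f := A)) => //.
    by move=> y yr; rewrite jacY.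
  apply/is_derive_mxP => a b.
  have [_ dW _] := W0 a; have /is_derive_mxP/(_ 0 (rshift 1 b)) := dW x j xr.
  rewrite WB row_mxEr jacY// -row_mul [row _ _ _ _]mxE.
  by under [X in _ -> is_derive _ _ X _]eq_fun do rewrite mxE.
Qed.

Lemma mulmx_cancel (R : realType) m (J A : 'M[R]_m) :
  J \in unitmx -> J^T *m A *m J = 0 -> A = 0.
Proof.
move=> uJ H.
have uJT : J^T \in unitmx by rewrite unitmx_tr.
by rewrite -[A](mulKmx uJT) -[J^T *m A](mulmxK uJ) H mul0mx mulmx0.
Qed.

(** With [J] the Jacobian, differentiating [G = J^T g J] gives the two connection terms from
    [D J = J Gam], and metric compatibility says they already make up [D G]. The term with the
    derivative of [g] must therefore vanish. *)
Lemma flat_chart (R : realType) (M : topologicalType) m (S : manifold R M m)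
    (g : riemannian_metric S) (p : M) : flat_metric g ->
  exists c y0 d, [/\ atlas S c, cdom c p, 0 < d, cimg c = [set y | `|y - y0| < d] &
    forall y a, cimg c y -> is_derive y (frame R a) (g c) 0].
Proof.
move=> hflat; have [c0 c0S c0p] := atlas_cover S p.
pose U0 := cimg c0; pose x0 := cmap c0 p; pose G := g c0.
have oU0 : open U0 by exact: cimg_open.
have U0x0 : U0 x0 by exists p.
have CG k : Ckmx k U0 G by move: k; apply/smooth_onP; exact: rm_smooth.
have Gsym x : U0 x -> (G x)^T = G x by exact: rm_sym.
have Gpos x (v : 'cV[R]_m) : U0 x -> v != 0 -> 0 < (v^T *m G x *m v) 0 0.
  by move=> ? ?; exact: rm_pos.
have smc v : smooth_on U0 (fun=> v : 'cV[R]_m).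
  apply/smooth_onP => k i j; exact: Ck_cst.
have [r [Y [r0 rU CY JY dJ]]] := flat_coordinates oU0 U0x0
  (christoffel_mx_smooth oU0 CG Gpos) (christoffel_mx_sym oU0 Gsym)
  (fun i j x Ux => flat_christoffel oU0 CG Gpos Ux
     (fun k => hflat c0 _ _ _ c0S (smc _) (smc _) (smc _) x Ux)).
have [d [U [Z [d0 oU Ux0 [Ur UY YZ CZ]]]]] := inverse_function r0 CY JY.
have YU : Y @` U = [set y | `|y - Y x0| < d].
  apply/seteqP; split; first by move=> _ [x Ux <-]; have [] := UY x Ux.
  by move=> y yd; have [UZ YZy] := YZ y yd; exists (Z y).
have oYU : open (Y @` U) by rewrite YU; exact: open_norm_ball.
have [|||||c [cS cdc cic ca]] := @chart_change R M m S c0 U Y Z c0S oU.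
- by move=> x /Ur /rU.
- by move=> k i j; apply: Ck_subset (CY k i j) => x /Ur.
- exact: oYU.
- by rewrite YU.
- by move=> x /UY[].
exists c, (Y x0), d; split => //.
- exact: cdc.
- by rewrite cic.
move=> y a; rewrite cic => -[x Ux <-].
have xr := Ur x Ux; have U0x := rU x xr; have [_ _ uJ] := UY x Ux.
have gE z : U z -> (jac Y z)^T *m g c (Y z) *m jac Y z = G z.
  move=> Uz; have [b [b0 b1 <- bY <-]] := ca z Uz.
  by rewrite /G (rm_law g c0S cS b0 b1) bY.
have oc : open (cimg c) by exact: cimg_open.
have Ccg k : Ckmx k (cimg c) (g c) by move: k; apply/smooth_onP; exact: rm_smooth.
have cYx : cimg c (Y x) by rewrite cic; exists x.
pose dg b := 'D_(frame R b) (g c) (Y x).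
have dgP b : is_derive (Y x) (frame R b) (g c) (dg b) := Ckmx_derive b (Ccg 1%N) cYx.
(* The derivative of the new metric along the old coordinate direction [e_j]; the inverse Jacobian
   recovers the new directions at the end. *)
pose dH j := \sum_b jac Y x b j *: dg b.
have dHP j : is_derive x (frame R j) (fun z => g c (Y z)) (dH j).
  apply/is_derive_mxP => s t.
  have fr : frechet (fun z => g c z s t) (Y x) by apply: C1_frechet oc cYx _; exact: Ccg.
  have dY : is_derive x (frame R j) Y (jac Y x *m frame R j).
    apply/is_derive_mxP => i l; rewrite (ord1 l) mulmx_frameE mxE.
    exact: CkS_derive (CY 1%N i 0) xr.
  have := frechet_comp fr dY; congr (is_derive _ _ _ _).
  rewrite /dH summxE; apply: eq_bigr => b _; rewrite mulmx_frameE [in RHS]mxE mulrC.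
  by congr (_ * _); have /is_derive_mxP/(_ s t)[_ ->] := dgP b.
have dH0 j : dH j = 0.
  apply: mulmx_cancel uJ _.
  have dJj := dJ x j xr.
  have h1 := is_derive_mulmx (is_derive_mulmx (is_derive_trmx dJj) (dHP j)) dJj.
  have [_ h2] := is_derive_ext oU Ux gE h1.
  move: h2; rewrite -/G (metric_compatible oU0 CG Gsym Gpos j U0x) -(gE x Ux).
  rewrite trmx_mul.
  move: (jac Y x) (christoffel_mx _ _ _) (g c (Y x)) (dH j) => J Gm g1 dh.
  rewrite !mulmxDl !mulmxA.
  move: (Gm^T *m J^T *m g1 *m J) (J^T *m dh *m J) (J^T *m g1 *m J *m Gm) => T1 T2 T3 E.
  have -> : T2 = T1 + T2 + T3 - (T1 + T3) by mxring.
  by rewrite -E subrr.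
have : dg a = 0; last by move=> <-; exact: dgP.
have -> : dg a = \sum_j invmx (jac Y x) j a *: dH j.
  rewrite /dH; under eq_bigr do rewrite scaler_sumr; rewrite exchange_big/=.
  under eq_bigr => b _.
    under eq_bigr do rewrite scalerA mulrC.
    rewrite -scaler_suml.
    have -> : \sum_j jac Y x b j * invmx (jac Y x) j a = (b == a)%:R.
      by have := congr1 (fun A : 'M[R]_m => A b a) (mulmxV uJ); rewrite !mxE.
  over.
  by rewrite (bigD1 a)//= eqxx scale1r big1 ?addr0// => b /negbTE ->; rewrite scale0r.
by rewrite big1// => j _; rewrite dH0 scaler0.
Qed.

(** * Parallelism of the structure tensors *)

(* S X Y Z stands for g(Y, (D_X phi) Z) and H X Y for g(D_X xi, Y). *)
Lemma cosymplectic_algebra (R : realType) (V : Type) (f : V -> V) (xi : V) (eta : V -> R)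
    (S : V -> V -> V -> R) (H : V -> V -> R) :
  (forall X Y Z, S X Y Z = - S (f (f X)) Y Z + eta X * S xi Y Z) ->
  (forall Y Z, S (f xi) Y Z = 0) ->
  (forall X Y Z, S X Y Z = - S X Z Y) ->
  (forall X Y Z, S X Y Z + S Y Z X + S Z X Y = 0) ->
  (forall Y Z, S Y Z xi = H Y (f Z)) ->
  (forall E F W, S (f E) W F - S (f F) W E - S F (f W) E + S E (f W) F = 0) ->
  (forall Y Z, H Y Z = H Z Y) ->
  (forall Y Z, H Y (f (f Z)) = - H Y Z) ->
  (forall Y Z, H Y Z = 0) /\ (forall X Y Z, S X Y Z = 0).
Proof.
move=> Sdec Sfxi skew cyc Sxi nij Hsym Hff.
(* The cyclic identity with [xi] in one slot expresses the derivative along [xi] through [H]. *)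
have Sxi1 A F : S xi A F = H F (f A) - H A (f F).
  by have := cyc xi A F; rewrite (skew F xi A) !Sxi; lra.
(* Normality with first argument [xi] collapses to [-2 H (f F) (f W) = 0]; applying [f] once more to
   both arguments then gives all of [H]. *)
have H0 F W : H (f F) (f W) = 0.
  have := nij xi F W; rewrite Sfxi Sxi1 !Sxi !Hff (Hsym (f W)); lra.
have HH Y Z : H Y Z = 0.
  by have := H0 (f Y) (f Z); rewrite Hff Hsym Hff opprK Hsym.
split => // X Y Z.
have q E W F : S (f E) W F - S (f F) W E - S (f W) F E = 0.
  by have := nij E F W; have := cyc E (f W) F; rewrite (skew F E (f W)); lra.
(* Up to skewness in the last two arguments, the instances of [q] read [A + B + C = 0] and
   [A - B - C = 0], with [A] the wanted term. *)
have fS E W F : S (f E) W F = 0.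
  have := q E W F; have := q W F E; have := q F E W.
  rewrite (skew (f F) W E) (skew (f W) E F) (skew (f E) F W).
  rewrite (skew (f E) W F) (skew (f F) E W) (skew (f W) F E) !opprK; lra.
by rewrite Sdec fS Sxi1 !HH subrr mulr0 addr0 oppr0.
Qed.

Lemma Ckmx_derive_along (R : realType) m p q (U : set 'cV[R]_m)
    (A : 'cV[R]_m -> 'M[R]_(p, q)) x v : open U -> Ckmx 1 U A -> U x ->
  is_derive x v A (\sum_j v j 0 *: 'D_(frame R j) A x).
Proof.
move=> oU CA Ux; apply/is_derive_mxP => a b.
have := frechet_derive v (C1_frechet oU Ux (CA a b)).
congr (is_derive _ _ _ _); rewrite summxE; apply: eq_bigr => j _.
rewrite [in RHS]mxE derive_mx_entry// => i' j'.
by have [] := CkS_derive j (CA i' j') Ux.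
Qed.

Lemma is_derive_mulmxr (R : realType) (V : normedModType R) p q r
    (A : V -> 'M[R]_(p, q)) (B : 'M[R]_(q, r)) x v A' :
  is_derive x v A A' -> is_derive x v (fun y => A y *m B) (A' *m B).
Proof.
move=> dA; have := is_derive_mulmx dA (is_derive_cst B x v).
by rewrite mulmx0 addr0.
Qed.

Lemma is_derive_mulmxl (R : realType) (V : normedModType R) p q r
    (A : 'M[R]_(p, q)) (B : V -> 'M[R]_(q, r)) x v B' :
  is_derive x v B B' -> is_derive x v (fun y => A *m B y) (A *m B').
Proof.
move=> dB; have := is_derive_mulmx (is_derive_cst A x v) dB.
by rewrite mul0mx add0r.
Qed.

Lemma tr_frame_mul (R : realType) m p (A : 'M[R]_(m, p)) i j :
  ((frame R i)^T *m A) 0 j = A i j.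
Proof. by rewrite /frame trmx_delta -rowE mxE. Qed.

Lemma bilin_eq (R : realType) m (A B : 'M[R]_m) :
  (forall u v : 'cV[R]_m, (u^T *m A *m v) 0 0 = (u^T *m B *m v) 0 0) -> A = B.
Proof.
move=> AB; apply/matrixP => i j; have := AB (frame R i) (frame R j).
by rewrite !mulmx_frameE !tr_frame_mul.
Qed.

Section contact_pointwise.
Context (R : realType) (m : nat) (G f : 'M[R]_m) (x : 'cV[R]_m) (e : 'rV[R]_m).
Hypothesis Gsym : G^T = G.
Hypothesis ff : f *m f = - 1%:M + tensor e x.
Hypothesis compat : forall u v, bilin G (f *m u) (f *m v) =
  bilin G u v - pairing e u * pairing e v.
Hypothesis fx : f *m x = 0.
Hypothesis ef : e *m f = 0.
Hypothesis ex : pairing e x = 1.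

(** Compatibility tested against [x] has vanishing left side because [f] kills [x], leaving
    [g(u, x) = e(u)]. *)
Lemma contact_form_metric : e = x^T *m G.
Proof.
apply: trmx_inj; rewrite trmx_mul trmxK Gsym; apply/colP => i.
have := compat (frame R i) x.
rewrite fx ex mulr1 /bilin mulmx0 mxE => /eqP; rewrite eq_sym subr_eq0 => /eqP.
by rewrite /pairing mulmx_frameE -mulmxA tr_frame_mul => ->; rewrite mxE.
Qed.

(** Compatibility reads [f^T G f = G - e^T e]. Multiplying by [f] on the right and using
    [f f = -1 + x e], both rank-one terms die since [e f = 0]. *)
Lemma contact_endo_skew : f^T *m G = - (G *m f).
Proof.
have fGf : f^T *m G *m f = G - e^T *m e.
  apply: bilin_eq => u v; have := compat u v; rewrite /bilin /pairing trmx_mul !mulmxA => ->.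
  have -> : (e *m u) 0 0 * (e *m v) 0 0 = (u^T *m (e^T *m e) *m v) 0 0.
    rewrite mulmxA -trmx_mul -mulmxA.
    by move: (e *m u) (e *m v) => a b; rewrite !mxE big_ord1 mxE.
  rewrite mulmxBr mulmxBl.
  by move: (u^T *m G *m v) (u^T *m _ *m v) => A B; rewrite !mxE.
have : f^T *m G *m f *m f = (G - e^T *m e) *m f by rewrite fGf.
rewrite mulmxBl -[e^T *m e *m f]mulmxA ef mulmx0 subr0 -mulmxA ff mulmxDr mulmxN mulmx1.
have -> : f^T *m G *m tensor e x = 0.
  have E : f^T *m G *m x = (x^T *m G *m f)^T by rewrite !trmx_mul trmxK Gsym mulmxA.
  by rewrite /tensor mulmxA E -contact_form_metric ef trmx0 mul0mx.
by rewrite addr0 => <-; rewrite opprK.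
Qed.

End contact_pointwise.

Section parallel.
Context (R : realType) (m : nat) (U : set 'cV[R]_m).
Variables (g f : 'cV[R]_m -> 'M[R]_m) (x : 'cV[R]_m -> 'cV[R]_m) (e : 'cV[R]_m -> 'rV[R]_m).
Hypothesis oU : open U.
Hypothesis Cg : Ckmx 1 U g.
Hypothesis Cf : Ckmx 1 U f.
Hypothesis Cx : Ckmx 1 U x.
Hypothesis dg : forall y a, U y -> is_derive y (frame R a) g 0.
Hypothesis gunit : forall y, U y -> g y \in unitmx.
Hypothesis gsym : forall y, U y -> (g y)^T = g y.
Hypothesis ff : forall y, U y -> f y *m f y = - 1%:M + tensor (e y) (x y).
Hypothesis compat : forall y u v, U y ->
  bilin (g y) (f y *m u) (f y *m v) = bilin (g y) u v - pairing (e y) u * pairing (e y) v.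
Hypothesis fx : forall y, U y -> f y *m x y = 0.
Hypothesis ef : forall y, U y -> e y *m f y = 0.
Hypothesis ex : forall y, U y -> pairing (e y) (x y) = 1.
Hypothesis deta : forall (E F : 'cV[R]_m) y, U y ->
  d_one_form e (fun=> E) (fun=> F) y = 0.
Hypothesis dPhi : forall (E F G : 'cV[R]_m) y, U y ->
  d_two_form (fundamental_form g f) (fun=> E) (fun=> F) (fun=> G) y = 0.
Hypothesis nij : forall (E F : 'cV[R]_m) y, U y ->
  nijenhuis f (fun=> E) (fun=> F) y = 0.

(** Constant fields have vanishing brackets, so closedness and normality become identities between
    first derivatives, to which the differentiated structure equations are added. *)
Lemma cosymplectic_parallel y v : U y ->
  [/\ is_derive y v f 0, is_derive y v x 0 & is_derive y v e 0].
Proof.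
move=> Uy.
pose df (v : 'cV[R]_m) := \sum_j v j 0 *: 'D_(frame R j) f y.
pose dx (v : 'cV[R]_m) := \sum_j v j 0 *: 'D_(frame R j) x y.
have dfP w : is_derive y w f (df w) by exact: Ckmx_derive_along w oU Cf Uy.
have dxP w : is_derive y w x (dx w) by exact: Ckmx_derive_along w oU Cx Uy.
have dgP w : is_derive y w g 0.
  have := Ckmx_derive_along w oU Cg Uy; congr (is_derive _ _ _ _).
  by rewrite big1// => j _; have [_ ->] := dg j Uy; rewrite scaler0.
have eE z : U z -> e z = (x z)^T *m g z.
  by move=> Uz; apply: (@contact_form_metric _ _ (g z) (f z)); auto.
have skewE z : U z -> (f z)^T *m g z = - (g z *m f z).
  by move=> Uz; apply: (@contact_endo_skew _ _ (g z) (f z) (x z) (e z)); auto.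
have deP w : is_derive y w e ((dx w)^T *m g y).
  have := is_derive_mulmx (is_derive_trmx (dxP w)) (dgP w); rewrite mulmx0 addr0.
  by apply: is_derive_ext oU Uy _ => z /eE ->.
have dfskew w : (df w)^T *m g y = - (g y *m df w).
  have h1 := is_derive_mulmx (is_derive_trmx (dfP w)) (dgP w).
  have h2 := is_deriveN (is_derive_mulmx (dgP w) (dfP w)).
  have [_ h3] := is_derive_ext oU Uy skewE h1; have [_ h4] := h2.
  by have := etrans (esym h3) h4; rewrite mulmx0 addr0 mul0mx add0r.
have trE (w : 'rV[R]_m) (z : 'cV[R]_m) : (w *m z) 0 0 = (z^T *m w^T) 0 0.
  by rewrite -trmx_mul [in RHS]mxE.
pose S (X Y Z : 'cV[R]_m) : R := (Y^T *m g y *m (df X *m Z)) 0 0.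
pose H (Y Z : 'cV[R]_m) : R := ((dx Y)^T *m g y *m Z) 0 0.
have dflin a X Y : df (a *: X + Y) = a *: df X + df Y.
  rewrite /df scaler_sumr -big_split/=; apply: eq_bigr => j _.
  by rewrite !mxE scalerDl scalerA.
(* Differentiating [e(x) = 1] gives twice [g(D x, x)], because [e] is the metric dual of [x] and [g]
   is constant. *)
have dxe Y : (dx Y)^T *m g y *m x y = 0.
  have h1 := is_derive_mulmx (deP Y) (dxP Y).
  have h2 : is_derive y Y (fun z => e z *m x z) 0.
    have E z : U z -> 1%:M = e z *m x z.
      by move=> Uz; have := ex Uz; rewrite /pairing => h;
        apply/matrixP => i j; rewrite (ord1 i) (ord1 j) h mxE.
    by apply: is_derive_ext oU Uy E _; exact: is_derive_cst.
  have [_ ] := h1; have [_ ->] := h2; rewrite eE// => /esym.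
  have -> : (x y)^T *m g y *m dx Y = (dx Y)^T *m g y *m x y.
    apply/matrixP => i j; rewrite (ord1 i) (ord1 j) -mulmxA trE !trmx_mul trmxK gsym//.
  move=> /matrixP h; apply/matrixP => i j; have := h i j.
  by move: (_ *m x y) => A; rewrite !mxE; lra.
have dfx Y : df Y *m x y = - (f y *m dx Y).
  have h1 := is_derive_mulmx (dfP Y) (dxP Y).
  have h2 : is_derive y Y (fun z => f z *m x z) 0.
    have E z : U z -> 0 = f z *m x z by move=> /fx ->.
    by apply: is_derive_ext oU Uy E _; exact: is_derive_cst.
  have [_] := h1; have [_ ->] := h2 => /esym/eqP.
  by rewrite addr_eq0 => /eqP.
have eHsym Y Z : H Y Z = H Z Y.
  have pd A B : is_derive y A (fun z => pairing (e z) B) (H A B).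
    by have /is_derive_mxP/(_ 0 0) := is_derive_mulmxr B (deP A).
  have := deta Y Z Uy; rewrite /d_one_form /lie_deriv.
  have [_ ->] := pd Y Z; have [_ ->] := pd Z Y.
  rewrite /bracket !derive_cst subrr /pairing mulmx0 mxE subr0.
  by move/eqP; rewrite mulf_eq0 invr_eq0 pnatr_eq0/= subr_eq0 => /eqP.
have dfv (w F : 'cV[R]_m) : is_derive y w (fun z => f z *m F) (df w *m F).
  exact: is_derive_mulmxr.
have brcst (A : 'cV[R]_m -> 'cV[R]_m) A' (F : 'cV[R]_m) : is_derive y F A A' ->
    bracket A (fun=> F) y = - A' /\ bracket (fun=> F) A y = A'.
  by move=> [_ <-]; rewrite /bracket !derive_cst sub0r subr0.
have skewf (A : 'cV[R]_m) : A^T *m g y *m f y = - ((f y *m A)^T *m g y).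
  by rewrite trmx_mul -!mulmxA skewE// mulmxN opprK.
(* The eight premises come, in order, from the formula for [f f], [f x = 0], skewness of [f],
   closedness of Phi, the derivative of [f x = 0], normality, closedness of eta, and the formula for
   [f f] with [dxe]. *)
have [||||||||HH SS] := @cosymplectic_algebra R _ (mulmx (f y)) (x y) (pairing (e y)) S H.
- move=> X Y Z; rewrite /S.
  have {1}-> : X = (-1) *: (f y *m (f y *m X)) + (pairing (e y) X *: x y + 0).
    rewrite mulmxA ff// mulmxDl mulNmx mul1mx scaleN1r opprD opprK addr0.
    have -> : tensor (e y) (x y) *m X = pairing (e y) X *: x y.
      rewrite /tensor -mulmxA /pairing; apply/matrixP => i j; rewrite (ord1 j).
      by rewrite mxE big_ord1 [in RHS]mxE mulrC.
    by rewrite subrK.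
  rewrite !dflin; have -> : df 0 = 0.
    by rewrite /df big1// => j _; rewrite mxE scale0r.
  rewrite addr0 mulmxDl mulmxDr -!scalemxAl -!scalemxAr scaleN1r.
  by move: (_ *m _) (_ *m (_ *m Z)) => A B; rewrite !mxE.
- move=> Y Z; rewrite /S fx//; have -> : df 0 = 0.
    by rewrite /df big1// => j _; rewrite mxE scale0r.
  by rewrite mul0mx mulmx0 mxE.
- move=> X Y Z; rewrite /S mulmxA trE !trmx_mul trmxK gsym// !mulmxA.
  by rewrite -[Z^T *m _ *m _]mulmxA dfskew mulmxN mulNmx mxE !mulmxA.
- move=> X Y Z.
  have pd (A B C : 'cV[R]_m) : is_derive y A (fun z => fundamental_form g f z B C) (S A B C).
    have h1 := is_derive_mulmx (is_derive_mulmxl B^T (dgP A)) (is_derive_mulmxr C (dfP A)).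
    have /is_derive_mxP/(_ 0 0) := h1; rewrite mulmx0 mul0mx add0r.
    exact.
  have := dPhi X Y Z Uy; rewrite /d_two_form /lie_deriv.
  have [_ ->] := pd X Y Z; have [_ ->] := pd Y Z X; have [_ ->] := pd Z X Y.
  rewrite /bracket !derive_cst subrr /fundamental_form /bilin trmx0 !mul0mx mxE !subr0.
  by move/eqP; rewrite mulf_eq0 invr_eq0 pnatr_eq0/= => /eqP.
- move=> Y Z; rewrite /S dfx mulmxN mulmxA skewf mulNmx opprK.
  rewrite /H trE !trmx_mul !trmxK gsym//.
  by rewrite -[in RHS]mulmxA.
- move=> E F W.
  have := nij E F Uy; rewrite /nijenhuis /apply_endo.
  have [-> _] := brcst _ _ F (dfv F E); have [_ ->] := brcst _ _ E (dfv E F).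
  have -> : bracket (fun=> E) (fun=> F) y = 0 by rewrite /bracket !derive_cst subrr.
  have -> : bracket (fun x => f x *m E) (fun x => f x *m F) y =
     df (f y *m E) *m F - df (f y *m F) *m E.
    by rewrite /bracket; have [_ ->] := dfv (f y *m E) F; have [_ ->] := dfv (f y *m F) E.
  rewrite !mulmx0 add0r mulmxN opprK => /(congr1 (mulmx (W^T *m g y))).
  rewrite !(mulmxBr, mulmxDr, mulmxN) mulmx0.
  rewrite (mulmxA _ (f y) (df F *m E)) (mulmxA _ (f y) (df E *m F)) skewf !mulNmx.
  have addE (A B : 'M[R]_1) : (A + B) 0 0 = A 0 0 + B 0 0 by rewrite mxE.
  have oppE (A : 'M[R]_1) : (- A) 0 0 = - A 0 0 by rewrite mxE.
  move=> /matrixP/(_ 0 0); rewrite /S !(addE, oppE) [(0 : 'M[R]_1) _ _]mxE opprK.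
  lra.
- exact: eHsym.
- move=> Y Z; rewrite /H !mulmxA -[_ *m f y *m f y]mulmxA ff// mulmxDr mulmxN mulmx1.
  rewrite /tensor [_ *m (x y *m _)]mulmxA dxe mul0mx addr0 mulNmx.
  by rewrite mxE.
have dx0 : dx v = 0.
  rewrite -(mulKmx (gunit Uy) (dx v)); have -> : g y *m dx v = 0; last by rewrite mulmx0.
  apply/colP => i; have := HH v (frame R i).
  by rewrite /H mulmx_frameE -[g y in LHS]gsym// -trmx_mul !mxE.
split.
- have -> : 0 = df v; last exact: dfP.
  apply: eq_mulmx_frame => j; rewrite mul0mx.
  apply/esym; rewrite -(mulKmx (gunit Uy) (df v *m _)).
  have -> : g y *m (df v *m frame R j) = 0; last by rewrite mulmx0.
  apply/colP => i; have := SS v (frame R i) (frame R j).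
  by rewrite /S -mulmxA tr_frame_mul => ->; rewrite mxE.
- by rewrite -dx0; exact: dxP.
- by have := deP v; rewrite dx0 trmx0 mul0mx.
Qed.
End parallel.

(** * Adapted bases *)

Section blocks.
Context (R : realType) (n : nat).

(** The last block has width 3, which is [1 + (1 + 1)] only up to conversion; hence the explicit
    sizes here and in the analogous lemmas. *)
Lemma mul_brow k l (A : 'M[R]_(l, k)) (a b c d : 'M[R]_(k, n)) (e f h : 'M[R]_(k, 1)) :
  A *m brow a b c d e f h =
  brow (A *m a) (A *m b) (A *m c) (A *m d) (A *m e) (A *m f) (A *m h).
Proof.
do 4!(apply: etrans (mul_mx_row _ _ _) _; congr (row_mx _ _)).
apply: etrans (@mul_mx_row R l k 1 2 A e _) _; congr (row_mx _ _).
exact: (@mul_mx_row R l k 1 1 A f h).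
Qed.

Lemma mul_bcol k l (A : 'M[R]_(k, l)) (a b c d : 'M[R]_(n, k)) (e f h : 'M[R]_(1, k)) :
  bcol a b c d e f h *m A =
  bcol (a *m A) (b *m A) (c *m A) (d *m A) (e *m A) (f *m A) (h *m A).
Proof.
do 4!(apply: etrans (mul_col_mx _ _ _) _; congr (col_mx _ _)).
apply: etrans (@mul_col_mx R 1 2 k l e _ A) _; congr (col_mx _ _).
exact: (@mul_col_mx R 1 1 k l f h A).
Qed.

Lemma mul_brow_bcol k l (a b c d : 'M[R]_(k, n)) (e f h : 'M[R]_(k, 1))
   (a' b' c' d' : 'M[R]_(n, l)) (e' f' h' : 'M[R]_(1, l)) :
  brow a b c d e f h *m bcol a' b' c' d' e' f' h' =
  a *m a' + (b *m b' + (c *m c' + (d *m d' + (e *m e' + (f *m f' + h *m h'))))).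
Proof.
do 4!(apply: etrans (mul_row_col _ _ _ _) _; congr (_ + _)).
apply: etrans (@mul_row_col R k 1 2 l e _ e' _) _; congr (_ + _).
exact: (@mul_row_col R k 1 1 l f h f' h').
Qed.

Lemma add_brow k (a b c d : 'M[R]_(k, n)) (e f h : 'M[R]_(k, 1))
   (a' b' c' d' : 'M[R]_(k, n)) (e' f' h' : 'M[R]_(k, 1)) :
  brow a b c d e f h + brow a' b' c' d' e' f' h' =
  brow (a + a') (b + b') (c + c') (d + d') (e + e') (f + f') (h + h').
Proof.
do 4!(apply: etrans (add_row_mx _ _ _ _) _; congr (row_mx _ _)).
apply: etrans (@add_row_mx R k 1 2 e _ e' _) _; congr (row_mx _ _).
exact: (@add_row_mx R k 1 1 f h f' h').
Qed.

Lemma tr_brow k (a b c d : 'M[R]_(k, n)) (e f h : 'M[R]_(k, 1)) :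
  (brow a b c d e f h)^T = bcol a^T b^T c^T d^T e^T f^T h^T.
Proof.
do 4!(apply: etrans (tr_row_mx _ _) _; congr (col_mx _ _)).
apply: etrans (@tr_row_mx R k 1 2 e _) _; congr (col_mx _ _).
exact: (@tr_row_mx R k 1 1 f h).
Qed.

Lemma bcol1 : (1%:M : 'M[R]_(dim3c n)) = bcol
  (brow 1%:M 0 0 0 0 0 0) (brow 0 1%:M 0 0 0 0 0) (brow 0 0 1%:M 0 0 0 0)
  (brow 0 0 0 1%:M 0 0 0) (brow 0 0 0 0 1%:M 0 0) (brow 0 0 0 0 0 1%:M 0)
  (brow 0 0 0 0 0 0 1%:M).
Proof.
have step p q (A : 'M[R]_q) : A = 1%:M -> (1%:M : 'M[R]_(p + q)) =
    col_mx (row_mx 1%:M 0) (row_mx 0 A).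
  by move=> ->; rewrite -block_mxEv -scalar_mx_block.
have cr p q r1 r2 (A : 'M[R]_(r1, q)) (B : 'M[R]_(r2, q)) :
    row_mx (0 : 'M[R]_(r1 + r2, p)) (col_mx A B) = col_mx (row_mx 0 A) (row_mx 0 B).
  by rewrite -block_mxEv -[(0 : 'M[R]_(r1 + r2, p))]col_mx0 -block_mxEh.
have i2 := @step 1%N 1%N _ erefl.
have i3 := @step 1%N 2%N _ (esym i2).
have i4 := @step n 3%N _ (esym i3).
have i5 := @step n _ _ (esym i4).
have i6 := @step n _ _ (esym i5).
have i7 := @step n _ _ (esym i6).
rewrite /dim3c i7 !cr /bcol /brow !row_mx0.
do 4!(congr (col_mx _ _)).
by rewrite !(cr _ _ 1%N 2%N) !(cr _ _ 1%N 1%N).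
Qed.

End blocks.

Section adapted_basis.
Context (R : realType) (n : nat).
Local Notation m := (dim3c n).
Variables (G F1 F2 F3 : 'M[R]_m) (X1 X2 X3 : 'cV[R]_m).
Hypothesis Gsym : G^T = G.
Hypothesis Gpos : forall v : 'cV[R]_m, v != 0 -> 0 < (v^T *m G *m v) 0 0.
Local Notation E1 := (X1^T *m G).
Local Notation E2 := (X2^T *m G).
Local Notation E3 := (X3^T *m G).
Hypothesis sk1 : F1^T *m G = - (G *m F1).
Hypothesis sk2 : F2^T *m G = - (G *m F2).
Hypothesis sk3 : F3^T *m G = - (G *m F3).
Hypothesis f11 : F1 *m F1 = - 1%:M + X1 *m E1.
Hypothesis f22 : F2 *m F2 = - 1%:M + X2 *m E2.
Hypothesis f33 : F3 *m F3 = - 1%:M + X3 *m E3.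
Hypothesis f12 : F1 *m F2 = F3 + X1 *m E2.
Hypothesis f21 : F2 *m F1 = - F3 + X2 *m E1.
Hypothesis f23 : F2 *m F3 = F1 + X2 *m E3.
Hypothesis f32 : F3 *m F2 = - F1 + X3 *m E2.
Hypothesis f31 : F3 *m F1 = F2 + X3 *m E1.
Hypothesis f13 : F1 *m F3 = - F2 + X1 *m E3.
Hypothesis fx11 : F1 *m X1 = 0.
Hypothesis fx22 : F2 *m X2 = 0.
Hypothesis fx33 : F3 *m X3 = 0.
Hypothesis fx12 : F1 *m X2 = X3.
Hypothesis fx13 : F1 *m X3 = - X2.
Hypothesis fx21 : F2 *m X1 = - X3.
Hypothesis fx23 : F2 *m X3 = X1.
Hypothesis fx31 : F3 *m X1 = X2.
Hypothesis fx32 : F3 *m X2 = - X1.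
Hypothesis ex1 : E1 *m X1 = 1%:M.
Hypothesis ex2 : E2 *m X2 = 1%:M.
Hypothesis ex3 : E3 *m X3 = 1%:M.

Let skewT (F : 'M[R]_m) p q (A : 'M[R]_(m, p)) (B : 'M[R]_(m, q)) :
  F^T *m G = - (G *m F) -> A^T *m G *m (F *m B) = - (B^T *m G *m (F *m A))^T.
Proof.
move=> sk; rewrite !trmx_mul trmxK Gsym -!mulmxA (mulmxA F^T) sk.
by rewrite mulNmx !mulmxN opprK -!mulmxA.
Qed.

Let Gtr p q (A : 'M[R]_(m, p)) (B : 'M[R]_(m, q)) : A^T *m G *m B = (B^T *m G *m A)^T.
Proof. by rewrite !trmx_mul trmxK Gsym mulmxA. Qed.

Let skew0 (F : 'M[R]_m) (u : 'cV[R]_m) :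
  F^T *m G = - (G *m F) -> u^T *m G *m (F *m u) = 0.
Proof.
move=> sk; apply/matrixP => i j; rewrite !ord1 [RHS]mxE.
have := congr1 (fun A : 'M[R]_1 => A 0 0) (skewT u u sk).
move: (u^T *m G *m (F *m u)) => A; rewrite !mxE; lra.
Qed.

(** A quaternionic Gram-Schmidt process: the new vector is chosen orthogonal to the old ones, to
    their images under the three endomorphisms and to the Reeb fields, and is then normalised. *)
Lemma horizontal_frame k : (k <= n)%N -> exists P : 'M[R]_(m, k),
  [/\ P^T *m G *m P = 1%:M,
      [/\ P^T *m G *m (F1 *m P) = 0, P^T *m G *m (F2 *m P) = 0 & P^T *m G *m (F3 *m P) = 0]
    & [/\ P^T *m G *m X1 = 0, P^T *m G *m X2 = 0 & P^T *m G *m X3 = 0]].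
Proof.
elim: k => [|k IH] kn.
  by exists 0; split; [|split|split]; apply/matrixP => -[].
have [P [PP [P1 P2 P3] [PX1 PX2 PX3]]] := IH (ltnW kn).
pose Q := row_mx P (row_mx (F1 *m P) (row_mx (F2 *m P)
  (row_mx (F3 *m P) (row_mx X1 (row_mx X2 X3))))).
(* Q has 4 k + 3 columns, fewer than the dimension. *)
have [w wQ w0] : exists2 w : 'rV[R]_m, w *m (G *m Q) = 0 & w != 0.
  have : kermx (G *m Q) != 0.
    rewrite -mxrank_eq0 mxrank_ker subn_eq0 -ltnNge.
    apply: leq_ltn_trans (rank_leq_col _) _.
    by rewrite /dim3c; lia.
  by move/rowV0Pn => [w /sub_kermxP wQ w0]; exists w.
have u0 : w^T != 0 by rewrite -trmx0 (inj_eq trmx_inj).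
have q0 := Gpos u0; rewrite trmxK in q0.
set q := (_ *m _ *m _) 0 0 in q0.
pose u := (Num.sqrt q)^-1 *: w^T.
have uT : u^T = (Num.sqrt q)^-1 *: w by rewrite /u linearZ/= trmxK.
have uQ : u^T *m G *m Q = 0 by rewrite uT -!scalemxAl -mulmxA wQ scaler0.
move: uQ; rewrite /Q !mul_mx_row => uQ.
have r0 p1 p2 (A : 'M[R]_(1, p1)) (B : 'M[R]_(1, p2)) : row_mx A B = 0 -> A = 0 /\ B = 0.
  by rewrite -row_mx0 => /eq_row_mx.
have [uP /r0[uP1 /r0[uP2 /r0[uP3 /r0[uX1 /r0[uX2 uX3]]]]]] := r0 _ _ _ _ uQ.
have uu : u^T *m G *m u = 1%:M.
  rewrite uT /u -!scalemxAl -scalemxAr scalerA.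
  apply/matrixP => i j; rewrite !ord1 mxE -/q mxE -invfM -expr2 sqr_sqrtr ?ltW//.
  by rewrite mulVf// gt_eqF.
have tr0 p1 p2 (A : 'M[R]_(m, p1)) (B : 'M[R]_(m, p2)) : A^T *m G *m B = 0 -> B^T *m G *m A = 0.
  by move=> h; rewrite Gtr h trmx0.
(* Only one off-diagonal block has to be known: skewness gives the other one, and also the
   orthogonality of [u] to [F *m u]. *)
have rowP F : F^T *m G = - (G *m F) -> u^T *m G *m (F *m P) = 0 -> P^T *m G *m (F *m P) = 0 ->
   (row_mx u P)^T *m G *m (F *m row_mx u P) = 0.
  move=> sk h1 h2; rewrite tr_row_mx mul_col_mx mul_mx_row mul_col_row skew0// h1 h2.
  by rewrite (skewT P u sk) h1 trmx0 oppr0 block_mx0.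
have rowX (X : 'cV[R]_m) : u^T *m G *m X = 0 -> P^T *m G *m X = 0 ->
    (row_mx u P)^T *m G *m X = 0.
  by move=> h1 h2; rewrite tr_row_mx !mul_col_mx h1 h2 col_mx0.
have PP' : (row_mx u P)^T *m G *m row_mx u P = 1%:M.
  rewrite tr_row_mx mul_col_mx mul_col_row uu PP uP (tr0 _ _ _ _ uP).
  by rewrite -scalar_mx_block.
exists (row_mx u P : 'M[R]_(m, 1 + k)); split; first exact: PP'.
- by split; apply: rowP.
- by split; apply: rowX.
Qed.

(** Skewness moves an endomorphism from one argument to the other, and the quaternionic relations
    then reduce every inner product of columns to one recorded in [horizontal_frame]. *)
Lemma adapted_basis : exists L : 'M[R]_m, [/\ L^T *m G *m L = 1%:M,
  [/\ F1 *m L = L *m phi1_mx R n, F2 *m L = L *m phi2_mx R n & F3 *m L = L *m phi3_mx R n]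
  & [/\ L *m frame R (iz n i1) = X1, L *m frame R (iz n i2) = X2
      & L *m frame R (iz n i3) = X3]].
Proof.
have [P [PP [P1 P2 P3] [PX1 PX2 PX3]]] := horizontal_frame (leqnn n).
have tr0 p1 p2 (A : 'M[R]_(m, p1)) (B : 'M[R]_(m, p2)) : A^T *m G *m B = 0 -> B^T *m G *m A = 0.
  by move=> h; rewrite Gtr h trmx0.
have XP1 := tr0 _ _ _ _ PX1; have XP2 := tr0 _ _ _ _ PX2; have XP3 := tr0 _ _ _ _ PX3.
have eP (X : 'cV[R]_m) (E : 'rV[R]_m) : E *m P = 0 -> X *m E *m P = 0.
  by move=> h; rewrite -mulmxA h mulmx0.
have k11 : F1 *m (F1 *m P) = - P by rewrite mulmxA f11 mulmxDl mulNmx mul1mx eP ?addr0.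
have k22 : F2 *m (F2 *m P) = - P by rewrite mulmxA f22 mulmxDl mulNmx mul1mx eP ?addr0.
have k33 : F3 *m (F3 *m P) = - P by rewrite mulmxA f33 mulmxDl mulNmx mul1mx eP ?addr0.
have k12 : F1 *m (F2 *m P) = F3 *m P by rewrite mulmxA f12 mulmxDl eP ?addr0.
have k21 : F2 *m (F1 *m P) = - (F3 *m P) by rewrite mulmxA f21 mulmxDl mulNmx eP ?addr0.
have k23 : F2 *m (F3 *m P) = F1 *m P by rewrite mulmxA f23 mulmxDl eP ?addr0.
have k32 : F3 *m (F2 *m P) = - (F1 *m P) by rewrite mulmxA f32 mulmxDl mulNmx eP ?addr0.
have k31 : F3 *m (F1 *m P) = F2 *m P by rewrite mulmxA f31 mulmxDl eP ?addr0.
have k13 : F1 *m (F3 *m P) = - (F2 *m P) by rewrite mulmxA f13 mulmxDl mulNmx eP ?addr0.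
have s11 : (F1 *m P)^T *m G *m (F1 *m P) = 1%:M.
  by rewrite (skewT _ _ sk1) k11 mulmxN PP linearN/= trmx1 opprK.
have s22 : (F2 *m P)^T *m G *m (F2 *m P) = 1%:M.
  by rewrite (skewT _ _ sk2) k22 mulmxN PP linearN/= trmx1 opprK.
have s33 : (F3 *m P)^T *m G *m (F3 *m P) = 1%:M.
  by rewrite (skewT _ _ sk3) k33 mulmxN PP linearN/= trmx1 opprK.
have s12 : (F1 *m P)^T *m G *m (F2 *m P) = 0.
  by rewrite (skewT _ _ sk2) k21 mulmxN P3 oppr0 trmx0 oppr0.
have s13 : (F1 *m P)^T *m G *m (F3 *m P) = 0.
  by rewrite (skewT _ _ sk3) k31 P2 trmx0 oppr0.
have s23 : (F2 *m P)^T *m G *m (F3 *m P) = 0.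
  by rewrite (skewT _ _ sk3) k32 mulmxN P1 oppr0 trmx0 oppr0.
have sX F (X : 'cV[R]_m) : F^T *m G = - (G *m F) -> P^T *m G *m (F *m X) = 0 ->
    X^T *m G *m (F *m P) = 0.
  by move=> sk h; rewrite (skewT _ _ sk) h trmx0 oppr0.
have t11 : X1^T *m G *m (F1 *m P) = 0 by apply: sX => //; rewrite fx11 mulmx0.
have t12 : X2^T *m G *m (F1 *m P) = 0 by apply: sX => //; rewrite fx12.
have t13 : X3^T *m G *m (F1 *m P) = 0 by apply: sX => //; rewrite fx13 mulmxN PX2 oppr0.
have t21 : X1^T *m G *m (F2 *m P) = 0 by apply: sX => //; rewrite fx21 mulmxN PX3 oppr0.
have t22 : X2^T *m G *m (F2 *m P) = 0 by apply: sX => //; rewrite fx22 mulmx0.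
have t23 : X3^T *m G *m (F2 *m P) = 0 by apply: sX => //; rewrite fx23.
have t31 : X1^T *m G *m (F3 *m P) = 0 by apply: sX => //; rewrite fx31.
have t32 : X2^T *m G *m (F3 *m P) = 0 by apply: sX => //; rewrite fx32 mulmxN PX1 oppr0.
have t33 : X3^T *m G *m (F3 *m P) = 0 by apply: sX => //; rewrite fx33 mulmx0.
(* Each Reeb vector is, up to sign, the image of another under one of the endomorphisms, and a skew
   endomorphism maps a vector to an orthogonal one. *)
have x12 : X1^T *m G *m X2 = 0 by rewrite -fx31 skew0.
have x23 : X2^T *m G *m X3 = 0 by rewrite -fx12 skew0.
have x13 : X1^T *m G *m X3 = 0.
  by have := skew0 X1 sk2; rewrite fx21 mulmxN => /eqP; rewrite oppr_eq0 => /eqP.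
exists (brow P (F1 *m P) (F2 *m P) (F3 *m P) X1 X2 X3); split.
- rewrite tr_brow !mul_bcol !mul_brow bcol1.
  rewrite PP P1 P2 P3 PX1 PX2 PX3 (tr0 _ _ _ _ P1) (tr0 _ _ _ _ P2) (tr0 _ _ _ _ P3).
  rewrite s11 s22 s33 s12 s13 s23 (tr0 _ _ _ _ s12) (tr0 _ _ _ _ s13) (tr0 _ _ _ _ s23).
  rewrite XP1 XP2 XP3 t11 t12 t13 t21 t22 t23 t31 t32 t33.
  rewrite (tr0 _ _ _ _ t11) (tr0 _ _ _ _ t12) (tr0 _ _ _ _ t13).
  rewrite (tr0 _ _ _ _ t21) (tr0 _ _ _ _ t22) (tr0 _ _ _ _ t23).
  rewrite (tr0 _ _ _ _ t31) (tr0 _ _ _ _ t32) (tr0 _ _ _ _ t33).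
  by rewrite ex1 ex2 ex3 x12 x13 x23 (tr0 _ _ _ _ x12) (tr0 _ _ _ _ x13) (tr0 _ _ _ _ x23).
- split; rewrite mul_brow mul_brow_bcol !mul_brow
    !(mulmx0, mulmx1, mulmxN) !add_brow !(addr0, add0r).
  + by rewrite k11 k12 k13 fx11 fx12 fx13.
  + by rewrite k21 k22 k23 fx21 fx22 fx23.
  + by rewrite k31 k32 k33 fx31 fx32 fx33.
- split; apply/colP => i; rewrite mulmx_frameE /brow /iz !row_mxEr.
  + rewrite (_ : i1 = @lshift 1 2 0); last exact: val_inj.
    by rewrite (@row_mxEl R m 1 2).
  + rewrite (_ : i2 = @rshift 1 2 (@lshift 1 1 0)); last exact: val_inj.
    by rewrite (@row_mxEr R m 1 2) (@row_mxEl R m 1 1).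
  + rewrite (_ : i3 = @rshift 1 2 (@rshift 1 1 0)); last exact: val_inj.
    by rewrite (@row_mxEr R m 1 2) (@row_mxEr R m 1 1).
Qed.

End adapted_basis.

(** [partial_lipschitz] with [K = 0]. *)
Lemma constant_on_ball (R : realType) m p q (A : 'cV[R]_m -> 'M[R]_(p, q)) y0 d :
  (forall y a, `|y - y0| < d -> is_derive y (frame R a) A 0) ->
  forall y z, `|y - y0| < d -> `|z - y0| < d -> A y = A z.
Proof.
move=> dA y z yd zd; apply/matrixP => i j; apply/eqP; rewrite -subr_eq0 -normr_le0.
have := @partial_lipschitz R m (fun y => A y i j) y0 d 0 _ y z yd zd.
rewrite mulr0 mul0r; apply => x xd a.
by have /is_derive_mxP/(_ i j)[? ->] := dA x a xd; split => //; rewrite mxE normr0.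
Qed.

Lemma sum_I3 (V : nmodType) (F : 'I_3 -> V) :
  \sum_(d < 3) F d = F i1 + (F i2 + F i3).
Proof.
rewrite !big_ord_recl big_ord0 addr0; congr (F _ + (F _ + F _)); exact: val_inj.
Qed.

Lemma eps_diag (R : realType) (a d : 'I_3) : eps R a a d = 0.
Proof. by case: a d => [[|[|[|?]]] ?] [[|[|[|?]]] ?]. Qed.

Lemma I3_cases (P : 'I_3 -> Prop) : P i1 -> P i2 -> P i3 -> forall a, P a.
Proof.
move=> p1 p2 p3 [[|[|[|a]]] ha] //.
- by rewrite (_ : Ordinal ha = i1)//; exact: val_inj.
- by rewrite (_ : Ordinal ha = i2)//; exact: val_inj.
- by rewrite (_ : Ordinal ha = i3)//; exact: val_inj.
Qed.

Section contact_geometry.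
Context (R : realType) (M : topologicalType) (n : nat).
Local Notation m := (dim3c n).
Variables (S : manifold R M m) (phi : 'I_3 -> endo_field S)
  (xi : 'I_3 -> vector_field S) (eta : 'I_3 -> one_form S) (g : riemannian_metric S).
Hypothesis hcos : three_cosymplectic phi xi eta g.

Let hac a : almost_contact (phi a) (xi a) (eta a).
Proof. by have [[]] := hcos. Qed.

Let hcomp a : compatible_metric (phi a) (eta a) g.
Proof. by have [[]] := hcos. Qed.

Let h3 : three_contact_identities phi xi eta.
Proof. by have [[]] := hcos. Qed.

(** For equal indices the epsilon sums vanish, so the three-structure identities contain
    [phi xi = 0] and [eta phi = 0], which [almost_contact] does not state. *)
Lemma contact_identities c y a : atlas S c -> cimg c y ->
  [/\ phi a c y *m xi a c y = 0, eta a c y *m phi a c y = 0,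
      eta a c y = (xi a c y)^T *m g c y &
      (phi a c y)^T *m g c y = - (g c y *m phi a c y)].
Proof.
move=> cS cy; have [_ fx ef] := h3 a a cS cy.
rewrite big1 in fx; last by move=> d _; rewrite eps_diag scale0r.
rewrite big1 in ef; last by move=> d _; rewrite eps_diag scale0r.
have [ff ex] := hac a cS cy; have gs := rm_sym g cS cy.
have cm := fun u v => hcomp a u v cS cy.
split => //.
- exact: (contact_form_metric gs cm fx ex).
- exact: (contact_endo_skew gs ff cm fx ef ex).
Qed.

(** Since eta is closed, normality on constant fields is the vanishing of the Nijenhuis tensor. *)
Lemma flat_chart_parallel c a y v : atlas S c ->
  (forall y a, cimg c y -> is_derive y (frame R a) (g c) 0) -> cimg c y ->
  [/\ is_derive y v (phi a c) 0, is_derive y v (xi a c) 0 & is_derive y v (eta a c) 0].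
Proof.
move=> cS dg cy; have [_ /(_ a)[heta hPhi hnor]] := hcos.
have smc w : smooth_on (cimg c) (fun=> w : 'cV[R]_m).
  apply/smooth_onP => k i j; exact: Ck_cst.
have deta (E F : 'cV[R]_m) z : cimg c z -> d_one_form (eta a c) (fun=> E) (fun=> F) z = 0.
  by move=> cz; exact: heta.
apply: (@cosymplectic_parallel R m (cimg c) (g c) (phi a c) (xi a c) (eta a c)) => //.
- exact: cimg_open.
- by have /smooth_onP := rm_smooth g cS; exact.
- by have /smooth_onP := ef_smooth (phi a) cS; exact.
- by have /smooth_onP := vf_smooth (xi a) cS; exact.
- by move=> z cz; apply: posdef_unitmx => w; exact: rm_pos.
- by move=> z cz; exact: rm_sym.
- by move=> z cz; have [] := hac a cS cz.
- by move=> z u w cz; exact: hcomp.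
- by move=> z cz; have [] := contact_identities a cS cz.
- by move=> z cz; have [] := contact_identities a cS cz.
- by move=> z cz; have [] := hac a cS cz.
- by move=> E F G z cz; exact: hPhi.
- move=> E F z cz; have := hnor c _ _ cS (smc E) (smc F) z cz.
  by rewrite deta// mulr0 scale0r addr0.
Qed.

Lemma contact_adapted_basis c y : atlas S c -> cimg c y ->
  exists L : 'M[R]_m, [/\ L^T *m g c y *m L = 1%:M,
    [/\ phi i1 c y *m L = L *m phi1_mx R n, phi i2 c y *m L = L *m phi2_mx R n
      & phi i3 c y *m L = L *m phi3_mx R n]
    & forall a, L *m frame R (iz n a) = xi a c y].
Proof.
move=> cS cy.
have et a : eta a c y = (xi a c y)^T *m g c y by have [] := contact_identities a cS cy.
have ff a : phi a c y *m phi a c y = - 1%:M + xi a c y *m ((xi a c y)^T *m g c y).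
  by have [+ _] := hac a cS cy; rewrite /tensor -et.
have ex a : (xi a c y)^T *m g c y *m xi a c y = 1%:M.
  have [_ h] := hac a cS cy; rewrite -et; apply/matrixP => i j.
  by rewrite !ord1 [LHS]h mxE.
have fx a : phi a c y *m xi a c y = 0 by have [] := contact_identities a cS cy.
have sk a : (phi a c y)^T *m g c y = - (g c y *m phi a c y).
  by have [] := contact_identities a cS cy.
have pp a b : a != b -> phi a c y *m phi b c y =
    \sum_(d < 3) eps R a b d *: phi d c y + xi a c y *m ((xi b c y)^T *m g c y).
  move=> /negbTE ab; have [+ _ _] := h3 a b cS cy.
  by rewrite ab /tensor -et /= raddf0 subr0 => <-; rewrite subrK.
have px a b : phi a c y *m xi b c y = \sum_(d < 3) eps R a b d *: xi d c y.
  by have [_ + _] := h3 a b cS cy.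
have [L [LL LF [L1 L2 L3]]] : exists L : 'M[R]_m, [/\ L^T *m g c y *m L = 1%:M,
    [/\ phi i1 c y *m L = L *m phi1_mx R n, phi i2 c y *m L = L *m phi2_mx R n
      & phi i3 c y *m L = L *m phi3_mx R n]
    & [/\ L *m frame R (iz n i1) = xi i1 c y, L *m frame R (iz n i2) = xi i2 c y
        & L *m frame R (iz n i3) = xi i3 c y]].
{ apply: adapted_basis => //.
  - exact: rm_sym.
  - by move=> v; exact: rm_pos.
  all: try solve [exact: sk|exact: ff|exact: fx|exact: ex].
  all: rewrite ?pp// ?px sum_I3 /eps /= ?(scale0r, scaleN1r, scale1r, add0r, addr0)//. }
by exists L; split => //; apply: I3_cases.
Qed.

End contact_geometry.

(** * The model structure *)

Section bcol_coordinates.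
Context (R : realType) (n : nat).

Lemma bcolP (u : 'cV[R]_(dim3c n)) : exists a b c d e f h, u = bcol a b c d e f h.
Proof.
do 7!eexists; rewrite -[LHS]vsubmxK; congr (col_mx _ _).
rewrite -[LHS]vsubmxK; congr (col_mx _ _).
rewrite -[LHS]vsubmxK; congr (col_mx _ _).
rewrite -[LHS]vsubmxK; congr (col_mx _ _).
apply: etrans (esym (@vsubmxK R 1 2 1 _)) _; congr (col_mx _ _).
exact: esym (@vsubmxK R 1 1 1 _).
Qed.

Variables (a b c d : 'cV[R]_n) (e f h : 'cV[R]_1).
Let u := bcol a b c d e f h.

Lemma bcol_ix i : u (ix i) 0 = a i 0. Proof. exact: col_mxEu. Qed.

Lemma bcol_iy i : u (iy i) 0 = b i 0.
Proof. by rewrite /u /bcol /iy col_mxEd col_mxEu. Qed.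

Lemma bcol_iu i : u (iu i) 0 = c i 0.
Proof. by rewrite /u /bcol /iu !col_mxEd col_mxEu. Qed.

Lemma bcol_iv i : u (iv i) 0 = d i 0.
Proof. by rewrite /u /bcol /iv !col_mxEd col_mxEu. Qed.

Lemma bcol_iz1 : u (iz n i1) 0 = e 0 0.
Proof.
rewrite /u /bcol /iz !col_mxEd (_ : i1 = @lshift 1 2 0); last exact: val_inj.
by rewrite (@col_mxEu R 1 2).
Qed.

Lemma bcol_iz2 : u (iz n i2) 0 = f 0 0.
Proof.
rewrite /u /bcol /iz !col_mxEd (_ : i2 = @rshift 1 2 (@lshift 1 1 0)); last exact: val_inj.
by rewrite (@col_mxEd R 1 2) (@col_mxEu R 1 1).
Qed.

Lemma bcol_iz3 : u (iz n i3) 0 = h 0 0.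
Proof.
rewrite /u /bcol /iz !col_mxEd (_ : i3 = @rshift 1 2 (@rshift 1 1 0)); last exact: val_inj.
by rewrite (@col_mxEd R 1 2) (@col_mxEd R 1 1).
Qed.

Lemma tr_bcol : u^T = brow a^T b^T c^T d^T e^T f^T h^T.
Proof. by apply: trmx_inj; rewrite trmxK tr_brow !trmxK. Qed.

End bcol_coordinates.

Section model_forms.
Context (R : realType) (n : nat).
Local Notation m := (dim3c n).

Lemma dcoordE (i : 'I_m) (x : 'cV[R]_m) : dcoord i x = (frame R i)^T.
Proof.
apply/rowP => j; rewrite /dcoord /differential [LHS]mxE.
have [_ ->] := is_derive_coord x (frame R j) i.
by rewrite !mxE !andbT eq_sym.
Qed.

Lemma wedge_dcoord (i j : 'I_m) (x E F : 'cV[R]_m) :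
  wedge (dcoord i x) (dcoord j x) E F = 2^-1 * (E i 0 * F j 0 - F i 0 * E j 0).
Proof. by rewrite /wedge /pairing !dcoordE !tr_frame_mul. Qed.

Lemma mul_tr_cv k (a b : 'cV[R]_k) : (a^T *m b) 0 0 = \sum_i a i 0 * b i 0.
Proof. by rewrite mxE; apply: eq_bigr => i _; rewrite mxE. Qed.

(** In the final chart the metric is the identity, so the left side is the fundamental form; the
    factors 2 undo the 1/2 of [wedge]. The same holds for the other two forms. *)
Lemma phi1_form (x E F : 'cV[R]_m) : (E^T *m (phi1_mx R n *m F)) 0 0 =
  - 2 * (\sum_(i < n) (wedge (dcoord (ix i) x) (dcoord (iy i) x) E F
                     + wedge (dcoord (iu i) x) (dcoord (iv i) x) E F))
  - 2 * wedge (dcoord (iz n i2) x) (dcoord (iz n i3) x) E F.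
Proof.
have [a [b [c [d [e [f [h ->]]]]]]] := bcolP E.
have [a' [b' [c' [d' [e' [f' [h' ->]]]]]]] := bcolP F.
under eq_bigr do rewrite !wedge_dcoord !bcol_ix !bcol_iy !bcol_iu !bcol_iv.
rewrite wedge_dcoord !bcol_iz2 !bcol_iz3 tr_bcol /phi1_mx mul_bcol !mul_brow_bcol.
rewrite !(mul0mx, mulNmx, mul1mx, add0r, addr0) !mulmxN mulmx0.
have addE (A B : 'M[R]_1) : (A + B) 0 0 = A 0 0 + B 0 0 by rewrite mxE.
have oppE (A : 'M[R]_1) : (- A) 0 0 = - A 0 0 by rewrite mxE.
have zE : (0 : 'M[R]_1) 0 0 = 0 by rewrite mxE.
rewrite !(addE, oppE, zE) !mul_tr_cv !big_ord1.
have -> : \sum_(i < n) (2^-1 * (a i 0 * b' i 0 - a' i 0 * b i 0) +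
    2^-1 * (c i 0 * d' i 0 - c' i 0 * d i 0)) =
  2^-1 * (\sum_i a i 0 * b' i 0 - \sum_i b i 0 * a' i 0 +
     (\sum_i c i 0 * d' i 0 - \sum_i d i 0 * c' i 0)).
  rewrite -!sumrB -big_split mulr_sumr; apply: eq_bigr => i _ /=.
  by ring.
by field.
Qed.

Lemma phi2_form (x E F : 'cV[R]_m) : (E^T *m (phi2_mx R n *m F)) 0 0 =
  - 2 * (\sum_(i < n) (wedge (dcoord (ix i) x) (dcoord (iu i) x) E F
                     - wedge (dcoord (iy i) x) (dcoord (iv i) x) E F))
  + 2 * wedge (dcoord (iz n i1) x) (dcoord (iz n i3) x) E F.
Proof.
have [a [b [c [d [e [f [h ->]]]]]]] := bcolP E.
have [a' [b' [c' [d' [e' [f' [h' ->]]]]]]] := bcolP F.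
under eq_bigr do rewrite !wedge_dcoord !bcol_ix !bcol_iy !bcol_iu !bcol_iv.
rewrite wedge_dcoord !bcol_iz1 !bcol_iz3 tr_bcol /phi2_mx mul_bcol !mul_brow_bcol.
rewrite !(mul0mx, mulNmx, mul1mx, add0r, addr0) !mulmxN mulmx0.
have addE (A B : 'M[R]_1) : (A + B) 0 0 = A 0 0 + B 0 0 by rewrite mxE.
have oppE (A : 'M[R]_1) : (- A) 0 0 = - A 0 0 by rewrite mxE.
have zE : (0 : 'M[R]_1) 0 0 = 0 by rewrite mxE.
rewrite !(addE, oppE, zE) !mul_tr_cv !big_ord1.
have -> : \sum_(i < n) (2^-1 * (a i 0 * c' i 0 - a' i 0 * c i 0) -
    2^-1 * (b i 0 * d' i 0 - b' i 0 * d i 0)) =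
  2^-1 * (\sum_i a i 0 * c' i 0 - \sum_i c i 0 * a' i 0 -
     (\sum_i b i 0 * d' i 0 - \sum_i d i 0 * b' i 0)).
  rewrite -!sumrB mulr_sumr; apply: eq_bigr => i _ /=.
  by ring.
by field.
Qed.

Lemma phi3_form (x E F : 'cV[R]_m) : (E^T *m (phi3_mx R n *m F)) 0 0 =
  - 2 * (\sum_(i < n) (wedge (dcoord (ix i) x) (dcoord (iv i) x) E F
                     + wedge (dcoord (iy i) x) (dcoord (iu i) x) E F))
  - 2 * wedge (dcoord (iz n i1) x) (dcoord (iz n i2) x) E F.
Proof.
have [a [b [c [d [e [f [h ->]]]]]]] := bcolP E.
have [a' [b' [c' [d' [e' [f' [h' ->]]]]]]] := bcolP F.
under eq_bigr do rewrite !wedge_dcoord !bcol_ix !bcol_iy !bcol_iu !bcol_iv.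
rewrite wedge_dcoord !bcol_iz1 !bcol_iz2 tr_bcol /phi3_mx mul_bcol !mul_brow_bcol.
rewrite !(mul0mx, mulNmx, mul1mx, add0r, addr0) !mulmxN mulmx0.
have addE (A B : 'M[R]_1) : (A + B) 0 0 = A 0 0 + B 0 0 by rewrite mxE.
have oppE (A : 'M[R]_1) : (- A) 0 0 = - A 0 0 by rewrite mxE.
have zE : (0 : 'M[R]_1) 0 0 = 0 by rewrite mxE.
rewrite !(addE, oppE, zE) !mul_tr_cv !big_ord1.
have -> : \sum_(i < n) (2^-1 * (a i 0 * d' i 0 - a' i 0 * d i 0) +
    2^-1 * (b i 0 * c' i 0 - b' i 0 * c i 0)) =
  2^-1 * (\sum_i a i 0 * d' i 0 - \sum_i d i 0 * a' i 0 +
     (\sum_i b i 0 * c' i 0 - \sum_i c i 0 * b' i 0)).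
  rewrite -!sumrB -big_split mulr_sumr; apply: eq_bigr => i _ /=.
  by ring.
by field.
Qed.

End model_forms.

Lemma Ckmx_linear (R : realType) m k (A : 'M[R]_m) (U : set 'cV[R]_m) : open U ->
  Ckmx k U (fun y => A *m y).
Proof.
move=> oU; apply: Ckmx_mul => // i j; first exact: Ck_cst.
by rewrite (ord1 j); exact: Ck_coord.
Qed.

Lemma jac_linear (R : realType) m (A : 'M[R]_m) x : jac (fun y => A *m y) x = A.
Proof.
apply/matrixP => i j; rewrite [LHS]mxE.
have h : is_derive x (frame R j) (fun y => A *m y) (A *m frame R j).
  by apply: is_derive_mulmxl; exact: is_derive_id.
by have /is_derive_mxP/(_ i 0)[_ ->] := h; rewrite mulmx_frameE.
Qed.

Theorem theorem4p4 (R : realType) (n : nat) (M : topologicalType)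
    (S : manifold R M (dim3c n)) (phi : 'I_3 -> endo_field S)
    (xi : 'I_3 -> vector_field S) (eta : 'I_3 -> one_form S)
    (g : riemannian_metric S)
    (hcos : three_cosymplectic phi xi eta g) (hflat : flat_metric g) :
  forall p : M, exists c : chart R M (dim3c n),
    [/\ atlas S c, cdom c p &
      forall x : 'cV[R]_(dim3c n), cimg c x ->
      let dx i := dcoord (ix i) x in
      let dy i := dcoord (iy i) x in
      let du i := dcoord (iu i) x in
      let dv i := dcoord (iv i) x in
      let dz a := dcoord (iz n a) x in
      let Phi a := fundamental_form (g c) (phi a c) x in
      [/\ (forall a, eta a c x = dz a /\ xi a c x = frame R (iz n a)),
          [/\ (forall E F, Phi i1 E F =
                 - 2 * (\sum_(i < n) (wedge (dx i) (dy i) E F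
                                      + wedge (du i) (dv i) E F))
                 - 2 * wedge (dz i2) (dz i3) E F),
              (forall E F, Phi i2 E F =
                 - 2 * (\sum_(i < n) (wedge (dx i) (du i) E F
                                      - wedge (dy i) (dv i) E F))
                 + 2 * wedge (dz i1) (dz i3) E F)
            & (forall E F, Phi i3 E F =
                 - 2 * (\sum_(i < n) (wedge (dx i) (dv i) E F
                                      + wedge (dy i) (du i) E F))
                 - 2 * wedge (dz i1) (dz i2) E F)]
        & [/\ phi i1 c x = phi1_mx R n,
              phi i2 c x = phi2_mx R n
            & phi i3 c x = phi3_mx R n]]].
Proof.
move=> p; have [c1 [y0 [d [c1S c1p d0 c1img dg]]]] := flat_chart p hflat.
pose y1 := cmap c1 p.
have c1y1 : cimg c1 y1 by exists p.
have [L [LL LF LX]] := contact_adapted_basis hcos c1S c1y1.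
have par a y v := @flat_chart_parallel R M n S phi xi eta g hcos c1 a y v c1S dg.
have cst q (A : 'cV[R]_(dim3c n) -> 'M[R]_(dim3c n, q)) :
    (forall y v, cimg c1 y -> is_derive y v A 0) -> forall y, cimg c1 y -> A y = A y1.
  move=> dA y cy; apply: (@constant_on_ball _ _ _ _ A y0 d).
  - by move=> z a zd; apply: dA; rewrite c1img.
  - by move: cy; rewrite c1img.
  - by move: c1y1; rewrite c1img.
have gC y : cimg c1 y -> g c1 y = g c1 y1.
  move=> cy; apply: (@constant_on_ball _ _ _ _ (g c1) y0 d).
  - by move=> z a zd; apply: dg; rewrite c1img.
  - by move: cy; rewrite c1img.
  - by move: c1y1; rewrite c1img.
have phiC a y : cimg c1 y -> phi a c1 y = phi a c1 y1.
  by apply: cst => z v cz; have [] := par a z v cz.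
have xiC a y : cimg c1 y -> xi a c1 y = xi a c1 y1.
  by apply: cst => z v cz; have [] := par a z v cz.
(* Orthonormality of the columns of [L] already exhibits a left inverse. *)
have [K KL] : exists K, K *m L = 1%:M by exists (L^T *m g c1 y1).
have LK : L *m K = 1%:M by exact: mulmx1C.
have oc1 : open (cimg c1) by exact: cimg_open.
(* Rewriting the image under [K] as a preimage under its inverse [L] makes openness a matter of
   continuity. *)
have img : (fun y => K *m y) @` cimg c1 = (fun y => L *m y) @^-1` cimg c1.
  apply/seteqP; split; first by move=> _ [y cy <-]; rewrite /= mulmxA LK mul1mx.
  by move=> y cy; exists (L *m y) => //; rewrite mulmxA KL mul1mx.
have oimg : open ((fun y => K *m y) @` cimg c1).
  rewrite img; apply: open_comp oc1 => y _.
  by apply: Ckmx_continuous (Ckmx_linear 0 L openT) _.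
have [||||c [cS cdc cic ca]] := @chart_change R M _ S c1 (cimg c1) (fun y => K *m y)
    (fun y => L *m y) c1S oc1 (@subset_refl _ _).
- by move=> k; exact: Ckmx_linear.
- exact: oimg.
- by move=> k; exact: Ckmx_linear.
- by move=> y _; rewrite mulmxA LK mul1mx.
exists c; split => //; first by apply: cdc.
move=> x; rewrite cic => -[y cy <-] dx dy du dv dz Phi.
have [a [a0 a1 ay aKy jK]] := ca y cy.
rewrite jac_linear -ay in jK.
have gc : g c (K *m y) = 1%:M.
  have := rm_law g c1S cS a0 a1; rewrite jK ay aKy gC// => gE.
  (* The law gives the old metric as [K^T] times the new one times [K]; congruence by [L] undoes
     [K], and orthonormality of [L] makes the result the identity. *)
  have : L^T *m g c1 y1 *m L = (K *m L)^T *m g c (K *m y) *m (K *m L).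
    by rewrite {1}gE trmx_mul !mulmxA.
  by rewrite LL KL trmx1 mul1mx mulmx1.
have phic b P : phi b c1 y1 *m L = L *m P -> phi b c (K *m y) = P.
  move=> bL; have := ef_law (phi b) c1S cS a0 a1; rewrite jK ay aKy phiC// => pE.
  by rewrite -[LHS]mulmx1 -KL mulmxA pE -mulmxA bL mulmxA KL mul1mx.
have [L1 L2 L3] := LF.
have cKy : cimg c (K *m y) by rewrite cic; exists y.
have PhiE b E F : Phi b E F = (E^T *m (phi b c (K *m y) *m F)) 0 0.
  by rewrite /Phi /fundamental_form /bilin gc mulmx1.
have xic b : xi b c (K *m y) = frame R (iz n b).
  have := vf_law (xi b) c1S cS a0 a1; rewrite jK ay aKy xiC// => ->.
  by rewrite -LX mulmxA KL mul1mx.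
split.
(* The one-form is recovered as the metric dual of the Reeb field, here simply a transposed frame
   vector. *)
- move=> b; split => //; have [_ _ -> _] := contact_identities hcos b cS cKy.
  by rewrite gc mulmx1 /dz dcoordE xic.
- split => E F; rewrite PhiE.
  + by rewrite (phic _ _ L1) (phi1_form (K *m y)).
  + by rewrite (phic _ _ L2) (phi2_form (K *m y)).
  + by rewrite (phic _ _ L3) (phi3_form (K *m y)).
- by split; apply: phic.
Qed.
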